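(* Let $n\ge 3$ and let $\boldsymbol{\mu}=(\mu,\nu)$ be a valuated flag matroid of rank $(1,n-1)$ on $[n]$, where $\mu:\binom{[n]}{1}\to\mathbb{R}\cup\{\infty\}$ and $\nu:\binom{[n]}{n-1}\to\mathbb{R}\cup\{\infty\}$. For $i\in[n]$ put $\lambda_i:=\mu(\{i\})+\nu([n]\setminus\{i\})$, and put $\lambda_0=\lambda_{n+1}=\infty$. Then: \begin{enumerate} \item $\boldsymbol{\mu}$ is totally non-negative if and only if $\lambda_i\ge\min(\lambda_{i-1},\lambda_{i+1})$ for every $i\in[n]$. \item $\boldsymbol{\mu}$ induces a Bruhat subdivision if and only if $\lambda_i=\min(\lambda_{i-1},\lambda_{i+1})$ for every $i\in[n]$ such that $\lambda_i=\min(\lambda_1,\dots,\lambda_n)$. \item The following are equivalent: (i) $\boldsymbol{\mu}$ is a valuated flag positroid; (ii) $\boldsymbol{\mu}$ induces a flag positroid subdivision; (iii) $\min_{i\in[n],\ i\text{ odd}}\lambda_i=\min_{i\in[n],\ i\text{ even}}\lambda_i$. \end{enumerate}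
   Context: Conventions: $\mathbb{T}=\mathbb{R}\cup\{\infty\}$, $e_B=\sum_{i\in B}e_i$ for $B\subseteq[n]$. A valuated matroid of rank $d$ on $[n]$ is a function $\mu:\binom{[n]}{d}\to\mathbb{T}$, not identically $\infty$, such that for all $S\in\binom{[n]}{d-1}$, $T\in\binom{[n]}{d+1}$ the minimum of $\mu(S\cup\{t\})+\mu(T\setminus\{t\})$ over $t\in T\setminus S$ is attained at least twice (or is $\infty$). A valuated flag matroid of rank $\mathbf d=(d_1<\dots<d_s)$ is a tuple $(\mu_1,\dots,\mu_s)$ of valuated matroids of ranks $d_j$ such that for all $j<k$, $S\in\binom{[n]}{d_j-1}$, $T\in\binom{[n]}{d_k+1}$, the minimum of $\mu_j(S\cup\{t\})+\mu_k(T\setminus\{t\})$ over $t\in T\setminus S$ is attained at least twice (or is $\infty$). Its support is the flag matroid $\mathbf M=(M_1,\dots,M_s)$, $M_j$ having bases $\{B:\mu_j(B)<\infty\}$, and its polytope is $P_{\mathbf M}=\sum_j\operatorname{conv}\{e_B: B\text{ basis of }M_j\}$. For $x\in\mathbb{R}^n$, the cell $P^x=\sum_j\operatorname{conv}\{e_B:B\text{ minimizes }\mu_j(B)-x\cdot e_B\}$; the (regular mixed) subdivision of $P_{\mathbf M}$ induced by $\boldsymbol\mu$ consists of all cells $P^x$. Positivity: let $K$ be the field of generalized Puiseux series in $t$ with real coefficients, with valuation $\operatorname{val}$ (exponent of the leading term, $\operatorname{val}(0)=\infty$), and $K_{\ge0}$ the set consisting of $0$ and the series with positive leading coefficient. For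 a $d$-dimensional subspace $L\subseteq K^n$, its Plücker coordinates $p_B(L)$, $B\in\binom{[n]}{d}$, are the maximal minors of a $d\times n$ matrix with row span $L$ (defined up to a common nonzero scalar). A flag $L_{d_1}\subset\dots\subset L_{d_s}$ (with $\dim L_{d_j}=d_j$) realizes $\boldsymbol\mu$ if for each $j$, $\mu_j(B)=\operatorname{val}p_B(L_{d_j})+c_j$ for some constant $c_j$. $\boldsymbol\mu$ is a valuated flag positroid if it is realized by a flag all of whose Plücker coordinates can be chosen in $K_{\ge0}$; it is totally non-negative if it is realized by a flag which extends to a complete flag $L_1\subset L_2\subset\dots\subset L_n=K^n$ all of whose Plücker coordinates (in every dimension) can be chosen in $K_{\ge0}$. A flag positroid is a flag matroid realized by a flag of real subspaces whose Plücker coordinates are all $\ge0$; a flag positroid polytope is the polytope of a flag positroid; a flag positroid subdivision is one all of whose cells are flag positroid polytopes. Bruhat polytopes: $\operatorname{Sym}_n$ carries the Bruhat order ($u\le v$ iff a reduced word for $v$ in the adjacent transpositions contains a subword which is a word for $u$). For rank $\mathbf d$ and $x\in\operatorname{Sym}_n$ let $\pi(x)\in\mathbb{R}^n$ have $k$-th coordinate $\#\{j: x(k)\ge n+1-d_j\}$. Call $v$ minimal if it is Bruhat-minimal among all $x$ with $\pi(x)=\pi(v)$. For $u\le v$ with $v$ minimal, the Bruhat polytope is $Q^{\mathbf d}_{u,v}=\operatorname{conv}\{\pi(x):u\le x\le v\}$. A Bruhat subdivision is a subdivision all of whose cells are Bruhat polytopes of rank $\mathbf d$. *)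

(* Defs.v *)
From HB Require Import structures.
From mathcomp Require Import all_boot all_order all_algebra all_fingroup.
From mathcomp Require Import boolp classical_sets functions cardinality fsbigop reals constructive_ereal ereal.
Set Implicit Arguments. Unset Strict Implicit. Unset Printing Implicit Defensive.
Import Order.TTheory GRing.Theory Num.Theory.
Local Open Scope ring_scope.

(* Ground set [n] is 'I_n (element i : 'I_n stands for i+1 in [n]).          *)
(* Subsets B are {set 'I_n}; rank-d valuated matroids are functions          *)
(* {set 'I_n} -> \bar R whose values matter only on d-subsets and which      *)
(* never take the value -oo there (T = R u {oo}).                            *)

Section Valuated.
Variables (R : realType) (n : nat).

Definition min_twice (A : {set 'I_n}) (f : 'I_n -> \bar R) : Prop :=
  (forall t, t \in A -> f t = +oo%E) \/
  exists t1 t2, [/\ t1 \in A, t2 \in A, t1 != t2, f t1 = f t2 &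
                    forall t, t \in A -> (f t1 <= f t)%E].

Definition plucker_rel (d e : nat) (mu nu : {set 'I_n} -> \bar R) : Prop :=
  forall S T : {set 'I_n}, #|S|.+1 = d -> #|T| = e.+1 ->
    min_twice (T :\: S) (fun t => (mu (t |: S) + nu (T :\ t))%E).

Definition valuated_matroid (d : nat) (mu : {set 'I_n} -> \bar R) : Prop :=
  [/\ forall B : {set 'I_n}, #|B| = d -> mu B != -oo%E,
      exists B : {set 'I_n}, #|B| = d /\ mu B != +oo%E
    & plucker_rel d d mu mu].

Definition valuated_flag_matroid2 (d1 d2 : nat) (mu nu : {set 'I_n} -> \bar R) : Prop :=
  [/\ (d1 < d2)%N, valuated_matroid d1 mu, valuated_matroid d2 nu
    & plucker_rel d1 d2 mu nu].

(* Generalized Puiseux series with real coefficients:                        *)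
(*   f : R -> R (coefficient of t^a is f a), with, for every bound b, only    *)
(*   finitely many exponents a <= b in the support (i.e. the support is       *)
(*   finite or a sequence tending to +oo).                                   *)
Definition series := R -> R.

Definition is_series (f : series) : Prop :=
  forall b : R, finite_set [set a | f a != 0 /\ a <= b]%classic.

Definition szero : series := fun _ => 0.
Definition sone : series := fun a => if a == 0 then 1 else 0.
Definition sadd (f g : series) : series := fun a => f a + g a.
Definition sopp (f : series) : series := fun a => - f a.
Definition smul (f g : series) : series :=
  fun c => \sum_(a \in [set a | f a != 0 /\ g (c - a) != 0]%classic) f a * g (c - a).

Definition sval (f : series) : \bar R :=
  ereal_inf [set a%:E | a in [set a | f a != 0]]%classic.

Definition snonneg (f : series) : Prop :=
  (forall a, f a = 0) \/ exists a, 0 < f a /\ forall b, b < a -> f b = 0.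

Definition cols (B : {set 'I_n}) : seq nat := [seq val i | i <- enum B].

(* Maximal minor (rows 0..d-1, columns B) of a matrix over series, by the   *)
(* Leibniz formula.  Matrices are given as nat -> nat -> _, only entries     *)
(* with indices < n being relevant; row i is a vector of K^n.                *)
Definition sminor (A : nat -> nat -> series) (d : nat) (B : {set 'I_n}) : series :=
  \big[sadd/szero]_(s : 'S_d)
     (if odd_perm s then sopp else id)
       (\big[smul/sone]_(i < d) A i (nth 0%N (cols B) (s i))).

Definition series_matrix (A : nat -> nat -> series) : Prop :=
  forall i j, (i < n)%N -> (j < n)%N -> is_series (A i j).

(* the first d rows of A span a d-dimensional subspace L_d *)
Definition srank (A : nat -> nat -> series) (d : nat) : Prop :=
  exists B : {set 'I_n}, #|B| = d /\ sminor A d B <> szero.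

Definition srealizes (A : nat -> nat -> series) (d : nat) (mu : {set 'I_n} -> \bar R) : Prop :=
  srank A d /\ exists c : R, forall B : {set 'I_n}, #|B| = d ->
      mu B = (sval (sminor A d B) + c%:E)%E.

(* the Plücker coordinates of L_d can be chosen in K_{>=0} *)
Definition spositive (A : nat -> nat -> series) (d : nat) : Prop :=
  exists c : series, is_series c /\ c <> szero /\
    forall B : {set 'I_n}, #|B| = d -> snonneg (smul c (sminor A d B)).

Definition valuated_flag_positroid2 (d1 d2 : nat) (mu nu : {set 'I_n} -> \bar R) : Prop :=
  exists A, [/\ series_matrix A, srealizes A d1 mu, srealizes A d2 nu,
                spositive A d1 & spositive A d2].

(* realized by a flag extending to a complete flag L_1 < ... < L_n = K^n, all *)
(* of whose Plücker coordinates can be chosen in K_{>=0}                      *)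
Definition totally_nonnegative2 (d1 d2 : nat) (mu nu : {set 'I_n} -> \bar R) : Prop :=
  exists A, [/\ series_matrix A, srealizes A d1 mu, srealizes A d2 nu &
                forall k, (1 <= k <= n)%N -> srank A k /\ spositive A k].

Definition eB (B : {set 'I_n}) : 'rV[R]_n := \row_(i < n) (i \in B)%:R.

Definition conv (I : finType) (A : {set I}) (p : I -> 'rV[R]_n) : set 'rV[R]_n :=
  [set x | exists w : I -> R,
     [/\ forall i, 0 <= w i, forall i, i \notin A -> w i = 0,
         \sum_(i : I) w i = 1 & x = \sum_(i : I) w i *: p i]]%classic.

Definition minkowski (P Q : set 'rV[R]_n) : set 'rV[R]_n :=
  [set z | exists x y, [/\ P x, Q y & z = x + y]]%classic.

Definition flag_polytope2 (Bs1 Bs2 : {set {set 'I_n}}) : set 'rV[R]_n :=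
  minkowski (conv Bs1 eB) (conv Bs2 eB).

Definition dotB (x : 'rV[R]_n) (B : {set 'I_n}) : R := \sum_(i in B) x 0 i.

Definition argmin_bases (d : nat) (mu : {set 'I_n} -> \bar R) (x : 'rV[R]_n) :
    {set {set 'I_n}} :=
  [set B : {set 'I_n} | (#|B| == d) && [forall B' : {set 'I_n}, (#|B'| == d) ==>
       (mu B - (dotB x B)%:E <= mu B' - (dotB x B')%:E)%E]].

Definition cell2 (d1 d2 : nat) (mu nu : {set 'I_n} -> \bar R) (x : 'rV[R]_n) :
    set 'rV[R]_n :=
  flag_polytope2 (argmin_bases d1 mu x) (argmin_bases d2 nu x).

(* flag positroid polytopes of rank (d1,d2): realized by a real flag       *)
(* (first d1 rows / first d2 rows of A) with nonnegative Plücker coords.   *)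
Definition rminor (A : nat -> nat -> R) (d : nat) (B : {set 'I_n}) : R :=
  \det (\matrix_(i < d, j < d) A i (nth 0%N (cols B) j)).

Definition rpositive_rank (A : nat -> nat -> R) (d : nat) : Prop :=
  (exists B : {set 'I_n}, #|B| = d /\ rminor A d B != 0) /\
  exists c : R, c != 0 /\ forall B : {set 'I_n}, #|B| = d -> 0 <= c * rminor A d B.

Definition rbases (A : nat -> nat -> R) (d : nat) : {set {set 'I_n}} :=
  [set B : {set 'I_n} | (#|B| == d) && (rminor A d B != 0)].

Definition flag_positroid_polytope2 (d1 d2 : nat) (P : set 'rV[R]_n) : Prop :=
  exists A : nat -> nat -> R, [/\ rpositive_rank A d1, rpositive_rank A d2 &
     P = flag_polytope2 (rbases A d1) (rbases A d2)].

Definition flag_positroid_subdivision2 (d1 d2 : nat) (mu nu : {set 'I_n} -> \bar R) : Prop :=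
  forall x, flag_positroid_polytope2 d1 d2 (cell2 d1 d2 mu nu x).

Definition nxt (i : 'I_n) : 'I_n := insubd i i.+1.

Definition word_prod (w : seq 'I_n) : 'S_n := (\prod_(i <- w) tperm i (nxt i))%g.

Definition is_word (w : seq 'I_n) (u : 'S_n) : Prop :=
  all (fun i : 'I_n => (i.+1 < n)%N) w /\ word_prod w = u.

Definition reduced_word (w : seq 'I_n) (v : 'S_n) : Prop :=
  is_word w v /\ forall w', is_word w' v -> (size w <= size w')%N.

Definition bruhat_le (u v : 'S_n) : Prop :=
  exists w, reduced_word w v /\ exists w', subseq w' w /\ is_word w' u.

(* pi(x)_k = #{j : x(k) >= n+1-d_j}  (1-indexed), here 0-indexed *)
Definition piB (d1 d2 : nat) (x : 'S_n) : 'rV[R]_n :=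
  \row_(k < n) ((n - d1 <= x k)%N + (n - d2 <= x k)%N)%:R.

Definition bruhat_minimal (d1 d2 : nat) (v : 'S_n) : Prop :=
  forall x, piB d1 d2 x = piB d1 d2 v -> bruhat_le x v -> x = v.

Definition bruhat_polytope (d1 d2 : nat) (u v : 'S_n) : set 'rV[R]_n :=
  conv [set x : 'S_n | `[< bruhat_le u x /\ bruhat_le x v >] ] (piB d1 d2).

Definition bruhat_subdivision2 (d1 d2 : nat) (mu nu : {set 'I_n} -> \bar R) : Prop :=
  forall x, exists u v, [/\ bruhat_le u v, bruhat_minimal d1 d2 v &
                           cell2 d1 d2 mu nu x = bruhat_polytope d1 d2 u v].

Definition lam (mu nu : {set 'I_n} -> \bar R) (k : nat) : \bar R :=
  if (0 < k <= n)%N then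
    (mu [set i : 'I_n | i.+1 == k] + nu [set i : 'I_n | i.+1 != k])%E
  else +oo%E.

End Valuated.

(* Main.v *)
(* A flag of rank (1, n-1) is a point p of a hyperplane sum_t (-1)^t q_t x_t = 0, where
   the q_t are the Plücker coordinates of the hyperplane; l_t is val (p_t q_t) up to a
   constant. A nonnegative flag is a pair p, q >= 0 with sum_t (-1)^t p_t q_t = 0, and
   leading terms do not cancel within a parity class, whence the condition on parities.

   The flag extends to a complete nonnegative flag if and only if all alternating sums
   s_k = p_(k-1) q_(k-1) - p_(k-2) q_(k-2) + ... are nonnegative: one direction is a sign
   computation with the Desnanot-Jacobi identity, the other an explicit matrix. Then
   p_k q_k = s_(k+1) + s_k has valuation min (val s_(k+1)) (val s_k), and such valuations
   exist exactly when l_k >= min l_(k-1) l_(k+1) for all k.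

   The vertices of a Bruhat polytope record the positions of the largest and of the
   smallest value of the permutations in [u, v]; those of a cell are the pairs i <> j
   in I x J, where I and J are disjoint or meet exactly in the minima of l. If no minimum
   is isolated, take for v the least permutation with largest value at min I and smallest
   value at max J, and u = s * t^-1, where s and t rotate the blocks of two partitions of
   [0, n) into intervals. If the minimum m is isolated, then in every interval realizing
   the cell I = J the largest value can be moved to m+1 or the smallest to m-1. *)
Require Import Defs.
From HB Require Import structures.
From mathcomp Require Import all_boot all_order all_algebra all_fingroup.
From mathcomp Require Import boolp classical_sets functions cardinality fsbigop reals constructive_ereal ereal.
From mathcomp Require Import zify ring lra.
Import Order.TTheory GRing.Theory Num.Theory.
Set Implicit Arguments. Unset Strict Implicit. Unset Printing Implicit Defensive.
Local Open Scope ring_scope.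

(** Positivity in [K] is the order of an integral domain, so realizability becomes a question about
    inequalities; valuations enter because they are antitone on nonnegative elements. The sign
    computation is a proof by contradiction: the Desnanot-Jacobi identity is obtained for nonzero
    determinants, and a wrong sign supplies one. The explicit matrix singles out two columns, the
    first with [q != 0] and the last with [p != 0]; the vanishing of [q] before the one and of [p]
    after the other is what gives all minors of one size the same sign.

    A cell is known through its points [1 + e_i - e_j] with [i <> j]. The centre, where [i = j], is
    invisible, and a single common index of I and J would be ambiguous; the incidence relation
    excludes this.

    The Bruhat order is replaced by a comparison of counts of large values in initial segments,
    where moving one value is a local change. The difficulty is a lower end of the interval that
    admits the prescribed positions and no others. Its two rotations interfere where two of their
    blocks end together, which is why a block for the value 0 starts late at points common to I and
    J. *)

Lemma seq_minimum d (T : orderType d) (x0 : T) (s : seq T) : x0 \in s ->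
  exists2 m, m \in s & forall x, x \in s -> (m <= x)%O.
Proof.
elim: s x0 => // y s IH x0 _.
case: s IH => [|z s] IH.
  by exists y; rewrite ?mem_head // => x; rewrite inE => /eqP->.
have [m ms Hm] := IH z (mem_head _ _).
case: (leP y m) => ym.
  exists y; rewrite ?mem_head // => x; rewrite inE => /orP[/eqP->//|/Hm].
  exact: le_trans.
exists m; first by rewrite inE ms orbT.
by move=> x; rewrite inE => /orP[/eqP->|/Hm//]; exact: ltW.
Qed.

(** * Generalized Puiseux series *)

Section SeriesFunctions.
Variable R : realType.
Implicit Types f g h : series R.

Lemma is_series_seq f b : is_series f ->
  exists2 s : seq R, uniq s & forall a, (a \in s) = (f a != 0) && (a <= b).
Proof.
move=> /(_ b) /finite_seqP [s Es]; exists (undup s); first exact: undup_uniq.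
move=> a; rewrite mem_undup; apply/idP/idP => [as_|/andP[fa ab]].
  have : [set` s]%classic a by [].
  by rewrite -Es => -[-> ->].
have : [set a | f a != 0 /\ a <= b]%classic a by [].
by rewrite Es.
Qed.

Lemma seq_is_series f : (forall b, exists s : seq R,
  forall a, f a != 0 -> a <= b -> a \in s) -> is_series f.
Proof.
move=> H b; have [s Hs] := H b.
apply: (@sub_finite_set _ _ [set` s]); last exact: finite_seq.
by move=> a /= [fa ab]; apply: Hs.
Qed.

Lemma is_series_min f : is_series f -> (exists a, f a != 0) ->
  exists2 a, f a != 0 & forall b, b < a -> f b = 0.
Proof.
move=> sf [a0 fa0]; have [s _ Hs] := is_series_seq a0 sf.
have a0s : a0 \in s by rewrite Hs fa0 lexx.
have [m ms Hm] := seq_minimum a0s.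
have /andP[fm ma0] : (f m != 0) && (m <= a0) by rewrite -Hs.
exists m => // b bm; apply/eqP; apply: contraTT bm => fb.
rewrite -leNgt; case: (leP b a0) => [ba|/ltW]; last exact: le_trans.
by rewrite Hm // Hs fb.
Qed.

Lemma is_series_lb f : is_series f -> exists l, forall a, f a != 0 -> l <= a.
Proof.
move=> sf; case: (pselect (exists a, f a != 0)) => [/(is_series_min sf)[m _ Hm]|H].
  by exists m => a; apply: contraR; rewrite -ltNge => /Hm->; rewrite eqxx.
by exists 0 => a fa; case: H; exists a.
Qed.

Lemma smul_seq f g c (s : seq R) : uniq s ->
  (forall a, f a != 0 -> g (c - a) != 0 -> a \in s) ->
  smul f g c = \sum_(a <- s) f a * g (c - a).
Proof.
move=> us Hs; rewrite /smul.
rewrite (fsbig_widen (T:=R) _ [set` s]); first last.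
- move=> a /= [as_ Na]; apply/eqP; rewrite mulf_eq0.
  by apply: contra_notT Na; rewrite negb_or => /andP[].
- by move=> a /= [fa ga]; apply: Hs.
by rewrite -fsbig_seq.
Qed.

(** With the condition [a + b == c] as an indicator, the convolution is symmetric in its factors,
    and commutativity is an exchange of finite sums. *)
Lemma smul_seq2 f g c (s t : seq R) : uniq s -> uniq t ->
  (forall a, f a != 0 -> g (c - a) != 0 -> a \in s /\ c - a \in t) ->
  smul f g c = \sum_(a <- s) \sum_(b <- t) (f a * g b) *+ (a + b == c).
Proof.
move=> us ut H; rewrite (smul_seq us); last by move=> a fa ga; case: (H a fa ga).
apply: eq_bigr => a _.
case: (boolP (c - a \in t)) => ct.
  rewrite (bigD1_seq (c - a)) //= [a + _]addrC subrK eqxx mulr1n big1 ?addr0 // => b /negPf bc.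
  by case: eqP => // abc; move: bc; rewrite -abc addrAC subrr add0r eqxx.
rewrite [RHS]big_seq big1 => [|b bt]; last first.
  by case: eqP => // abc; move: ct; rewrite -abc addrAC subrr add0r bt.
apply/eqP; rewrite mulf_eq0; apply: contraR ct; rewrite negb_or => /andP[fa ga].
by case: (H a fa ga).
Qed.

Lemma smulC f g c : is_series f -> is_series g -> smul f g c = smul g f c.
Proof.
move=> sf sg; have [lf Hf] := is_series_lb sf; have [lg Hg] := is_series_lb sg.
have [s us Hs] := is_series_seq (c - lg) sf.
have [t ut Ht] := is_series_seq (c - lf) sg.
rewrite (smul_seq2 us ut) ?(smul_seq2 ut us).
- rewrite exchange_big; apply: eq_bigr => b _; apply: eq_bigr => a _.
  by rewrite addrC mulrC.
- move=> a ga fa; have := Hf _ fa; have := Hg _ ga => ? ?.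
  by rewrite Hs Ht ga fa /=; split; lra.
- move=> a fa ga; have := Hf _ fa; have := Hg _ ga => ? ?.
  by rewrite Hs Ht ga fa /=; split; lra.
Qed.

Lemma is_series_smul f g : is_series f -> is_series g -> is_series (smul f g).
Proof.
move=> sf sg; apply: seq_is_series => c.
have [lf Hf] := is_series_lb sf; have [lg Hg] := is_series_lb sg.
have [s us Hs] := is_series_seq (c - lg) sf.
have [t ut Ht] := is_series_seq (c - lf) sg.
exists [seq a + b | a <- s, b <- t] => d fgd dc.
apply: contraNT fgd => dst.
rewrite (smul_seq2 us ut) => [|a fa ga]; last first.
  have := Hf _ fa; have := Hg _ ga => ? ?.
  by rewrite Hs Ht ga fa /=; split; lra.
rewrite big_seq big1 // => a as_; rewrite big_seq big1 // => b bt.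
case: eqP => // abd; case/negP: dst; apply/allpairsP; exists (a, b); split=> //.
Qed.

Lemma smul_neq0 f g c : smul f g c != 0 ->
  exists a, f a != 0 /\ g (c - a) != 0.
Proof.
apply: contraNP => H; rewrite /smul fsbig1 // => a /= fg; case: H; by exists a.
Qed.

(** The list [S] of all sums [a + b] carries the support of the inner product; the sum over [S] then
    collapses to one term. *)
Lemma smul_seq3 f g h d (s t r : seq R) : uniq s -> uniq t -> uniq r ->
  (forall a b c, f a != 0 -> g b != 0 -> h c != 0 -> a + b + c = d ->
     [/\ a \in s, b \in t & c \in r]) ->
  smul (smul f g) h d = \sum_(a <- s) \sum_(b <- t) \sum_(c <- r)
     (f a * g b * h c) *+ (a + b + c == d).
Proof.
move=> us ut ur H; pose S := undup [seq a + b | a <- s, b <- t].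
rewrite (@smul_seq2 _ _ _ S r) ?undup_uniq //; last first.
  move=> e /smul_neq0[a [fa ga]] he.
  have [] := H a (e - a) (d - e) fa ga he; first by ring.
  move=> as_ bt cr; split=> //; rewrite mem_undup; apply/allpairsP.
  by exists (a, e - a); rewrite as_ bt /=; split=> //; ring.
transitivity (\sum_(e <- S) \sum_(c <- r) \sum_(a <- s) \sum_(b <- t)
   (f a * g b * h c) *+ ((a + b == e) && (a + b + c == d))).
  apply: eq_bigr => e _; apply: eq_bigr => c _.
  case: (eqVneq (e + c) d) => [ecd|/negPf ecd]; last first.
    rewrite mulr0n big1 // => a _; rewrite big1 // => b _.
    by case: eqP => [->|_] //=; rewrite ecd.
  case: (eqVneq (h c) 0) => [->|hc].
    by rewrite mulr0 mulr1n big1 // => a _; rewrite big1 // => b _; rewrite mulr0 mul0rn.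
  rewrite mulr1n (@smul_seq2 _ _ _ s t) //; last first.
    move=> a fa ga; have [] := H a (e - a) c fa ga hc; last by [].
    by rewrite -ecd; ring.
  rewrite big_distrl; apply: eq_bigr => a _; rewrite big_distrl; apply: eq_bigr => b _.
  by rewrite /= mulrnAl; case: eqP => [->|_] //=; rewrite ecd eqxx.
rewrite exchange_big /=.
under eq_bigr => c _.
  rewrite exchange_big /=.
  under eq_bigr => a _ do rewrite exchange_big /=.
  over.
rewrite exchange_big /=; rewrite [LHS]big_seq [RHS]big_seq; apply: eq_bigr => a as_.
rewrite exchange_big /=; rewrite [LHS]big_seq [RHS]big_seq; apply: eq_bigr => b bt.
apply: eq_bigr => c _.
have abS : a + b \in S.
  by rewrite mem_undup; apply/allpairsP; exists (a, b); rewrite as_ bt.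
rewrite (bigD1_seq (a + b)) ?undup_uniq //= eqxx big1 ?addr0 // => e.
by rewrite eq_sym => /negPf->.
Qed.

Lemma smulA f g h d : is_series f -> is_series g -> is_series h ->
  smul f (smul g h) d = smul (smul f g) h d.
Proof.
move=> sf sg sh; have [lf Hf] := is_series_lb sf.
have [lg Hg] := is_series_lb sg; have [lh Hh] := is_series_lb sh.
have [s us Hs] := is_series_seq (d - lg - lh) sf.
have [t ut Ht] := is_series_seq (d - lf - lh) sg.
have [r ur Hr] := is_series_seq (d - lf - lg) sh.
have H a b c : f a != 0 -> g b != 0 -> h c != 0 -> a + b + c = d ->
   [/\ a \in s, b \in t & c \in r].
  move=> fa gb hc E; rewrite Hs Ht Hr fa gb hc /=.
  by have := Hf _ fa; have := Hg _ gb; have := Hh _ hc => ? ? ?; split; lra.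
(* Commutativity brings [g * h] to the left, so that both sides are triple sums of the form treated
   by [smul_seq3]. *)
rewrite smulC //; last exact: is_series_smul.
rewrite (smul_seq3 us ut ur H) (@smul_seq3 _ _ _ _ t r s) //; last first.
  by move=> b c a gb hc fa E; have [] := H a b c fa gb hc; first by rewrite -E; ring.
under eq_bigr => b _ do rewrite exchange_big /=.
rewrite exchange_big /=; apply: eq_bigr => a _; apply: eq_bigr => b _.
apply: eq_bigr => c _; congr (_ *+ _); first by ring.
by congr (nat_of_bool (_ == _)); ring.
Qed.

Lemma smul1 f c : is_series f -> smul (@sone R) f c = f c.
Proof.
move=> sf; rewrite (@smul_seq _ _ _ [:: 0]) //.
  by rewrite big_seq1 /sone eqxx mul1r subr0.
by move=> a; rewrite /sone inE; case: (a == 0) => //=; rewrite eqxx.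
Qed.

Lemma is_series_sone : is_series (@sone R).
Proof.
apply: seq_is_series => b; exists [:: 0] => a; rewrite /sone inE.
by case: (a == 0) => //=; rewrite eqxx.
Qed.

Lemma is_series_szero : is_series (@szero R).
Proof. by apply: seq_is_series => b; exists [::] => a; rewrite /szero eqxx. Qed.

Lemma is_series_sadd f g : is_series f -> is_series g -> is_series (sadd f g).
Proof.
move=> sf sg; apply: seq_is_series => b.
have [s _ Hs] := is_series_seq b sf; have [t _ Ht] := is_series_seq b sg.
exists (s ++ t) => a fga ab; rewrite mem_cat Hs Ht ab !andbT -negb_and.
by apply: contra fga => /andP[/eqP fa /eqP ga]; rewrite /sadd fa ga addr0.
Qed.

Lemma is_series_sopp f : is_series f -> is_series (sopp f).
Proof.
move=> sf; apply: seq_is_series => b; have [s _ Hs] := is_series_seq b sf.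
by exists s => a; rewrite /sopp oppr_eq0 Hs => ->.
Qed.

Lemma smulDl f g h c : is_series f -> is_series g -> is_series h ->
  smul (sadd f g) h c = sadd (smul f h) (smul g h) c.
Proof.
move=> sf sg sh; have [l Hl] := is_series_lb sh.
have [s us Hs] := is_series_seq (c - l) sf.
have [t ut Ht] := is_series_seq (c - l) sg.
rewrite /sadd !(@smul_seq _ _ _ (undup (s ++ t))) ?undup_uniq //.
- by rewrite -big_split; apply: eq_bigr => a _; rewrite mulrDl.
- by move=> a fa /Hl ha; rewrite mem_undup mem_cat Ht fa /= orbC; have -> : a <= c - l by lra.
- by move=> a fa /Hl ha; rewrite mem_undup mem_cat Hs fa /=; have -> : a <= c - l by lra.
- move=> a fga /Hl ha; rewrite mem_undup mem_cat Hs Ht.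
  have -> : a <= c - l by lra.
  rewrite !andbT -negb_and; apply: contra fga => /andP[/eqP fa /eqP ga].
  by rewrite fa ga addr0.
Qed.
End SeriesFunctions.

(** The statement works with bare functions; bundled with the finiteness condition they form an
    ordered integral domain, to which the lemmas on determinants apply. *)
Record puiseux (R : realType) := Puiseux {
  coefs :> series R;
  coefsP : is_series coefs }.

Section PuiseuxRing.
Variable R : realType.
Local Notation K := (puiseux R).
Implicit Types x y z : K.

Lemma puiseux_eq x y : (forall a, coefs x a = coefs y a) -> x = y.
Proof.
case: x y => [f sf] [g sg] /= /funext E; subst g.
by rewrite (Prop_irrelevance sf sg).
Qed.

HB.instance Definition _ := gen_eqMixin K.
HB.instance Definition _ := gen_choiceMixin K.

Definition pzero : K := Puiseux (@is_series_szero R).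
Definition pone : K := Puiseux (@is_series_sone R).
Definition padd x y : K := Puiseux (is_series_sadd (coefsP x) (coefsP y)).
Definition popp x : K := Puiseux (is_series_sopp (coefsP x)).
Definition pmul x y : K := Puiseux (is_series_smul (coefsP x) (coefsP y)).

Fact paddA : associative padd.
Proof. by move=> x y z; apply: puiseux_eq => a; exact: addrA. Qed.
Fact paddC : commutative padd.
Proof. by move=> x y; apply: puiseux_eq => a; exact: addrC. Qed.
Fact padd0 : left_id pzero padd.
Proof. by move=> x; apply: puiseux_eq => a; exact: add0r. Qed.
Fact paddN : left_inverse pzero popp padd.
Proof. by move=> x; apply: puiseux_eq => a; exact: addNr. Qed.

HB.instance Definition _ := GRing.isZmodule.Build K paddA paddC padd0 paddN.

Fact pmulA : associative pmul.
Proof.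
move=> x y z; apply: puiseux_eq => a /=.
by apply: smulA; exact: coefsP.
Qed.
Fact pmulC : commutative pmul.
Proof. by move=> x y; apply: puiseux_eq => a; apply: smulC; exact: coefsP. Qed.
Fact pmul1 : left_id pone pmul.
Proof. by move=> x; apply: puiseux_eq => a; apply: smul1; exact: coefsP. Qed.
Fact pmulDl : left_distributive pmul padd.
Proof. by move=> x y z; apply: puiseux_eq => a; apply: smulDl; exact: coefsP. Qed.
Fact pone_neq0 : pone != 0.
Proof.
apply/eqP => /(congr1 (fun x : K => coefs x 0)); rewrite /= /sone eqxx => /eqP.
by rewrite (oner_eq0 R).
Qed.

HB.instance Definition _ :=
  GRing.Zmodule_isComNzRing.Build K pmulA pmulC pmul1 pmulDl pone_neq0.

Lemma coefs0 : coefs (0 : K) = @szero R. Proof. by []. Qed.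
Lemma coefs1 : coefs (1 : K) = @sone R. Proof. by []. Qed.
Lemma coefsD x y : coefs (x + y) = sadd x y. Proof. by []. Qed.
Lemma coefsN x : coefs (- x) = sopp x. Proof. by []. Qed.
Lemma coefsM x y : coefs (x * y) = smul x y. Proof. by []. Qed.

Definition leads x a := coefs x a != 0 /\ forall b, b < a -> coefs x b = 0.

Lemma puiseux_neq0 x : x != 0 -> exists a, leads x a.
Proof.
move=> x0; have [|a xa Ha] := is_series_min (coefsP x).
  apply: contrapT => H; case/eqP: x0; apply: puiseux_eq => a.
  by apply/eqP/negPn/negP => xa; apply: H; exists a.
by exists a.
Qed.

Lemma leads_neq0 x a : leads x a -> x != 0.
Proof. by case=> xa _; apply: contraNneq xa => ->; rewrite coefs0 /szero eqxx. Qed.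

Lemma leadsM x y a b : leads x a -> leads y b ->
  coefs (x * y) (a + b) = coefs x a * coefs y b /\ leads (x * y) (a + b).
Proof.
move=> [xa Ha] [yb Hb].
have E : coefs (x * y) (a + b) = coefs x a * coefs y b.
  rewrite coefsM (@smul_seq _ _ _ _ [:: a]) //; last first.
    move=> c xc yc; rewrite inE; apply/eqP/le_anti/andP; split.
      by rewrite leNgt; apply: contra yc => ac; rewrite Hb //; lra.
    by rewrite leNgt; apply: contra xc => ca; rewrite Ha.
  by rewrite big_seq1 addrAC subrr add0r.
split=> //; split=> [|c cab]; first by rewrite E mulf_neq0.
apply/eqP/negPn/negP => /smul_neq0[d [xd yd]].
have : a <= d by rewrite leNgt; apply: contra xd => /Ha->.
have : b <= c - d by rewrite leNgt; apply: contra yd => /Hb->.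
lra.
Qed.

(** Integral domains are built on rings with units, so the units are declared to be the elements
    that have an inverse; no series is inverted explicitly. *)
Definition punit : pred K := fun x => `[< exists y, y * x = 1 >].
Definition pinv x : K :=
  if pselect (exists y, y * x = 1) is left H then projT1 (cid H) else x.

Fact pmulV : {in punit, left_inverse 1 pinv *%R}.
Proof.
move=> x /asboolP H; rewrite /pinv; case: pselect => // H'.
by case: (cid H').
Qed.
Fact punitP x y : y * x = 1 -> punit x.
Proof. by move=> H; apply/asboolP; exists y. Qed.
Fact pinv_out : {in [predC punit], pinv =1 id}.
Proof.
by move=> x /asboolP H; rewrite /pinv; case: pselect.
Qed.
HB.instance Definition _ :=
  GRing.ComNzRing_hasMulInverse.Build K pmulV punitP pinv_out.

Fact pmulf_eq0 x y : x * y = 0 -> (x == 0) || (y == 0).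
Proof.
move=> xy; apply/negPn/negP; rewrite negb_or => /andP[x0 y0].
have [a xa] := puiseux_neq0 x0; have [b yb] := puiseux_neq0 y0.
by have [_ /leads_neq0] := leadsM xa yb; rewrite xy eqxx.
Qed.
HB.instance Definition _ :=
  GRing.ComUnitRing_isIntegral.Build K pmulf_eq0.

(** The order whose nonnegative cone is [K_{>=0}]; it is total because the leading coefficient is
    real. *)
Definition ple x y := `[< snonneg (y - x) >].
Definition plt x y := (y != x) && ple x y.
Definition pnorm x := if ple 0 x then x else - x.

Lemma snonnegP x : snonneg x <-> x = 0 \/ exists2 a, leads x a & 0 < coefs x a.
Proof.
split=> [[H|[a [xa Ha]]]|[->|[a [_ Ha] xa]]].
- by left; apply: puiseux_eq.
- by right; exists a => //; split=> //; rewrite gt_eqF.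
- by left.
- by right; exists a.
Qed.

Lemma ple0P x : ple 0 x <-> x = 0 \/ exists2 a, leads x a & 0 < coefs x a.
Proof. by rewrite /ple subr0 -snonnegP; split=> /asboolP. Qed.

Lemma leads_uniq x a b : leads x a -> leads x b -> a = b.
Proof.
move=> [xa Ha] [xb Hb]; apply/le_anti; rewrite !leNgt; apply/andP; split.
  by apply: contra xb => /Ha/eqP.
by apply: contra xa => /Hb/eqP.
Qed.

Lemma leadsN x a : leads x a -> leads (- x) a.
Proof.
move=> [xa Ha]; rewrite /leads coefsN /sopp oppr_eq0; split=> // b /Ha ->.
exact: oppr0.
Qed.

Lemma ple0D x y : ple 0 x -> ple 0 y -> ple 0 (x + y).
Proof.
move=> /ple0P[->|[a xa xa0]]; first by rewrite add0r.
move=> /ple0P[->|[b yb yb0]].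
  by rewrite addr0; apply/ple0P; right; exists a.
wlog ab : x y a b xa xa0 yb yb0 / a <= b => [W|].
  by case: (leP a b) => [|/ltW] /W; [|rewrite addrC]; apply.
have pos : 0 < coefs (x + y) a.
  rewrite coefsD /sadd; move: ab; rewrite le_eqVlt => /orP[/eqP ab|ab].
    by rewrite addr_gt0 // ab.
  by rewrite (proj2 yb) // addr0.
apply/ple0P; right; exists a => //; split=> [|c ca]; first by rewrite gt_eqF.
rewrite coefsD /sadd (proj2 xa) // (proj2 yb) ?addr0 //.
exact: lt_le_trans ab.
Qed.

Lemma ple0M x y : ple 0 x -> ple 0 y -> ple 0 (x * y).
Proof.
move=> /ple0P[->|[a xa xa0]]; first by rewrite mul0r => _; apply/ple0P; left.
move=> /ple0P[->|[b yb yb0]]; first by rewrite mulr0; apply/ple0P; left.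
apply/ple0P; right; have [E H] := leadsM xa yb.
by exists (a + b) => //; rewrite E mulr_gt0.
Qed.

Lemma ple_sub x y : ple 0 (y - x) = ple x y.
Proof. by rewrite /ple subr0. Qed.

Lemma ple0_anti x : ple 0 x -> ple x 0 -> x = 0.
Proof.
rewrite -(ple_sub x) sub0r => /ple0P[//|[a xa xa0]] /ple0P[/eqP|[b xb]].
  by rewrite oppr_eq0 => /eqP.
have -> := leads_uniq xb (leadsN xa).
by rewrite coefsN /sopp oppr_gt0 => /(lt_trans xa0); rewrite ltxx.
Qed.

Lemma ple0_total x : ple 0 x || ple x 0.
Proof.
apply/orP; have [->|/puiseux_neq0[a xa]] := eqVneq x 0; first by left; apply/ple0P; left.
case: (ltgtP (coefs x a) 0) => xa0; last by case: xa; rewrite xa0 eqxx.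
  right; rewrite -ple_sub sub0r; apply/ple0P; right; exists a; first exact: leadsN.
  by rewrite coefsN /sopp oppr_gt0.
by left; apply/ple0P; right; exists a.
Qed.

Lemma pnormN x : pnorm (- x) = pnorm x.
Proof.
rewrite /pnorm; case: ifP => Hn; case: ifP => Hp; rewrite ?opprK //.
  have := ple0_anti Hp; rewrite -ple_sub sub0r => /(_ Hn)->; exact: oppr0.
by have := ple0_total x; rewrite Hp -ple_sub sub0r Hn.
Qed.

Lemma pge0_norm x : ple 0 x -> pnorm x = x.
Proof. by rewrite /pnorm => ->. Qed.

Lemma plt_def x y : plt x y = (y != x) && ple x y.
Proof. by []. Qed.

HB.instance Definition _ := Num.IntegralDomain_isLeReal.Build K
  ple0D ple0M ple0_anti ple_sub ple0_total pnormN pge0_norm plt_def.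

Lemma pos_leads x : 0 < x <-> exists2 a, leads x a & 0 < coefs x a.
Proof.
split=> [|[a xa xa0]]; last first.
  by rewrite lt_def (leads_neq0 xa) /=; apply/ple0P; right; exists a.
rewrite lt_def => /andP[x0 /ple0P[/eqP|//]]; by rewrite (negPf x0).
Qed.

Lemma snonneg_ge0 x : snonneg x <-> 0 <= x.
Proof. by rewrite snonnegP -ple0P. Qed.

Definition vval x : \bar R := Defs.sval x.

Lemma vval0 : vval 0 = +oo%E.
Proof.
rewrite /vval /Defs.sval; suff -> : [set a | coefs (0:K) a != 0]%classic = set0.
  by rewrite image_set0 ereal_inf0.
by apply/seteqP; split=> a // /eqP; case.
Qed.

Lemma vval_leads x a : leads x a -> vval x = a%:E.
Proof.
move=> [xa Ha]; apply/le_anti/andP; split; rewrite /vval /Defs.sval.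
  by apply: ereal_inf_lbound; exists a.
apply: le_ereal_inf_tmp => _ [b /= xb <-]; rewrite lee_fin leNgt.
by apply: contra xb => /Ha->.
Qed.

Lemma vval_eqy x : (vval x == +oo%E) = (x == 0).
Proof.
have [->|/puiseux_neq0[a /vval_leads->]] := eqVneq x 0; first by rewrite vval0.
by [].
Qed.

Lemma vval_Ny x : vval x != -oo%E.
Proof.
by have [->|/puiseux_neq0[a /vval_leads->]] := eqVneq x 0; rewrite ?vval0.
Qed.

Lemma vvalM x y : vval (x * y) = (vval x + vval y)%E.
Proof.
have [->|/puiseux_neq0[a xa]] := eqVneq x 0.
  by rewrite mul0r vval0 addye // vval_Ny.
have [->|/puiseux_neq0[b yb]] := eqVneq y 0.
  by rewrite mulr0 vval0 addey // vval_Ny.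
have [_ xyab] := leadsM xa yb.
by rewrite (vval_leads xa) (vval_leads yb) (vval_leads xyab).
Qed.

Lemma vvalN x : vval (- x) = vval x.
Proof.
have [->|/puiseux_neq0[a xa]] := eqVneq x 0; first by rewrite oppr0.
by rewrite (vval_leads xa) (vval_leads (leadsN xa)).
Qed.

Lemma vval_ge x (l : R) : (l%:E <= vval x)%E <-> forall b, b < l -> coefs x b = 0.
Proof.
have [->|/puiseux_neq0[a xa]] := eqVneq x 0.
  by rewrite vval0; split=> [_ b _|_]; rewrite ?leey // coefs0.
rewrite (vval_leads xa) lee_fin; split=> [la b bl|H].
  by apply: (proj2 xa); exact: lt_le_trans la.
by rewrite leNgt; apply/negP => /H /eqP; rewrite (negPf (proj1 xa)).
Qed.

Lemma vvalD x y : (Order.min (vval x) (vval y) <= vval (x + y)%R)%E.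
Proof.
have [->|] := eqVneq x 0; first by rewrite add0r ge_min lexx orbT.
move=> /puiseux_neq0[a xa]; rewrite (vval_leads xa).
have [->|] := eqVneq y 0; first by rewrite addr0 (vval_leads xa) ge_min lexx.
move=> /puiseux_neq0[b yb]; rewrite (vval_leads yb) -EFin_min.
apply/vval_ge => c; rewrite lt_min => /andP[ca cb].
by rewrite coefsD /sadd (proj2 xa) // (proj2 yb) // addr0.
Qed.

(** If [x] had the smaller leading exponent, the leading term of [y - x] would be that of [- x],
    which is negative. Hence no cancellation can occur between nonnegative series. *)
Lemma vval_anti x y : 0 <= x -> x <= y -> (vval y <= vval x)%E.
Proof.
move=> x0 xy; have [->|y0] := eqVneq x 0; first by rewrite vval0 leey.
have {x0 y0} /pos_leads[a xa xa0] : 0 < x by rewrite lt_def y0.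
have /pos_leads[b yb yb0] : 0 < y by apply: lt_le_trans xy; apply/pos_leads; exists a.
rewrite (vval_leads xa) (vval_leads yb) lee_fin leNgt; apply/negP => ab.
move: xy; rewrite -subr_ge0 => /ple0P[/subr0_eq E|[c [yxc Hc]]].
  by move: xa0; rewrite -E (proj2 yb) // ltxx.
have ca : c = a.
  apply: (@leads_uniq (y - x)) => //; split=> [|d da].
    by rewrite coefsD coefsN /sadd /sopp (proj2 yb) // add0r oppr_eq0; case: xa.
  by rewrite coefsD coefsN /sadd /sopp (proj2 yb) ?(proj2 xa) ?subr0 //; exact: lt_trans ab.
rewrite ca coefsD coefsN /sadd /sopp (proj2 yb) // add0r oppr_gt0 => /(lt_trans xa0).
by rewrite ltxx.
Qed.

Lemma vvalD_ge0 x y : 0 <= x -> 0 <= y ->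
  vval (x + y) = Order.min (vval x) (vval y).
Proof.
move=> x0 y0; apply/le_anti; rewrite vvalD andbT le_min.
by rewrite !vval_anti ?lerDl ?lerDr.
Qed.

Lemma is_series_mono (a : R) : is_series (fun b => if b == a then 1 else 0).
Proof.
apply: seq_is_series => b; exists [:: a] => c; rewrite inE.
by case: (c == a) => //=; rewrite eqxx.
Qed.

Definition mono (a : R) : K := Puiseux (is_series_mono a).

Definition monoe (a : \bar R) : K := if a is a%:E%E then mono a else 0.

Lemma mono_leads a : leads (mono a) a.
Proof.
by split=> [|b /lt_eqF /=]; rewrite /= ?eqxx ?oner_eq0 // => ->.
Qed.

Lemma vval_mono a : vval (mono a) = a%:E.
Proof. exact/vval_leads/mono_leads. Qed.

Lemma mono_gt0 a : 0 < mono a.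
Proof. by apply/pos_leads; exists a; [exact: mono_leads | rewrite /= eqxx]. Qed.

Lemma vval_monoe a : a != -oo%E -> vval (monoe a) = a.
Proof. by case: a => [a||] //= _; rewrite ?vval_mono ?vval0. Qed.

Lemma monoe_ge0 a : 0 <= monoe a.
Proof. by case: a => [a||] //=; exact/ltW/mono_gt0. Qed.

Lemma monoM a b : mono a * mono b = mono (a + b).
Proof.
apply: puiseux_eq => c; rewrite coefsM (@smul_seq _ _ _ _ [:: a]) //.
  by rewrite big_seq1 /= eqxx mul1r subr_eq [b + a]addrC.
by move=> d; rewrite inE /=; case: (d == a) => //=; rewrite eqxx.
Qed.

(** The ultrametric inequality, iterated. The second alternative is there for the empty sum, which
    has no summand to offer. *)
Lemma vval_sum_le_seq (I : eqType) (s : seq I) (P : pred I) (F : I -> K) :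
  (exists2 i, (i \in s) && P i & (vval (F i) <= vval (\sum_(i <- s | P i) F i)%R)%E) \/
  \sum_(i <- s | P i) F i = 0.
Proof.
elim: s => [|j s IH]; first by right; rewrite big_nil.
rewrite big_cons; case: ifP => Pj; last first.
  case: IH => [[i /andP[si Pi] H]|->]; [left|by right].
  by exists i => //; rewrite inE si orbT.
case: IH => [[i /andP[si Pi] H]|->]; left; last first.
  by exists j; rewrite ?mem_head ?Pj // addr0.
have := vvalD (F j) (\sum_(k <- s | P k) F k); rewrite ge_min => /orP[Hj|Hs].
  by exists j => //; rewrite mem_head.
by exists i; rewrite ?inE ?si ?Pi ?orbT //; exact: le_trans H Hs.
Qed.
End PuiseuxRing.

(** * Minors and total nonnegativity *)

Definition incr (d : nat) (g : nat -> nat) :=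
  forall i j, (i < j < d)%N -> (g i < g j)%N.

Section Minors.
Variable F : comNzRingType.
Implicit Types (A : nat -> nat -> F) (g : nat -> nat).

(** Columns are chosen by a function on [nat]: deleting the column number [t] is composition with
    [bump t], without casts between dimensions. *)
Definition mnr A d g : F := \det (\matrix_(i < d, j < d) A i (g j)).

Lemma eq_mnr A A' d g g' :
  (forall i j, (i < d)%N -> (j < d)%N -> A i (g j) = A' i (g' j)) ->
  mnr A d g = mnr A' d g'.
Proof. by move=> H; congr (\det _); apply/matrixP => i j; rewrite !mxE H. Qed.

Lemma mnr_last A d g :
  mnr A d.+1 g = \sum_(t < d.+1) A d (g t) * ((-1) ^+ (d + t) * mnr A d (g \o bump t)).
Proof.
rewrite /mnr (expand_det_row _ ord_max); apply: eq_bigr => t _.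
rewrite mxE; congr (_ * _); rewrite /cofactor; congr (_ * \det _).
apply/matrixP => i j; rewrite !mxE /=; congr (A _ _).
by rewrite /bump leqNgt ltn_ord.
Qed.

Lemma mnr_first A d g :
  mnr A d.+1 g =
  \sum_(t < d.+1) (-1) ^+ t * (A 0%N (g t) * mnr (fun i => A i.+1) d (g \o bump t)).
Proof.
rewrite /mnr (expand_det_row _ ord0); apply: eq_bigr => t _.
rewrite mxE mulrCA; congr (_ * _); rewrite /cofactor /=; congr (_ * _); congr (\det _).
by apply/matrixP => i j; rewrite !mxE /=.
Qed.

Lemma mnr_alt A d g i1 i2 : (i1 < d)%N -> (i2 < d)%N -> i1 != i2 ->
  (forall j, (j < d)%N -> A i1 (g j) = A i2 (g j)) -> mnr A d g = 0.
Proof.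
move=> h1 h2 ne H.
apply: (@determinant_alternate _ _ _ (Ordinal h1) (Ordinal h2)) => // j.
by rewrite !mxE H.
Qed.

Lemma mnr_col0 A d g j0 : (j0 < d)%N ->
  (forall i, (i < d)%N -> A i (g j0) = 0) -> mnr A d g = 0.
Proof.
move=> h H; rewrite /mnr (expand_det_col _ (Ordinal h)) big1 // => i _.
by rewrite mxE H ?mul0r.
Qed.

Lemma mnr0 A g : mnr A 0 g = 1. Proof. exact: det_mx00. Qed.

Lemma mnr1 A g : mnr A 1 g = A 0%N (g 0%N).
Proof. by rewrite /mnr det_mx11 mxE. Qed.

Lemma mnr_rowscale A d g (e : nat -> F) :
  mnr (fun i j => e i * A i j) d g = (\prod_(i < d) e i) * mnr A d g.
Proof.
transitivity (\det (diag_mx (\row_(i < d) e i) *m \matrix_(i < d, j < d) A i (g j))).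
  by congr (\det _); apply/matrixP => i j; rewrite mul_diag_mx !mxE.
by rewrite det_mulmx det_diag; congr (_ * _); apply: eq_bigr => i _; rewrite mxE.
Qed.

Definition setrow A k (w : nat -> F) : nat -> nat -> F :=
  fun i j => if i == k then w j else A i j.

Lemma mnr_setrow A d w g :
  mnr (setrow A d w) d.+1 g =
  \sum_(t < d.+1) w (g t) * ((-1) ^+ (d + t) * mnr A d (g \o bump t)).
Proof.
rewrite mnr_last; apply: eq_bigr => t _; rewrite /setrow eqxx.
do 2!congr (_ * _); apply: eq_mnr => i j id _; by rewrite ltn_eqF.
Qed.

(** This is the expansion of a determinant whose last row repeats row [i]. *)
Lemma mnr_cramer A d g i : (i < d)%N ->
  \sum_(t < d.+1) A i (g t) * ((-1) ^+ (d + t) * mnr A d (g \o bump t)) = 0.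
Proof.
move=> id; rewrite -mnr_setrow; apply: (@mnr_alt _ _ _ i d) => //.
- exact: ltnW.
- by rewrite ltn_eqF.
- by move=> j _; rewrite /setrow eqxx ltn_eqF.
Qed.

(* L_1 is contained in L_(n-1). *)
Lemma incidence A d : (0 < d)%N ->
  \sum_(t < d.+1) (-1) ^+ t * (A 0%N t * mnr A d (bump t)) = 0.
Proof.
move=> d0; apply: (@lreg_sign F d).
rewrite mulr0 -[RHS](@mnr_cramer A d id 0 d0) big_distrr; apply: eq_bigr => t _ /=.
by rewrite exprD /comp; ring.
Qed.
End Minors.

Lemma incr_bump d g t : incr d.+1 g -> incr d (g \o bump t).
Proof. move=> H i j ij /=; apply: H; rewrite /bump; lia. Qed.

Section Nonnegative.
Variable F : realDomainType.
Implicit Types (A : nat -> nat -> F) (g : nat -> nat).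

(* The Desnanot-Jacobi identity for the last two rows, when the determinant is
   nonzero. *)
Lemma jacobi A m w g i j : (i < j < m.+2)%N ->
  let D := mnr (setrow A m.+1 w) m.+2 g in
  let y t := mnr A m.+1 (g \o bump t) in
  let f t := mnr (setrow A m w) m.+1 (g \o bump t) in
  D != 0 -> f i * y j - y i * f j = D * mnr A m (g \o bump i \o bump j.-1).
Proof.
move=> /andP[ij jm] D y f bot_start0.
have im : (i < m.+2)%N by lia.
pose N := \matrix_(a < m.+2, b < m.+2) setrow A m.+1 w a (g b).
have DE : \det N = D by [].
pose rm : 'I_m.+2 := inord m.
have rmE : rm = m :> nat by rewrite inordK.
have alE t : cofactor N ord_max t = (-1) ^+ (m.+1 + t) * y t.
  rewrite /cofactor; congr (_ * \det _); apply/matrixP => a b; rewrite !mxE /=.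
  have am : (a < m.+1)%N by have := ltn_ord a.
  by rewrite /setrow /bump leqNgt am ltn_eqF.
have beE t : cofactor N rm t = (-1) ^+ (m + t) * f t.
  rewrite /cofactor rmE; congr (_ * \det _); apply/matrixP => a b; rewrite !mxE /=.
  rewrite /setrow rmE /bump; case: (ltngtP a m) => am /=.
  - by rewrite add0n ltn_eqF //; lia.
  - by have := ltn_ord a; lia.
  - by rewrite am eqxx.
(* [dl] collects the signed minors on the first [m] rows with column [i] and one more column
   deleted; pairing it with a row [u] expands the minor that has [u] as its last row. *)
pose dl := \col_(b < m.+2) (if unlift (Ordinal im) b is Some t
   then (-1) ^+ (m + t) * mnr A m (g \o bump i \o bump t) else 0) : 'cV[F]_m.+2.
have dlS u : \sum_(b < m.+2) u b * dl b 0 = \sum_(t < m.+1) u (lift (Ordinal im) t) *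
    ((-1) ^+ (m + t) * mnr A m (g \o bump i \o bump t)).
  rewrite (bigD1_ord (Ordinal im)) //= mxE unlift_none mulr0 add0r.
  by apply: eq_bigr => t _; rewrite mxE liftK.
have f_last u : \sum_(b < m.+2) u (g b) * dl b 0 = mnr (setrow A m u) m.+1 (g \o bump i).
  by rewrite dlS mnr_setrow.
(* A combination of two columns of the adjugate whose entry at [i] is zero. At most two entries of
   [N *m h] are nonzero, and [dl] reproduces them up to a factor [D] and a sign; since [D] is
   nonzero, [N] can be cancelled, and the entry at [j] is the identity. *)
pose h := \col_(b < m.+2) (cofactor N ord_max (Ordinal im) * cofactor N rm b
    - cofactor N rm (Ordinal im) * cofactor N ord_max b) : 'cV[F]_m.+2.
have cof a b : \sum_(t < m.+2) N a t * cofactor N b t = D *+ (a == b).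
  have := congr1 (fun M : 'M_m.+2 => M a b) (mul_mx_adj N).
  rewrite !mxE -DE => <-; apply: eq_bigr => t _; rewrite !mxE; reflexivity.
have Nh : N *m h = N *m (((-1) ^+ (m.+1 + i) * D) *: dl).
  apply/matrixP => a0 k; rewrite (ord1 k) {k} !mxE; move: a0 => a.
  transitivity (cofactor N ord_max (Ordinal im) * (D *+ (a == rm)) -
     cofactor N rm (Ordinal im) * (D *+ (a == ord_max))).
    rewrite -!cof !big_distrr -sumrB /=; apply: eq_bigr => t _.
    by rewrite [h t 0]mxE; ring.
  transitivity ((-1) ^+ (m.+1 + i) * D * \sum_(b < m.+2) setrow A m.+1 w a (g b) * dl b 0);
    last first.
    by rewrite big_distrr; apply: eq_bigr => t _ /=; rewrite !mxE; ring.
  rewrite f_last alE beE /=.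
  have [am|am] := eqVneq a rm.
    rewrite am -val_eqE /= rmE ltn_eqF // mulr0n mulr0 subr0 mulr1n.
    rewrite (_ : mnr _ _ _ = y i); first by ring.
    apply: eq_mnr => a' b' ha' _; rewrite /setrow; case: eqP => [->|//].
    by rewrite ltn_eqF.
  have [aM|aM] := eqVneq a ord_max.
    rewrite aM /= mulr0n mulr0 sub0r mulr1n.
    rewrite (_ : mnr _ _ _ = f i); first by rewrite addSn exprS; ring.
    by apply: eq_mnr => a' b' _ _; rewrite /setrow eqxx.
  have {am aM} am : (a < m)%N.
    have := ltn_ord a; move: am aM; rewrite -!val_eqE /= rmE; lia.
  rewrite !mulr0n !mulr0 subr0 (@mnr_alt _ _ _ _ a m) ?mulr0 //.
  - by lia.
  - by rewrite ltn_eqF.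
  - by move=> b' _; rewrite /setrow eqxx ltn_eqF // ltn_eqF //; lia.
have {Nh} /matrixP/(_ (Ordinal jm) 0) : h = ((-1) ^+ (m.+1 + i) * D) *: dl.
  apply/matrixP => a b; apply: (mulfI bot_start0).
  have := congr1 (fun M : 'cV_m.+2 => (\adj N *m M) a b) Nh.
  rewrite !mulmxA mul_adj_mx !mul_scalar_mx DE.
  by rewrite [LHS]mxE [RHS]mxE.
have jE : Ordinal jm = lift (Ordinal im) (inord j.-1).
  by apply: val_inj => /=; rewrite inordK /bump; lia.
rewrite !mxE [in unlift _ _]jE liftK !alE !beE /= inordK; last by lia.
move=> E.
apply: (@mulfI _ ((-1) ^+ (i + j))); first by rewrite signr_eq0.
have s2 k : (-1) ^+ k * (-1) ^+ k = 1 :> F by rewrite -expr2 sqrr_sign.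
have -> : (-1) ^+ (i + j) * (f i * y j - y i * f j) =
   - ((-1) ^+ m * (-1) ^+ m) * ((-1) ^+ i * (-1) ^+ j * (y i * f j - f i * y j)).
  by rewrite s2 exprD; ring.
transitivity ((-1) ^+ (m.+1 + i) * y i * ((-1) ^+ (m + j) * f j) -
    (-1) ^+ (m + i) * f i * ((-1) ^+ (m.+1 + j) * y j)).
  by rewrite !exprD exprS; ring.
rewrite E; case: j {jm jE E} ij => // j _ /=; rewrite !exprD !exprS.
transitivity (((-1) ^+ m * (-1) ^+ m) * (- (-1) ^+ i * (-1) ^+ j * (D * mnr A m (g \o bump i \o bump j)))).
  by ring.
by rewrite s2; ring.
Qed.
End Nonnegative.

(** * Alternating sums of a totally nonnegative flag *)

Section TotallyNonnegative.
Variable F : realDomainType.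
Implicit Types (A : nat -> nat -> F) (g : nat -> nat).

Definition tnn A n := forall d g, (d <= n)%N -> incr d g ->
  (forall j, (j < d)%N -> (g j < n)%N) -> 0 <= mnr A d g.

Lemma exists_neq0_sum m (u v : nat -> F) :
  \sum_(t < m) u t * v t != 0 -> exists t, [/\ (t < m)%N, u t != 0 & v t != 0].
Proof.
move=> H; apply: contrapT => K; case/eqP: H; rewrite big1 // => t _.
apply/eqP; rewrite mulf_eq0; apply: contrapT => /negP; rewrite negb_or => /andP[ut vt].
by apply: K; exists t.
Qed.

(* The sign of the Plücker coordinates of the span of the first m rows and of
   the truncation of the first row to the columns below k; r is the number of
   selected columns that lie below k. *)
Lemma tnn_truncated A n k m g r : tnn A n -> (m < n)%N -> incr m.+1 g ->
  (forall j, (j < m.+1)%N -> (g j < n)%N) ->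
  (r <= m.+1)%N -> (forall j, (j < m.+1)%N -> (g j < k)%N = (j < r)%N) ->
  0 <= (-1) ^+ (r + m).+1 *
       mnr (setrow A m (fun j => if (j < k)%N then A 0%N j else 0)) m.+1 g.
Proof.
move=> tA; set w := fun j => _.
elim: m g r => [|m IH] g r mn ig gn rm gk; last first.
(* A determinant of the wrong sign is nonzero, so the Desnanot-Jacobi identity becomes available. *)
set D := mnr _ _ _; rewrite leNgt; apply/negP => Dneg.
have bot_start0 : D != 0 by apply: contraTneq Dneg => ->; rewrite mulr0 ltxx.
pose y t := mnr A m.+1 (g \o bump t).
pose f t := mnr (setrow A m w) m.+1 (g \o bump t).
have bl t j : (j < m.+1)%N -> (bump t j < m.+2)%N by rewrite /bump; lia.
have y_ge0 t : 0 <= y t.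
  by apply: tA; [lia|exact: incr_bump|move=> j jm; apply: gn; exact: bl].
have f_ge0 t : (t < m.+2)%N -> 0 <= (-1) ^+ (r - (t < r)%N + m).+1 * f t.
  move=> tm; apply: IH; [lia|exact: incr_bump| | |].
  - by move=> j jm; apply: gn; exact: bl.
  - by case: ltnP; lia.
  - by move=> j jm; rewrite /= gk ?bl // /bump; case: leqP; case: ltnP; lia.
have expw : \sum_(t < m.+2) w (g t) * ((-1) ^+ (m.+1 + t) * y t) = D.
  by rewrite -mnr_setrow.
(* [D] is its own expansion along the truncated row, so some column below [k] contributes. *)
have [i [im wi yi]] : exists i, [/\ (i < m.+2)%N, (i < r)%N & y i != 0].
  have [|i [im wi]] := @exists_neq0_sum m.+2 (fun t => w (g t))
     (fun t => (-1) ^+ (m.+1 + t) * y t); first by rewrite expw.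
  rewrite mulf_eq0 signr_eq0 /= => yi; exists i; split=> //.
  by rewrite -gk //; apply: contraNT wi => /negPf; rewrite /w => ->.
(* The whole first row expands to zero, being a repeated row; the part cut off expands to [- D], so
   some column from [k] on contributes too. *)
have [j [jm rj yj]] : exists j, [/\ (j < m.+2)%N, (r <= j)%N & y j != 0].
  have exp0 := mnr_cramer A g (ltn0Sn m).
  have [|j [jm]] := @exists_neq0_sum m.+2 (fun t => A 0%N (g t) - w (g t))
     (fun t => (-1) ^+ (m.+1 + t) * y t).
    under eq_bigr do rewrite mulrBl.
    by rewrite sumrB expw exp0 sub0r oppr_eq0.
  rewrite mulf_eq0 signr_eq0 /= => wj yj; exists j; split=> //.
  rewrite leqNgt; apply: contraNN wj; rewrite -gk // /w => ->.
  by rewrite subrr.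
(* By induction both terms on the right of [E] are nonnegative, whereas the Jacobi identity and the
   assumed sign of [D] make their sum nonpositive. *)
have key a b : (a < r)%N -> (r <= b < m.+2)%N ->
    f a * y b = 0 /\ y a * f b = 0.
  move=> ar /andP[rb bm]; have am : (a < m.+2)%N by lia.
  have := @jacobi F A m w g a b; rewrite -/D bm andbT => /(_ _ bot_start0) J.
  have {}J := J ltac:(lia).
  have := f_ge0 a am; have := f_ge0 b bm; rewrite ar ltnNge rb /= subn0 subn1 => fb fa.
  have p0 : 0 <= mnr A m (g \o bump a \o bump b.-1).
    apply: tA; [lia|apply: incr_bump; exact: incr_bump|].
    move=> c cm; apply: gn => /=; move: ar rb bm am cm; rewrite /bump; lia.
  have E : (-1) ^+ (r + m.+1).+1 * (f a * y b - y a * f b) =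
     y b * ((-1) ^+ (r.-1 + m).+1 * f a) + y a * ((-1) ^+ (r + m).+1 * f b).
    by case: (r) ar => // r' _ /=; rewrite !addSn !addnS !exprS; ring.
  have : 0 <= y b * ((-1) ^+ (r.-1 + m).+1 * f a) by apply: mulr_ge0.
  have : 0 <= y a * ((-1) ^+ (r + m).+1 * f b) by apply: mulr_ge0.
  have : y b * ((-1) ^+ (r.-1 + m).+1 * f a) + y a * ((-1) ^+ (r + m).+1 * f b) <= 0.
    by rewrite -E J mulrA mulr_le0_ge0 // ltW.
  move=> h1 h2 h3.
  have /eqP : y b * ((-1) ^+ (r.-1 + m).+1 * f a) = 0 by apply/le_anti; lra.
  have /eqP : y a * ((-1) ^+ (r + m).+1 * f b) = 0 by apply/le_anti; lra.
  rewrite !mulf_eq0 !signr_eq0 /= => /orP[/eqP->|/eqP->] /orP[/eqP->|/eqP->];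
  by rewrite ?mul0r ?mulr0.
have f0 t : (t < m.+2)%N -> f t = 0.
  move=> tm; case: (ltnP t r) => tr.
    have [/eqP] := key t j tr ltac:(by rewrite rj jm).
    by rewrite mulf_eq0 (negPf yj) orbF => /eqP.
  have [_ /eqP] := key i t wi ltac:(by rewrite tr tm).
  by rewrite mulf_eq0 (negPf yi) => /eqP.
(* The vanishing numbers [f t] are, up to sign, the cofactors of row [m], so [D] is zero after
   all. *)
case/eqP: bot_start0; rewrite /D /mnr (expand_det_row _ (inord m)) big1 // => t _.
rewrite /cofactor (_ : \det _ = f t); first by rewrite f0 // !mulr0.
rewrite /f /mnr; congr (\det _).
apply/matrixP => a b; rewrite !mxE /= inordK //.
rewrite /setrow /bump; case: (ltngtP a m) => am /=.
- by rewrite add0n ltn_eqF // leqW.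
- by have := ltn_ord a; lia.
- by rewrite am eqxx.
rewrite mnr1 /setrow eqxx /w gk //.
case: r rm gk => [|[|r]] // _ _; rewrite -signr_odd /= mul1r -(mnr1 A).
apply: tA => // j; rewrite ltnS leqn0 => /eqP->; exact: gn.
Qed.

Definition alternating_sum (c : nat -> F) k : F := \sum_(t < k) (-1) ^+ (k.-1 + t) * c t.

Lemma alternating_sumS c k :
  alternating_sum c k.+1 = c k - alternating_sum c k.
Proof.
rewrite /alternating_sum big_ord_recr /= addnn -signr_odd odd_double mul1r addrC.
congr (_ + _); rewrite -sumrN; apply: eq_bigr => t _.
by case: k t => [[]//|k] t /=; rewrite addSn exprS; ring.
Qed.

(** The case of [tnn_truncated] in which every column is chosen: expansion along the truncated row
    keeps the first [k] terms of the incidence relation. *)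
Lemma tnn_alternating_sum A n k : tnn A n.+1 -> (k <= n.+1)%N -> (0 < n)%N ->
  0 <= alternating_sum (fun t => A 0%N t * mnr A n (bump t)) k.
Proof.
move=> tA kn n0.
have := @tnn_truncated A n.+1 k n id k tA (ltnSn n).
rewrite mnr_setrow => H.
have {H} := H _ (fun j jn => jn) kn (fun j _ => erefl).
have ii : incr n.+1 id by move=> i j /andP[].
move=> /(_ ii); congr (_ <= _).
rewrite /alternating_sum (big_ord_widen_cond n.+1 predT (fun t : nat =>
  (-1) ^+ (k.-1 + t) * (A 0%N t * mnr A n (bump t)))) // big_distrr [in RHS]big_mkcond /=.
apply: eq_bigr => t _; case: ifP => tk; last by rewrite mul0r mulr0.
case: k tk kn => // k _ _.
rewrite mulrCA [RHS]mulrCA; congr (_ * _); rewrite mulrA -exprD; congr (_ * _).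
rewrite -[LHS]signr_odd -[RHS]signr_odd; congr (_ ^+ nat_of_bool _).
by rewrite /= !(oddD, oddS) /=; case: (odd k); case: (odd n); case: (odd t).
Qed.

(** Indexed like [l]: the value 0 outside the range stands for the convention that [l_0] and
    [l_(n+1)] are infinite. *)
Definition weight A n t := if (0 < t <= n.+1)%N then A 0%N t.-1 * mnr A n (bump t.-1) else 0.

(** In terms of the alternating sums, the weight at [k + 1] is [a (k + 1) + a k]; each of the two
    summands also occurs in one neighbouring weight, beside another nonnegative one. At the ends
    [a 0] is an empty sum and [a (n + 1)] is zero by incidence. *)
Lemma tnn_neighbours A n i : tnn A n.+1 -> (0 < n)%N -> (i <= n)%N ->
  weight A n i.+1 <= weight A n i + weight A n i.+2.
Proof.
move=> tA n0 ii; pose a : nat -> F := alternating_sum (fun t => A 0%N t * mnr A n (bump t)).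
pose c := weight A n; rewrite -/(c i) -/(c i.+1) -/(c i.+2).
have a_ge0 k : (k <= n.+1)%N -> 0 <= a k by move=> kn; apply: tnn_alternating_sum.
have a0 : a 0%N = 0 by rewrite /a /alternating_sum big_ord0.
have an : a n.+1 = 0.
  rewrite /a /alternating_sum /=; apply: (@lreg_sign F n).
  rewrite mulr0 -[RHS](incidence A n0) big_distrr; apply: eq_bigr => t _ /=.
  by rewrite mulrA -exprD addnA addnn exprD -[(-1) ^+ n.*2]signr_odd odd_double mul1r.
have cS k : (k <= n)%N -> c k.+1 = a k.+1 + a k.
  by move=> kn; rewrite /c /weight /= ltnS kn /a alternating_sumS subrK.
rewrite cS //.
have -> : c i = if i is k.+1 then a k.+1 + a k else 0.
  by case: i ii => // k ik; rewrite cS // ltnW.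
have -> : c i.+2 = if (i.+1 <= n)%N then a i.+2 + a i.+1 else 0.
  by case: ifP => H; [rewrite cS|rewrite /c /weight /= ltnS H].
case: i ii => [|k] ik; case: ifP => kn; rewrite ?a0.
- by have := a_ge0 2 ltac:(lia); lra.
- by lia.
- by have := a_ge0 k ltac:(lia); have := a_ge0 k.+3 ltac:(lia); lra.
- have kE : k.+2 = n.+1 by lia.
  have := a_ge0 k ltac:(lia); rewrite kE an.
  by lra.
Qed.
End TotallyNonnegative.

Lemma incr_le d g i j : incr d g -> (i <= j < d)%N -> (g i <= g j)%N.
Proof.
move=> H /andP[]; rewrite leq_eqVlt => /orP[/eqP->//|ij jd].
by apply: ltnW; apply: H; rewrite ij.
Qed.

Lemma incr_inj d g i j : incr d g -> (i < d)%N -> (j < d)%N -> g i = g j -> i = j.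
Proof.
move=> H id jd E; case: (ltngtP i j) => // ij.
  by have := H i j ltac:(lia); lia.
by have := H j i ltac:(lia); lia.
Qed.

(** Monotonicity leaves the value [g j] only the indices [j] and [j + 1] in [x]. The skipped index
    is the first one at which [g] and [x] disagree. *)
Lemma incr_skip d g x : incr d g -> incr d.+1 x ->
  (forall j, (j < d)%N -> exists2 u, (u < d.+1)%N & g j = x u) ->
  exists2 t, (t < d.+1)%N & forall j, (j < d)%N -> g j = x (bump t j).
Proof.
move=> ig ix H.
have up u v : (u < d.+1)%N -> (v < d.+1)%N -> (x u < x v)%N -> (u < v)%N.
  move=> ud vd; apply: contraTltn => vu; rewrite -leqNgt.
  by apply: (incr_le ix); lia.
have lb j u : (j < d)%N -> (u < d.+1)%N -> g j = x u -> (j <= u)%N.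
  elim: j u => // j IH u jd ud E.
  have [v vd Ev] := H j ltac:(lia).
  have := ig j j.+1 ltac:(lia); rewrite E Ev => /(up _ _ vd ud).
  by have := IH v ltac:(lia) vd Ev; lia.
have ub i j u : (j + i).+1 = d -> (u < d.+1)%N -> g j = x u -> (u <= j.+1)%N.
  elim: i j u => [|i IH] j u E ud Eu; first by lia.
  have [v vd Ev] := H j.+1 ltac:(lia).
  have := ig j j.+1 ltac:(lia); rewrite Eu Ev => /(up _ _ ud vd).
  by have := IH j.+1 v ltac:(lia) vd Ev; lia.
pose P t := (t == d) || (g t != x t).
have exP : exists t, P t by exists d; rewrite /P eqxx.
case: (ex_minnP exP) => t Pt mint.
have td : (t <= d)%N by apply: mint; rewrite /P eqxx.
exists t => // j jd; rewrite /bump; case: leqP => tj; last first.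
  apply/eqP; rewrite add0n; apply: contraLR tj => gx.
  by rewrite -leqNgt; apply: mint; rewrite /P gx orbT.
have gt : g t != x t by move: Pt; rewrite /P; case: eqP => // td'; lia.
suff [u [ud ju Eu]] : exists u, [/\ (u < d.+1)%N, (j < u)%N & g j = x u].
  by have := ub (d - j.+1)%N j u ltac:(lia) ud Eu => uj; rewrite Eu; congr x; lia.
elim: j jd tj => [|j IH] jd tj.
  have [u ud Eu] := H 0%N jd; exists u; split=> //.
  have t0 : t = 0%N by lia.
  by move: gt; rewrite t0 Eu; case: u {ud Eu} => //; rewrite eqxx.
have [u ud Eu] := H j.+1 jd; exists u; split=> //.
case: (ltngtP t j.+1) tj => // tj _.
  have [v [vd jv Ev]] := IH ltac:(lia) ltac:(lia).
  by have := ig j j.+1 ltac:(lia); rewrite Eu Ev => /(up _ _ vd ud); lia.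
have := lb _ _ jd ud Eu; rewrite leq_eqVlt => /orP[/eqP E|//].
by move: gt; rewrite tj Eu -E eqxx.
Qed.

Lemma incr_same d g x : incr d g -> incr d x ->
  (forall j, (j < d)%N -> exists2 u, (u < d)%N & g j = x u) ->
  forall j, (j < d)%N -> g j = x j.
Proof.
(* Appending one value above all others reduces the claim to [incr_skip]; the skipped index must be
   the new one. *)
move=> ig ix H j jd; pose x' i := if (i < d)%N then x i else (x i + (x d.-1)).+1.
have [|j' j'd|t td E] := @incr_skip d g x' ig.
- move=> a b /andP[ab]; rewrite ltnS leq_eqVlt /x' => /orP[/eqP bd|bd].
    rewrite bd ltnn (_ : (a < d)%N); last by lia.
    by have := @incr_le d x a d.-1 ix; lia.
  by rewrite bd (ltn_trans ab bd); apply: ix; rewrite ab.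
- by have [u ud ->] := H j' j'd; exists u; [lia|rewrite /x' ud].
have key i : (i < d)%N -> (bump t i < d)%N.
  move=> id; rewrite ltnNge; apply/negP => ti.
  have := E _ id; rewrite /x' ltnNge ti /=; have [u ud ->] := H i id.
  by have := @incr_le d x u d.-1 ix; lia.
suff td' : t = d by rewrite (E _ jd) /x' key // td' /bump leqNgt jd.
case: d td key {E H ix ig x' jd} => [|d] td key; first by lia.
by have := key d (ltnSn d); rewrite /bump; lia.
Qed.

(** * An explicit matrix for a point on a hyperplane *)

Section FlagMatrix.
Variable F : realDomainType.
Variables (n : nat) (p q : nat -> F) (al om : nat).
Hypothesis (n2 : (1 < n)%N) (aln : (al < n)%N) (omn : (om < n)%N) (alom : al != om).
Hypothesis orth : \sum_(t < n) (-1) ^+ t * (p t * q t) = 0.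

(** The increasing enumeration of the indices other than [al] and [om]. *)
Definition eidx i := bump (maxn al om) (bump (minn al om) i).

Definition frow m j := q al *+ (j == m) - (-1) ^+ (m + al) * q m *+ (j == al).

(* The first row spans L_1; the rows 1, ..., n-2 are orthogonal to the
   coefficients (-1)^j q_j of the equation of L_(n-1). *)
Definition fmx i j :=
  if i == 0%N then p j else if (i < n.-1)%N then frow (eidx i.-1) j else (j == al)%:R.

Local Notation D := (mnr (fun i => fmx i.+1)).

(** The rows [1, ..., k] of [fmx] vanish outside the columns [al, eidx 0, ..., eidx (k-1)]; [x]
    lists these in increasing order, with [al] at position [a]. *)
Definition xenum k (x : nat -> nat) a :=
  [/\ incr k.+1 x, (a < k.+1)%N, x a = al & forall i, (i < k)%N -> x (bump a i) = eidx i].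

Lemma eidx_al i : eidx i != al.
Proof. by rewrite /eidx /bump; move: alom; lia. Qed.

Lemma eidx_inj i j : eidx i = eidx j -> i = j.
Proof. by rewrite /eidx /bump; lia. Qed.

Lemma sgn2 k : (-1) ^+ (k + k) = 1 :> F.
Proof. by rewrite addnn -signr_odd odd_double. Qed.

Lemma fmxE i j : (i < n - 2)%N -> fmx i.+1 j = frow (eidx i) j.
Proof. by move=> ik; rewrite /fmx /= (_ : (i.+1 < n.-1)%N) //; lia. Qed.

(** The rows span the hyperplane with normal [(-1)^j q_j] inside the space of the columns [x], so
    their maximal minors are proportional to [q]. For [t = a] the matrix is scalar; for other [t], a
    Cramer relation has only the two terms at [t] and at [a]. *)
Lemma D_xenum k x a t : (k <= n - 2)%N -> xenum k x a -> (t < k.+1)%N ->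
  q al * D k (x \o bump t) =
  (-1) ^+ (a + al) * (q al ^+ k) * ((-1) ^+ (t + x t) * q (x t)).
Proof.
move=> kn [ix ak xa xe] tk.
have Da : D k (x \o bump a) = q al ^+ k.
  rewrite /mnr (_ : \matrix_(i, j) _ = (q al)%:M) ?det_scalar //.
  apply/matrixP => i j; rewrite !mxE fmxE ?(leq_trans (ltn_ord _)) //= xe //.
  rewrite /frow (negPf (eidx_al _)) mulr0n subr0 eq_sym; congr (_ *+ nat_of_bool _).
  by apply/eqP/eqP => [/eidx_inj/val_inj|->].
have [->|ta] := eqVneq t a.
  rewrite Da xa [RHS]mulrAC mulrA -[in RHS]exprD sgn2 mul1r.
  by rewrite mulrC.
have [i ik ti] : exists2 i, (i < k)%N & t = bump a i.
  exists (unbump a t); first by rewrite /unbump; move: ta; lia.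
  by rewrite unbumpK // inE eq_sym.
have := mnr_cramer (fun i => fmx i.+1) x ik.
rewrite (bigD1 (Ordinal ak)) // (bigD1 (Ordinal tk)) //= big1 ?addr0; last first.
  move=> u /andP[]; rewrite -!val_eqE /= => ua ut.
  rewrite fmxE ?(leq_trans ik) // /frow -(xe i ik) -xa -ti.
  have /negPf-> : x u != x t by apply: contraNneq ut => /(incr_inj ix (ltn_ord u) tk)->.
  have /negPf-> : x u != x a by apply: contraNneq ua => /(incr_inj ix (ltn_ord u) ak)->.
  by rewrite mulr0n mulr0n subr0 mul0r.
rewrite !fmxE ?(leq_trans ik) // /frow -(xe i ik) -ti -{1 3}xa eqxx.
have /negPf-> : x a != x t by apply: contraNneq ta => /(incr_inj ix ak tk)->.
have /negPf-> : x t != al by rewrite ti xe // eidx_al.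
rewrite eqxx Da mulr0n mulr1n sub0r mulr0n subr0 mulr1n => /eqP.
rewrite addrC addr_eq0 => /eqP E.
apply: (@lreg_sign F (k + t)).
transitivity (q al * ((-1) ^+ (k + t) * D k (x \o bump t))); first by ring.
rewrite E; rewrite !exprD.
transitivity ((-1) ^+ x t * (-1) ^+ al * q (x t) * ((-1) ^+ k * (-1) ^+ a * q al ^+ k)); first by ring.
transitivity (((-1) ^+ t * (-1) ^+ t) * ((-1) ^+ x t * (-1) ^+ al * q (x t) * ((-1) ^+ k * (-1) ^+ a * q al ^+ k))); last by ring.
by rewrite -[(-1) ^+ t * (-1) ^+ t]exprD sgn2 mul1r.
Qed.

Lemma D_eq0 k x a g : (k <= n - 2)%N -> xenum k x a ->
  (exists2 j, (j < k)%N & forall u, (u < k.+1)%N -> g j != x u) -> D k g = 0.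
Proof.
move=> kn [ix ak xa xe] [j jk gj]; apply: (mnr_col0 jk) => i ik.
rewrite fmxE ?(leq_trans ik) // /frow -xe // -xa.
rewrite (negPf (gj _ _)); last by rewrite /bump; lia.
by rewrite (negPf (gj _ ak)) !mulr0n subrr.
Qed.

Lemma fmx_first k g : q al * mnr fmx k.+1 g =
   \sum_(t < k.+1) (-1) ^+ t * (p (g t) * (q al * D k (g \o bump t))).
Proof.
by rewrite mnr_first big_distrr; apply: eq_bigr => t _ /=; rewrite /fmx /=; ring.
Qed.

Lemma fmx_minor_in k x a : (k <= n - 2)%N -> xenum k x a ->
  q al * mnr fmx k.+1 x = (-1) ^+ (a + al) * (q al ^+ k) *
    \sum_(t < k.+1) (-1) ^+ x t * (p (x t) * q (x t)).
Proof.
move=> kn xen; rewrite fmx_first big_distrr; apply: eq_bigr => t _ /=.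
rewrite (D_xenum kn xen) // [(-1) ^+ (t + _)]exprD.
transitivity (((-1) ^+ t * (-1) ^+ t) * ((-1) ^+ (a + al) * q al ^+ k *
   ((-1) ^+ x t * (p (x t) * q (x t))))); first by ring.
by rewrite -[(-1) ^+ t * (-1) ^+ t]exprD sgn2 mul1r.
Qed.

Lemma fmx_minor_new k x a g t0 : (k <= n - 2)%N -> xenum k x a -> (t0 < k.+1)%N ->
  (forall u, (u < k.+1)%N -> g t0 != x u) ->
  q al * mnr fmx k.+1 g = (-1) ^+ t0 * (p (g t0) * (q al * D k (g \o bump t0))).
Proof.
move=> kn xen t0k gt0.
rewrite fmx_first (bigD1 (Ordinal t0k)) //= big1 ?addr0 // => t; rewrite -val_eqE /= => tt0.
rewrite (D_eq0 kn xen) ?mulr0 //; exists (unbump t t0).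
  by move: tt0 (ltn_ord t); rewrite /unbump; lia.
by rewrite /= unbumpK // inE eq_sym.
Qed.

Lemma fmx_minor_out k x a g t0 t1 : (k <= n - 2)%N -> xenum k x a ->
  (t0 < k.+1)%N -> (t1 < k.+1)%N -> (forall u, (u < k.+1)%N -> g t0 != x u) ->
  (forall j, (j < k)%N -> g (bump t0 j) = x (bump t1 j)) ->
  q al * mnr fmx k.+1 g = (-1) ^+ (a + al) * (q al ^+ k) *
          ((-1) ^+ (t0 + t1 + x t1) * (p (g t0) * q (x t1))).
Proof.
move=> kn xen t0k t1k gt0 gx; rewrite (fmx_minor_new kn xen t0k gt0).
rewrite (@eq_mnr _ _ (fun i => fmx i.+1) _ _ (x \o bump t1)).
  by rewrite (D_xenum kn xen) // !exprD; ring.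
by move=> i j _ jk /=; rewrite -gx.
Qed.

(** Since all rows but the first vanish off the columns of [x], two new columns give zero. No new
    column means [g = x] and leaves the full sum; one new column must be paired with the first row
    and leaves a single product. *)
Lemma fmx_minor k x a g : (k <= n - 2)%N -> xenum k x a -> incr k.+1 g ->
  [\/ q al * mnr fmx k.+1 g = 0,
      q al * mnr fmx k.+1 g = (-1) ^+ (a + al) * (q al ^+ k) *
        \sum_(t < k.+1) (-1) ^+ x t * (p (x t) * q (x t)) |
      exists t0 t1, [/\ (t0 < k.+1)%N, (t1 < k.+1)%N,
        forall u, (u < k.+1)%N -> g t0 != x u,
        forall j, (j < k)%N -> g (bump t0 j) = x (bump t1 j) &
        q al * mnr fmx k.+1 g = (-1) ^+ (a + al) * (q al ^+ k) *
          ((-1) ^+ (t0 + t1 + x t1) * (p (g t0) * q (x t1)))]].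
Proof.
move=> kn xen ig; have [ix ak xa xe] := xen.
case: (pselect (exists2 t0, (t0 < k.+1)%N & forall u, (u < k.+1)%N -> g t0 != x u)).
  move=> [t0 t0k gt0].
  case: (pselect (exists2 j, (j < k)%N & forall u, (u < k.+1)%N -> g (bump t0 j) != x u)).
    by move=> H; apply: Or31; rewrite (fmx_minor_new kn xen t0k gt0) (D_eq0 kn xen) ?mulr0.
  move=> H; apply: Or33.
  have [|j jk|t1 t1k gx] := @incr_skip k (g \o bump t0) x _ ix.
  - exact: incr_bump.
  - apply: contrapT => K; apply: H; exists j => // u uk.
    by apply/eqP => Eg; apply: K; exists u.
  by exists t0, t1; split=> //; apply: fmx_minor_out.
move=> H; apply: Or32; rewrite -(fmx_minor_in kn xen); congr (_ * _).
apply: eq_mnr => i j _ jk; congr fmx.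
apply: (incr_same ig ix) jk => {}j jk; apply: contrapT => K; apply: H; exists j => // u uk.
by apply/eqP => Eg; apply: K; exists u.
Qed.

Lemma xenum_last k : (al <= k.+1)%N -> (om <= k.+1)%N ->
  xenum k (bump om) (al - (om < al)).
Proof.
move=> ak ok; move: alom => ao; split=> [i j| | |i ik]; rewrite /eidx /bump; lia.
Qed.

Lemma sum_skip (c : nat -> F) : \sum_(t < n) c t = 0 ->
  \sum_(t < n.-1) c (bump om t) = - c om.
Proof.
have -> : \sum_(t < n) c t = c om + \sum_(t < n.-1) c (bump om t).
  by case: n omn n2 => // n' omn' _; rewrite (bigD1_ord (Ordinal omn')).
by move/eqP; rewrite addrC addr_eq0 => /eqP.
Qed.

(** For [m != om] the only column outside the enumeration is [om]. For [m = om] the columns are the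
    enumeration itself, and orthogonality of [p] and [q] turns the sum into minus the term at
    [om]. *)
Lemma fmx_hyperplane m : (m < n)%N -> q al * mnr fmx n.-1 (bump m) =
  (-1) ^+ (al - (om < al) + al + om.+1) * (q al ^+ (n - 2) * p om) * q m.
Proof.
move=> mn; have E1 : n.-1 = (n - 2).+1 by lia.
have xen := @xenum_last (n - 2) ltac:(lia) ltac:(lia).
have ib : incr (n - 2).+1 (bump m) by move=> i j; rewrite /bump; lia.
rewrite {1}E1; have [->|mom] := eqVneq m om.
  rewrite (fmx_minor_in (leqnn _) xen) -E1.
  rewrite (@sum_skip (fun t => (-1) ^+ t * (p t * q t)) orth).
  by rewrite [in RHS]exprD exprS; ring.
rewrite (@fmx_minor_out (n - 2) _ _ (bump m) (unbump m om) (unbump om m) _ xen) //.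
- rewrite !unbumpK ?inE // 1?eq_sym //.
  rewrite [in RHS]exprD (_ : (-1) ^+ (_ + _ + m) = (-1) ^+ om.+1); first by ring.
  rewrite -[LHS]signr_odd -[RHS]signr_odd; congr (_ ^+ nat_of_bool _).
  by move: mom; rewrite /unbump; lia.
- by rewrite /unbump; move: mom; lia.
- by rewrite /unbump; move: mom; lia.
- by move=> u _; rewrite /bump /unbump; move: mom; lia.
- by move=> j _; rewrite /bump /unbump; move: mom; lia.
Qed.

Lemma fmx_neq0 : q al != 0 -> p om != 0 -> mnr fmx n id != 0.
Proof.
move=> qal pom.
have : q al * mnr fmx n.-1 (bump al) != 0.
  by rewrite fmx_hyperplane // !mulf_neq0 ?signr_eq0 ?expf_neq0.
rewrite mulf_eq0 negb_or qal /= => H.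
have alE : (al < n.-1.+1)%N by lia.
have n10 : (n.-1 == 0)%N = false by apply/eqP; lia.
rewrite -{1}(prednK (ltnW n2)) mnr_last (bigD1 (Ordinal alE)) //=.
rewrite big1 ?addr0 => [|t]; last first.
  by rewrite -val_eqE /= /fmx ltnn n10 => /negPf->; rewrite mul0r.
by rewrite /fmx ltnn eqxx n10 mul1r mulf_neq0 ?signr_eq0.
Qed.

End FlagMatrix.

Lemma mnr_rank (F : idomainType) (A : nat -> nat -> F) n k : mnr A n id != 0 -> (k <= n)%N ->
  exists g, [/\ incr k g, forall j, (j < k)%N -> (g j < n)%N & mnr A k g != 0].
Proof.
move=> An kn; have := subnKC kn; move: (n - k)%N => d; elim: d k {kn} => [|d IH] k.
  by rewrite addn0 => ->; exists id; split=> // i j /andP[].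
rewrite addnS -addSn => /IH[g [ig gn]]; rewrite mnr_last => H.
have [t tk gt] : exists2 t, (t < k.+1)%N & mnr A k (g \o bump t) != 0.
  apply: contrapT => K; case/eqP: H; rewrite big1 // => t _.
  suff -> : mnr A k (g \o bump t) = 0 by rewrite !mulr0.
  by apply/eqP/negPn/negP => gt; apply: K; exists t.
exists (g \o bump t); split=> //; first exact: incr_bump.
by move=> j jk; apply: gn; rewrite /bump; lia.
Qed.

Section FlagMatrixPositive.
Variable F : realDomainType.
Variables (n : nat) (p q : nat -> F) (al om : nat).
Hypothesis (n2 : (1 < n)%N) (aln : (al < n)%N) (omn : (om < n)%N) (alom : al != om).
Hypothesis orth : \sum_(t < n) (-1) ^+ t * (p t * q t) = 0.
Hypothesis p0 : forall t, (t < n)%N -> 0 <= p t.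
Hypothesis q0 : forall t, (t < n)%N -> 0 <= q t.
Hypothesis (qal : q al != 0) (pom : p om != 0).
Hypothesis q_al : forall t, (t < al)%N -> q t = 0.
Hypothesis p_om : forall t, (om < t < n)%N -> p t = 0.
Hypothesis alt0 : forall k, (k <= n)%N -> 0 <= alternating_sum (fun t => p t * q t) k.

Local Notation fm := (fmx n p q al om).
Local Notation xenum := (xenum al om).

Definition same_sign k := exists e, forall g, incr k g ->
  (forall j, (j < k)%N -> (g j < n)%N) -> 0 <= (-1) ^+ e * mnr fm k g.

(** Because [q] vanishes before [al] and [p] after [om], the sign of a single product has to be
    checked only if [al <= x t1] and [g t0 <= om]; there the parity of the exponent is constant. *)
Lemma same_sign_xenum k x a e : (k <= n - 2)%N -> xenum k x a ->
  (forall t, (t < k.+1)%N -> (x t < n)%N) ->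
  (forall g t0 t1, (t0 < k.+1)%N -> (t1 < k.+1)%N -> incr k.+1 g ->
     (forall j, (j < k.+1)%N -> (g j < n)%N) ->
     (forall u, (u < k.+1)%N -> g t0 != x u) ->
     (forall j, (j < k)%N -> g (bump t0 j) = x (bump t1 j)) ->
     (al <= x t1)%N -> (g t0 <= om)%N -> odd (t0 + t1 + x t1) = odd e) ->
  0 <= (-1) ^+ e * (\sum_(t < k.+1) (-1) ^+ x t * (p (x t) * q (x t))) ->
  same_sign k.+1.
Proof.
move=> kn xen xn H Hs; exists (a + al + e)%N => g ig gn.
have qal0 : 0 < q al by rewrite lt_def qal q0.
have sg m : (-1) ^+ m * (-1) ^+ m = 1 :> F by rewrite -expr2 sqrr_sign.
have sgE (u v z s : F) : u * u = 1 -> u * v * (u * z * s) = z * (v * s).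
  by move=> uu; transitivity (u * u * (z * (v * s))); [ring|rewrite uu mul1r].
rewrite -(pmulr_rge0 _ qal0) mulrCA exprD.
have [->|->|[t0 [t1 [t0k t1k gt0 gx ->]]]] := fmx_minor p q n2 aln omn alom kn xen ig.
- by rewrite mulr0.
- by rewrite sgE ?sg // mulr_ge0 // exprn_ge0 // ltW.
- rewrite sgE ?sg // mulr_ge0 ?exprn_ge0 ?(ltW qal0) // mulrA.
  case: (leqP al (x t1)) => [ax|/q_al->]; last by rewrite !mulr0.
  case: (leqP (g t0) om) => [og|/= og]; last by rewrite p_om ?mul0r ?mulr0 // og gn.
  rewrite -[(-1) ^+ (t0 + _ + _)]signr_odd (H g t0 t1) // signr_odd sg mul1r.
  by rewrite mulr_ge0 ?p0 ?q0 ?gn ?xn.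
Qed.

(** The columns are [0, ..., k-1] and [al]; [q] vanishes on all but the last, so the sum has one
    term. *)
Lemma same_sign_small k : (k <= n - 2)%N -> (k <= minn al om)%N -> same_sign k.+1.
Proof.
move=> kn; rewrite leq_min => /andP[kal kom].
apply: (@same_sign_xenum k (fun t => if (t < k)%N then t else al) k al) => //.
- split=> [i j|||i ik]; rewrite /eidx /bump ?ltnn //; do ?[case: ifP => ?]; lia.
- by move=> t; case: ifP; lia.
- move=> g t0 t1 t0k t1k ig gn gt0 gx at1 got.
  have t1E : t1 = k by move: at1; case: ifP; lia.
  have gE j : (j < k)%N -> g (bump t0 j) = j.
    by move=> jk; rewrite gx // t1E (_ : bump k j = j) ?jk // /bump; lia.
  have t0E : t0 = k.
    case: (ltngtP t0 k) => // h; last by lia.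
    have := gE t0 h; rewrite /bump leqnn add1n => E1.
    have := ig t0 t0.+1 ltac:(lia); rewrite E1 => lt1.
    have := gt0 (g t0); rewrite (_ : (g t0 < k)%N) ?eqxx; last by lia.
    by move=> /(_ ltac:(lia)).
  by rewrite t0E t1E ltnn addnn oddD odd_double.
rewrite (bigD1 ord_max) //= ltnn big1 ?addr0 => [|t].
  by rewrite mulrA -expr2 sqrr_sign mul1r mulr_ge0 ?p0 ?q0.
rewrite -val_eqE /= => tk; have tk' : (t < k)%N by move: (ltn_ord t); lia.
by rewrite tk' q_al ?mulr0 //; lia.
Qed.

(** Every term of the sum is zero: the columns other than [al] lie before [al], where [q] vanishes,
    and [al] lies after [om], where [p] vanishes. *)
Lemma same_sign_swapped k : (k <= n - 2)%N -> (om < k < al)%N -> same_sign k.+1.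
Proof.
move=> kn /andP[ok ka].
apply: (@same_sign_xenum k (fun t => if (t < k)%N then bump om t else al) k (om + k + al)) => //.
- split=> [i j|||i ik]; rewrite /eidx /bump ?ltnn //; do ?[case: ifP => ?]; lia.
- by move=> t; case: ifP; rewrite /bump; lia.
- move=> g t0 t1 t0k t1k ig gn gt0 gx at1 got.
  have t1E : t1 = k by move: at1; case: ifP; rewrite /bump; lia.
  have gE j : (j < k)%N -> g (bump t0 j) = bump om j.
    by move=> jk; rewrite gx // t1E (_ : bump k j = j) ?jk // /bump; lia.
  have gom : g t0 = om.
    apply/eqP; rewrite eqn_leq got leqNgt; apply/negP => lto.
    have := gt0 (g t0); rewrite (_ : (g t0 < k)%N); last by lia.
    rewrite (_ : bump om (g t0) = g t0) ?eqxx; last by rewrite /bump; lia.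
    by move=> /(_ ltac:(lia)).
  have t0E : t0 = om.
    case: (ltngtP t0 om) => // h.
      have := gE t0 ltac:(lia); rewrite (_ : bump t0 t0 = t0.+1) /bump; last by lia.
      by have := ig t0 t0.+1 ltac:(lia); lia.
    have := gE t0.-1 ltac:(lia); rewrite (_ : bump t0 t0.-1 = t0.-1) /bump; last by lia.
    by have := ig t0.-1 t0 ltac:(lia); lia.
  by rewrite t0E t1E ltnn.
rewrite big1 ?mulr0 // => t _; case: ltnP => tk.
  by rewrite [q _]q_al ?mulr0 //; rewrite /bump; lia.
by rewrite p_om ?mul0r ?mulr0 //; lia.
Qed.

(** The columns are [0, ..., k], and the sum is up to sign an alternating sum: this is the range of
    dimensions in which their nonnegativity enters. *)
Lemma same_sign_middle k : (k <= n - 2)%N -> (al <= k < om)%N -> same_sign k.+1.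
Proof.
move=> kn /andP[ok ka].
apply: (@same_sign_xenum k id al k) => //.
- by split=> [i j|||i ik]; rewrite /eidx /bump; lia.
- by move=> t; lia.
- move=> g t0 t1 t0k t1k ig gn gt0 gx at1 got.
  have t0E : t0 = k.
    case: (ltngtP t0 k) => // h; last by lia.
    have gk : (k < g t0)%N.
      by rewrite ltnNge; apply/negP => gk; have := gt0 _ gk; rewrite eqxx.
    have := ig t0 k ltac:(lia).
    have := gx k.-1; rewrite /bump.
    have -> : (t0 <= k.-1)%N by lia.
    by move=> /(_ ltac:(lia)) E1 E2; move: E1; rewrite add1n prednK /=; lia.
  by rewrite t0E -addnA addnn oddD odd_double addbF.
have := @alt0 k.+1 ltac:(lia); rewrite /alternating_sum /=.
rewrite (_ : _ * _ = \sum_(t < k.+1) (-1) ^+ (k + t) * (p t * q t)) //.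
by rewrite big_distrr; apply: eq_bigr => t _ /=; rewrite exprD mulrA.
Qed.

(** The columns are [0, ..., k+1] without [om]. As [p] vanishes after [om], orthogonality makes the
    sum equal to minus the term at [om]. *)
Lemma same_sign_large k : (k <= n - 2)%N -> (al <= k.+1)%N -> (om <= k.+1)%N ->
  same_sign k.+1.
Proof.
move=> kn ak ok.
apply: (@same_sign_xenum k (bump om) (al - (om < al)) om.+1) => //.
- exact: (xenum_last n2 aln omn alom ak ok).
- by move=> t; rewrite /bump; lia.
- move=> g t0 t1 t0k t1k ig gn gt0 gx at1 got.
  have gom : g t0 = om.
    apply/eqP; rewrite eqn_leq got leqNgt; apply/negP => lto.
    have := gt0 (g t0); rewrite (_ : bump om (g t0) = g t0) ?eqxx; last by rewrite /bump; lia.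
    by move=> /(_ ltac:(lia)).
  have t0E : t0 = (om - (t1 < om))%N.
    have low : (0 < t0)%N -> (bump om (bump t1 t0.-1) < om)%N.
      move=> t00; rewrite -gx; last by lia.
      rewrite -gom; have -> : bump t0 t0.-1 = t0.-1 by rewrite /bump; lia.
      by apply: ig; lia.
    have high : (t0 < k)%N -> (om < bump om (bump t1 t0))%N.
      move=> t0k'; rewrite -gx //; rewrite -gom; have -> : bump t0 t0 = t0.+1 by rewrite /bump; lia.
      by apply: ig; lia.
    by move: low high; rewrite /bump; lia.
  by rewrite t0E /bump; lia.
have omE : \sum_(t < k.+1) (-1) ^+ bump om t * (p (bump om t) * q (bump om t)) =
   - ((-1) ^+ om * (p om * q om)).
  rewrite -(@sum_skip F n om n2 omn (fun t => (-1) ^+ t * (p t * q t)) orth).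
  rewrite (big_ord_widen n.-1 (fun t => (-1) ^+ bump om t * (p (bump om t) * q (bump om t))));
    last by lia.
  rewrite big_mkcond; apply: eq_bigr => t _; case: ltnP => // tk.
  by rewrite p_om ?mul0r ?mulr0 // /bump; have := ltn_ord t; lia.
rewrite omE exprS mulN1r mulrNN mulrA -expr2 sqrr_sign mul1r.
by rewrite mulr_ge0 ?p0 ?q0.
Qed.

Lemma same_sign_all k : (k <= n)%N -> same_sign k.
Proof.
case: k => [|k] kn; first by exists 0%N => g _ _; rewrite mnr0 mulr1.
case: (leqP k.+1 n.-1) => k1; last first.
  have kE : k.+1 = n by lia.
  (* In the top dimension there is one coordinate only, and the exponent records its sign. *)
  exists (mnr fm n id < 0)%R => g ig gn; rewrite kE in ig gn *.
  rewrite (@eq_mnr _ _ fm _ _ id).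
    by case: ltP => H; rewrite ?mul1r // mulN1r oppr_ge0 ltW.
  move=> i j _ jn; congr fmx; apply: (incr_same ig) jn => [? ? /andP[]//|{}j jn].
  by exists (g j); [exact: gn|].
have kn2 : (k <= n - 2)%N by lia.
case: (leqP k (minn al om)) => klo; first exact: same_sign_small.
case: (ltngtP al om) => [ao|oa|E]; last by move: alom; rewrite E eqxx.
  case: (ltnP k om) => ko; first by apply: same_sign_middle => //; lia.
  by apply: same_sign_large => //; lia.
case: (ltnP k al) => ko; first by apply: same_sign_swapped => //; lia.
by apply: same_sign_large => //; lia.
Qed.
End FlagMatrixPositive.

(** * Realizations of flags of rank (1, n-1) *)

Section Columns.
Variable n : nat.
Implicit Types B : {set 'I_n}.

Definition colfun B := nth 0%N (cols B).

Lemma sorted_cols B : sorted ltn (cols B).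
Proof.
rewrite /cols; apply: (@subseq_sorted _ _ ltn_trans _ (map val (enum 'I_n))).
  by apply: map_subseq; rewrite enumT /enum_mem; exact: filter_subseq.
by rewrite val_enum_ord iota_ltn_sorted.
Qed.

Lemma mem_cols B (i : 'I_n) : (val i \in cols B) = (i \in B).
Proof. by rewrite mem_map ?mem_enum //; exact: val_inj. Qed.

Lemma cols_lt B k : k \in cols B -> (k < n)%N.
Proof. by case/mapP => i _ ->; exact: ltn_ord. Qed.

Lemma cols_sorted_seq B (s : seq nat) : sorted ltn s ->
  (forall k, k \in s -> (k < n)%N) -> (forall i : 'I_n, (i \in B) = (val i \in s)) ->
  cols B = s.
Proof.
move=> ss sn Bs; apply: (irr_sorted_eq ltn_trans ltnn (sorted_cols B) ss) => k.
apply/idP/idP => [kB|ks].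
  by have kn := cols_lt kB; rewrite -[k]/(val (Ordinal kn)) -Bs -mem_cols.
by have kn := sn _ ks; rewrite -[k]/(val (Ordinal kn)) mem_cols Bs.
Qed.

Lemma size_cols B : size (cols B) = #|B|.
Proof. by rewrite size_map cardE. Qed.

Lemma colfun_lt B j : (j < #|B|)%N -> (colfun B j < n)%N.
Proof. by rewrite -size_cols => jB; apply: (@cols_lt B); exact: mem_nth. Qed.

Lemma incr_colfun B : incr #|B| (colfun B).
Proof.
move=> i j /andP[ij]; rewrite -size_cols => jB.
by apply: (sorted_ltn_nth ltn_trans 0%N (sorted_cols B)); rewrite ?inE //; exact: ltn_trans jB.
Qed.

Lemma sorted_mkseq d g : incr d g -> sorted ltn (mkseq g d).
Proof.
move=> ig; apply/(sortedP 0%N) => i; rewrite size_mkseq => id.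
by rewrite !nth_mkseq ?(ltnW id) //; apply: ig; rewrite ltnSn.
Qed.

Lemma colfun_mkseq B d g : incr d g -> (forall j, (j < d)%N -> (g j < n)%N) ->
  (forall i : 'I_n, (i \in B) = (val i \in mkseq g d)) ->
  #|B| = d /\ forall j, (j < d)%N -> colfun B j = g j.
Proof.
move=> ig gn HB; have E : cols B = mkseq g d.
  apply: cols_sorted_seq => //; first exact: sorted_mkseq.
  by move=> k /mapP[j]; rewrite mem_iota => /andP[_ jd] ->; apply: gn.
rewrite -size_cols E size_mkseq; split=> // j jd.
by rewrite /colfun E nth_mkseq.
Qed.

Lemma set_of_incr d g : incr d g -> (forall j, (j < d)%N -> (g j < n)%N) ->
  exists B, #|B| = d /\ forall j, (j < d)%N -> colfun B j = g j.
Proof.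
move=> ig gn; exists [set i : 'I_n | val i \in mkseq g d].
by apply: colfun_mkseq => // i; rewrite inE.
Qed.

Lemma colfun_single (t : nat) : (t < n)%N ->
  #|[set i : 'I_n | i == t :> nat]| = 1%N /\ colfun [set i : 'I_n | i == t :> nat] 0 = t.
Proof.
move=> tn; have [||i|-> H] := @colfun_mkseq [set i : 'I_n | i == t :> nat] 1 (fun=> t).
- by move=> i j; lia.
- by [].
- by rewrite /mkseq /= !inE.
by split=> //; apply: H.
Qed.

Lemma colfun_cosingle (t : nat) : (t < n)%N ->
  #|[set i : 'I_n | i != t :> nat]| = n.-1 /\
  forall j, (j < n.-1)%N -> colfun [set i : 'I_n | i != t :> nat] j = bump t j.
Proof.
move=> tn; apply: colfun_mkseq.
- by move=> i j; rewrite /bump; lia.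
- by move=> j; rewrite /bump; lia.
- move=> i; rewrite inE; apply/idP/mapP => [it|[j]].
    exists (unbump t i); last by rewrite unbumpK // inE eq_sym.
    by rewrite mem_iota add0n /unbump; have := ltn_ord i; move: it; lia.
  by rewrite mem_iota => _ ->; rewrite eq_sym neq_bump.
Qed.

Lemma card1_single B : #|B| = 1%N ->
  exists2 t, (t < n)%N & B = [set i : 'I_n | i == t :> nat].
Proof.
move=> /eqP/cards1P[i ->]; exists i => //.
by apply/setP => j; rewrite !inE.
Qed.

Lemma cardn1_cosingle B : (0 < n)%N -> #|B| = n.-1 ->
  exists2 t, (t < n)%N & B = [set i : 'I_n | i != t :> nat].
Proof.
move=> n0 HB; have : #|~: B| = 1%N by rewrite cardsCs finset.setCK HB card_ord; lia.
move=> /eqP/cards1P[i Ei]; exists i => //.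
by rewrite -[B]finset.setCK Ei; apply/setP => j; rewrite !inE.
Qed.
End Columns.

Section SeriesMinors.
Variables (R : realType).
Local Notation K := (puiseux R).

Lemma sminorE n (M : nat -> nat -> K) d (B : {set 'I_n}) :
  sminor (fun i j => coefs (M i j)) d B = coefs (mnr M d (colfun B)).
Proof.
rewrite /mnr /determinant (big_morph (@coefs R) (@coefsD R) (@coefs0 R)).
apply: eq_bigr => s _.
under [in RHS]eq_bigr do rewrite mxE.
rewrite -(big_morph (@coefs R) (@coefsM R) (@coefs1 R)).
by case: odd_perm; rewrite ?expr0 ?mul1r // expr1 mulN1r.
Qed.

Lemma series_matrix_puiseux n (A : nat -> nat -> series R) : series_matrix n A ->
  exists M : nat -> nat -> K,
    forall i j, (i < n)%N -> (j < n)%N -> coefs (M i j) = A i j.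
Proof.
move=> sA; exists (fun i j => if pselect ((i < n)%N /\ (j < n)%N) is left H
  then Puiseux (sA i j (proj1 H) (proj2 H)) else 0).
by move=> i j ii jn; case: pselect => // -[].
Qed.

Lemma sminor_puiseux n (A : nat -> nat -> series R) (M : nat -> nat -> K) d (B : {set 'I_n}) :
  (forall i j, (i < n)%N -> (j < n)%N -> coefs (M i j) = A i j) -> #|B| = d ->
  sminor A d B = coefs (mnr M d (colfun B)).
Proof.
move=> H Bd; rewrite -sminorE /sminor; apply: eq_bigr => s _.
have -> // : \big[@smul R/@sone R]_(i < d) A i (nth 0%N (cols B) (s i)) =
  \big[@smul R/@sone R]_(i < d) coefs (M i (nth 0%N (cols B) (s i))).
apply: eq_bigr => i _; rewrite H //.
  by apply: leq_trans (ltn_ord i) _; rewrite -Bd -[X in (_ <= X)%N](card_ord n) max_card.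
by apply: colfun_lt; rewrite Bd.
Qed.
End SeriesMinors.

Local Notation proper_on n f :=
  ((exists2 t, (t < n)%N & f t != +oo%E) /\ (forall t, (t < n)%N -> f t != -oo%E)).

Section Realizations.
Variables (R : realType) (n : nat).
Local Notation K := (puiseux R).
Variables (mu nu : {set 'I_n} -> \bar R).
Hypothesis n3 : (3 <= n)%N.

(* 0-indexed: [elt_val t] is mu({t+1}) and [coelt_val t] is nu([n] \ {t+1}). *)
Definition elt_val (t : nat) := mu [set i : 'I_n | i == t :> nat].
Definition coelt_val (t : nat) := nu [set i : 'I_n | i != t :> nat].

Lemma lamS t : (t < n)%N -> lam mu nu t.+1 = (elt_val t + coelt_val t)%E.
Proof.
move=> tn; rewrite /lam /= tn /elt_val /coelt_val.
by congr (mu _ + nu _)%E; apply/setP => i; rewrite !inE eqSS.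
Qed.

Lemma lam_out k : ~~ (0 < k <= n)%N -> lam mu nu k = +oo%E.
Proof. by rewrite /lam => /negPf->. Qed.

Lemma mnr_point (F : comNzRingType) (M : nat -> nat -> F) t : (t < n)%N ->
  mnr M 1 (colfun [set i : 'I_n | i == t :> nat]) = M 0%N t.
Proof. by move=> tn; rewrite mnr1 (proj2 (colfun_single tn)). Qed.

Lemma mnr_copoint (F : comNzRingType) (M : nat -> nat -> F) t : (t < n)%N ->
  mnr M n.-1 (colfun [set i : 'I_n | i != t :> nat]) = mnr M n.-1 (bump t).
Proof.
move=> tn; apply: eq_mnr => i j _ jn; congr M.
exact: (proj2 (colfun_cosingle tn)).
Qed.

Lemma srealizes_point A (M : nat -> nat -> K) :
  (forall i j, (i < n)%N -> (j < n)%N -> coefs (M i j) = A i j) ->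
  srealizes A 1 mu ->
  exists c : R, forall t, (t < n)%N -> elt_val t = (vval (M 0%N t) + c%:E)%E.
Proof.
move=> AM [_ [c Hc]]; exists c => t tn; have [B1 _] := colfun_single tn.
by rewrite /elt_val Hc // (sminor_puiseux AM B1) mnr_point.
Qed.

Lemma srealizes_copoint A (M : nat -> nat -> K) :
  (forall i j, (i < n)%N -> (j < n)%N -> coefs (M i j) = A i j) ->
  srealizes A (n - 1) nu ->
  exists c : R, forall t, (t < n)%N -> coelt_val t = (vval (mnr M n.-1 (bump t)) + c%:E)%E.
Proof.
move=> AM [_ [c Hc]]; exists c => t tn; have [B1 _] := colfun_cosingle tn.
by rewrite /coelt_val Hc ?subn1 // (sminor_puiseux AM B1) mnr_copoint.
Qed.

(** In an ordered domain the common scalar can be replaced by its sign. *)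
Lemma spositive_sign A (M : nat -> nat -> K) d :
  (forall i j, (i < n)%N -> (j < n)%N -> coefs (M i j) = A i j) ->
  spositive n A d ->
  exists e, forall g, incr d g -> (forall j, (j < d)%N -> (g j < n)%N) ->
     0 <= (-1) ^+ e * mnr M d g.
Proof.
move=> AM [c [sc [c0 Hc]]]; pose k : K := Puiseux sc.
have k0 : k != 0 by apply/eqP => kE; apply: c0; rewrite -[c]/(coefs k) kE.
exists (k < 0)%R => g ig gn; have [B [Bd gB]] := set_of_incr ig gn.
have := Hc B Bd; rewrite (sminor_puiseux AM Bd) => /(@snonneg_ge0 R (k * _)).
rewrite (@eq_mnr _ M M d _ g) => [|i j _ jd]; last by rewrite gB.
case: (ltgtP k 0) k0 => // [kneg|kpos] _.
  by rewrite nmulr_rge0 // expr1 mulN1r oppr_ge0.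
by rewrite pmulr_rge0 // expr0 mul1r.
Qed.

Lemma sign_spositive (M : nat -> nat -> K) d e :
  (forall g, incr d g -> (forall j, (j < d)%N -> (g j < n)%N) ->
     0 <= (-1) ^+ e * mnr M d g) ->
  spositive n (fun i j => coefs (M i j)) d.
Proof.
move=> H; exists (coefs ((-1) ^+ e : K)); split; first exact: coefsP.
split=> [E|B Bd].
  have /eqP : (-1) ^+ e = 0 :> K by apply: puiseux_eq => a; rewrite E.
  by rewrite signr_eq0.
rewrite sminorE; apply/(@snonneg_ge0 R ((-1) ^+ e * _))/H; rewrite -Bd.
  exact: incr_colfun.
exact: colfun_lt.
Qed.

Lemma vval_sign e (x : K) : vval ((-1) ^+ e * x) = vval x.
Proof. by rewrite -signr_odd; case: odd; rewrite ?mul1r // mulN1r vvalN. Qed.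

Lemma totally_nonnegative_lam : totally_nonnegative2 1 (n - 1) mu nu ->
  forall i, (1 <= i <= n)%N -> (mine (lam mu nu i.-1) (lam mu nu i.+1) <= lam mu nu i)%E.
Proof.
case=> A [sA r1 r2 pA]; have [M AM] := series_matrix_puiseux sA.
have [c1 H1] := srealizes_point AM r1; have [c2 H2] := srealizes_copoint AM r2.
have /choice[e He] : forall k, exists ek, (k <= n)%N -> forall g, incr k g ->
    (forall j, (j < k)%N -> (g j < n)%N) -> 0 <= (-1) ^+ ek * mnr M k g.
  case=> [|k]; first by exists 0%N => _ g _ _; rewrite mnr0 mulr1.
  case: (leqP k.+1 n) => kn; last by exists 0%N.
  have [_ /(spositive_sign AM)[e He]] := pA k.+1 kn.
  by exists e.
(* Each dimension has its own sign; scaling row [i] by the quotient of the signs of dimensions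
   [i + 1] and [i] makes all of them positive at once. *)
pose s i : K := (-1) ^+ (e i.+1 + (if i is 0 then 0 else e i))%N.
pose M' i j := s i * M i j.
have M'E d g : mnr M' d g = (-1) ^+ (if d is 0 then 0%N else e d) * mnr M d g.
  rewrite /M' mnr_rowscale; congr (_ * _); elim: d {g} => [|d IH]; first by rewrite big_ord0.
  rewrite big_ord_recr /= IH /s -exprD addnC -addnA addnn exprD.
  by rewrite -[_ ^+ (_.*2)]signr_odd odd_double mulr1.
have tM : tnn M' n.
  move=> d g dn ig gn; rewrite M'E; case: d dn ig gn => [|d] dn ig gn.
    by rewrite mnr0 mulr1.
  exact: He.
have nE : n = n.-1.+1 by lia.
have wE k : lam mu nu k = (vval (weight M' n.-1 k) + (c1 + c2)%:E)%E.
  rewrite /weight -nE; case: ifP => [|/negbT kn]; last by rewrite lam_out // vval0.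
  case: k => // k kn; rewrite lamS // H1 // H2 //= vvalM M'E /M' !vval_sign.
  by rewrite EFinD addeACA.
have w_ge0 k : 0 <= weight M' n.-1 k.
  rewrite /weight -nE; case: ifP => // /andP[k0 kn]; apply: mulr_ge0.
    have := @He 1%N ltac:(lia) (fun=> k.-1) _ _.
    rewrite mnr1 /M' /s addn0; apply=> [i j|j _]; lia.
  apply: tM => //; first by lia.
    by move=> i j; rewrite /bump; lia.
  by move=> j; rewrite /bump; lia.
move=> [//|i] /andP[_ ii]; rewrite !wE.
rewrite nE in tM.
have := tnn_neighbours tM (_ : (0 < n.-1)%N) (_ : (i <= n.-1)%N).
move=> /(_ ltac:(lia) ltac:(lia)) /(vval_anti (w_ge0 _)).
rewrite vvalD_ge0 //= => Hw.
move: Hw; rewrite ge_min => /orP[H|H]; rewrite ge_min.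
  by rewrite [in X in X || _]leeD2r.
by rewrite [in X in _ || X]leeD2r ?orbT.
Qed.
End Realizations.

(** The first index in the support of [q] cannot be the last one in the support of [p]: the
    orthogonality relation would have exactly one nonzero term. *)
Lemma first_last (F : idomainType) (n : nat) (p q : nat -> F) :
  \sum_(t < n) (-1) ^+ t * (p t * q t) = 0 ->
  (exists2 t, (t < n)%N & p t != 0) -> (exists2 t, (t < n)%N & q t != 0) ->
  exists al om, [/\ (al < n)%N, (om < n)%N, al != om, q al != 0 /\ p om != 0 &
    (forall t, (t < al)%N -> q t = 0) /\ (forall t, (om < t < n)%N -> p t = 0)].
Proof.
move=> orth [t1 t1n pt1] [t2 t2n qt2].
have exq : exists t, (t < n)%N && (q t != 0) by exists t2; rewrite t2n.
have exp : exists t, (t < n)%N && (p t != 0) by exists t1; rewrite t1n.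
have bdp t : (t < n)%N && (p t != 0) -> (t <= n)%N by case/andP => /ltnW.
case: (ex_minnP exq) => al /andP[aln qal] mal.
case: (ex_maxnP exp bdp) => om /andP[omn pom] mom.
have qa t : (t < al)%N -> q t = 0.
  move=> ta; apply/eqP/negPn/negP => qt.
  by have := mal t; rewrite qt (ltn_trans ta aln) => /(_ isT); lia.
have po t : (om < t < n)%N -> p t = 0.
  move=> /andP[ot tn]; apply/eqP/negPn/negP => pt.
  by have := mom t; rewrite pt tn => /(_ isT); lia.
exists al, om; split=> //; apply/eqP => E; move: orth.
rewrite (bigD1 (Ordinal aln)) //= big1 ?addr0 => [|t]; last first.
  rewrite -val_eqE /= neq_ltn => /orP[/qa->|ta]; first by rewrite !mulr0.
  by rewrite po ?mul0r ?mulr0 // -E ta ltn_ord.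
by apply/eqP; rewrite !mulf_neq0 ?signr_eq0 // E.
Qed.

Section Construction.
Variables (R : realType) (n : nat).
Local Notation K := (puiseux R).
Variables (mu nu : {set 'I_n} -> \bar R).
Hypothesis n3 : (3 <= n)%N.

Lemma realization (p q : nat -> K) :
  (forall t, (t < n)%N -> 0 <= p t) -> (forall t, (t < n)%N -> 0 <= q t) ->
  (forall t, (t < n)%N -> vval (p t) = elt_val mu t) ->
  (forall t, (t < n)%N -> vval (q t) = coelt_val nu t) ->
  (exists2 t, (t < n)%N & elt_val mu t != +oo%E) ->
  (exists2 t, (t < n)%N & coelt_val nu t != +oo%E) ->
  \sum_(t < n) (-1) ^+ t * (p t * q t) = 0 ->
  exists A, [/\ series_matrix n A, srealizes A 1 mu, srealizes A (n - 1) nu,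
     spositive n A 1 /\ spositive n A (n - 1) &
     (forall k, (k <= n)%N -> 0 <= alternating_sum (fun t => p t * q t) k) ->
     forall k, (1 <= k <= n)%N -> srank n A k /\ spositive n A k].
Proof.
move=> p0 q0 vp vq [t1 t1n pt1] [t2 t2n qt2] orth.
have [||al [om [aln omn alom [qal pom] [qa po]]]] := first_last orth.
- by exists t1; rewrite // -vval_eqy vp.
- by exists t2; rewrite // -vval_eqy vq.
have n2 : (1 < n)%N by lia.
pose M := fmx n p q al om.
have rank k : (k <= n)%N -> srank n (fun i j => coefs (M i j)) k.
  move=> kn; have [g [ig gn Mg]] := mnr_rank (fmx_neq0 n2 aln omn alom orth qal pom) kn.
  have [B [Bk gB]] := set_of_incr ig gn.
  exists B; split=> //; rewrite sminorE => E; case/eqP: Mg.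
  rewrite (@eq_mnr _ M M k g (colfun B)) => [|i j _ jk]; last by rewrite gB.
  by apply: puiseux_eq => a; rewrite E.
have M0 t : M 0%N t = p t by [].
have Mh t : (t < n)%N -> q al * mnr M n.-1 (bump t) =
  (-1) ^+ (al - (om < al) + al + om.+1) * (q al ^+ (n - 2) * p om) * q t.
  exact: (fmx_hyperplane n2 aln omn alom orth).
(* [v] is the valuation of the factor by which the hyperplane minors differ from [q]. *)
have [v Ev] : exists v : R, vval (q al ^+ (n - 2) * p om) = (vval (q al) + v%:E)%E.
  have fin x : x != 0 -> exists v : R, vval x = v%:E.
    by move=> /(@puiseux_neq0 R)[a /vval_leads->]; exists a.
  have [a Ea] := fin _ qal; have [b Eb] := fin (q al ^+ (n - 2) * p om) ltac:(by rewrite mulf_neq0 ?expf_neq0).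
  by exists (b - a); rewrite Ea Eb -EFinD; congr (_%:E); ring.
have vM t : (t < n)%N -> (coelt_val nu t = vval (mnr M n.-1 (bump t)) + (- v)%:E)%E.
  move=> tn; have := congr1 (@vval R) (Mh t tn); rewrite -vq //.
  rewrite -mulrA vval_sign vvalM [RHS]vvalM Ev.
  have [a /vval_leads->] := puiseux_neq0 qal.
  case: (vval (mnr M n.-1 (bump t))) (vval_Ny (mnr M n.-1 (bump t))) => [x||] // _;
  case: (vval (q t)) (vval_Ny (q t)) => [y||] //= _ => -[E].
  by congr (_%:E); lra.
exists (fun i j => coefs (M i j)); split.
- by move=> i j _ _; exact: coefsP.
- split; first by apply: rank; lia.
  exists 0 => B B1; have [t tn ->] := card1_single B1.
  by rewrite sminorE mnr_point // M0 adde0 -[RHS]/(vval (p t)) vp.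
- split; first by apply: rank; lia.
  exists (- v) => B; rewrite subn1 => B1; have [t tn ->] := cardn1_cosingle (ltnW n2) B1.
  by rewrite sminorE mnr_copoint // -[X in (X + _)%E]/(vval (mnr M n.-1 (bump t))) -vM.
- split.
    apply: (@sign_spositive _ _ _ _ 0) => g _ gn; rewrite mnr1 mul1r M0.
    exact/p0/gn.
  rewrite subn1; apply: (@sign_spositive _ _ _ _ (al - (om < al) + al + om.+1)) => g ig gn.
  have [B [B1 gB]] := set_of_incr ig gn; have [t tn BE] := cardn1_cosingle (ltnW n2) B1.
  have -> : mnr M n.-1 g = mnr M n.-1 (bump t).
    apply: eq_mnr => i j _ jn; congr M; rewrite -gB // BE.
    exact: (proj2 (colfun_cosingle tn)).
  have qal0 : 0 < q al by rewrite lt_def qal q0.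
  rewrite -(pmulr_rge0 _ qal0) mulrCA Mh // mulrA mulrA -expr2 sqrr_sign mul1r.
  by rewrite !mulr_ge0 ?exprn_ge0 ?q0 ?p0.
- move=> alt k /andP[k1 kn]; split; first exact: rank.
  have [e He] := same_sign_all n2 aln omn alom orth p0 q0 qal pom qa po alt kn.
  exact: sign_spositive He.
Qed.

Hypothesis (mu_proper : proper_on n (elt_val mu)) (nu_proper : proper_on n (coelt_val nu)).

Lemma lam_totally_nonnegative :
  (forall i, (1 <= i <= n)%N -> (mine (lam mu nu i.-1) (lam mu nu i.+1) <= lam mu nu i)%E) ->
  totally_nonnegative2 1 (n - 1) mu nu.
Proof.
move=> H; pose l := lam mu nu.
have lN k : l k != -oo%E.
  case: (boolP (0 < k <= n)%N) => [|/lam_out]; last by rewrite /l => ->.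
  case: k => // k kn; rewrite /l lamS //.
  by have := proj2 mu_proper k kn; have := proj2 nu_proper k kn; case: elt_val; case: coelt_val.
(* With val s_k = max (l_k) (l_(k+1)), the hypothesis is min (val s_k) (val s_(k+1)) = l_(k+1). *)
pose sg k := Order.max (l k) (l k.+1).
have sgN k : sg k != -oo%E by rewrite /sg /Order.max; case: ifP.
have sgE k : (k < n)%N -> Order.min (sg k) (sg k.+1) = l k.+1.
  move=> kn; have := H k.+1 ltac:(lia); rewrite -/(l _) -/(l _) -/(l _) /= => Hk.
  rewrite /sg [Order.max (l k) _]maxC -max_minr; apply: max_l.
  exact: Hk.
pose s k : K := monoe (sg k).
pose p t : K := monoe (elt_val mu t).
(* Where [p t] is not zero, [q t] is determined by [p t * q t = s (t + 1) + s t]; the monomial [p t]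
   has the inverse [mono (- a)]. Where [p t] is zero, this sum is zero as well and [q t] only has to
   have the right valuation. *)
pose q t : K := if elt_val mu t is a%:E%E then mono (- a) * (s t.+1 + s t)
   else monoe (coelt_val nu t).
have s0 k : 0 <= s k by exact: monoe_ge0.
have vs t : (t < n)%N -> vval (s t.+1 + s t) = l t.+1.
  by move=> tn; rewrite vvalD_ge0 // minC !vval_monoe // sgE.
have pq t : (t < n)%N -> p t * q t = s t.+1 + s t.
  move=> tn; rewrite /p /q; have := vs t tn; have := proj2 mu_proper t tn.
  rewrite /l lamS //; case: elt_val => [a||] //= _.
    by rewrite mulrA monoM subrr => _; rewrite (_ : mono 0 = 1) ?mul1r //; exact: puiseux_eq.
  rewrite mul0r; have := proj2 nu_proper t tn; case: coelt_val => [b||] //= _ /eqP;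
  by rewrite vval_eqy => /eqP.
have sE k : (k <= n)%N -> alternating_sum (fun t => p t * q t) k = s k.
  elim: k => [_|k IH kn].
    by rewrite /alternating_sum big_ord0 /s /sg /l lam_out // max_l ?leey.
  by rewrite alternating_sumS IH ?(ltnW kn) // pq // addrK.
have [|||||||A [sA r1 r2 _ Apos]] := @realization p q.
- by move=> t _; exact: monoe_ge0.
- move=> t _; rewrite /q; case: elt_val => [a||]; rewrite ?monoe_ge0 //.
  by rewrite mulr_ge0 ?addr_ge0 ?s0 // ltW ?mono_gt0.
- by move=> t tn; rewrite vval_monoe // (proj2 mu_proper).
- move=> t tn; rewrite /q; have := vs t tn; rewrite /l lamS //.
  have := proj2 mu_proper t tn; have := proj2 nu_proper t tn.
  case: elt_val => [a||] // bN _ E; last by rewrite vval_monoe.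
  rewrite vvalM vval_mono E; case: coelt_val bN => [b||] //= _.
  by rewrite -!EFinD; congr (_%:E); ring.
- exact: (proj1 mu_proper).
- exact: (proj1 nu_proper).
- have := sE n (leqnn n); rewrite /s /sg max_r; last by rewrite [X in (_ <= X)%E]lam_out ?leey // ltnn andbF.
  rewrite /l lam_out ?ltnn //= /alternating_sum => E.
  apply: (@lreg_sign K n.-1); rewrite mulr0 -[RHS]E big_distrr; apply: eq_bigr => t _ /=.
  by rewrite exprD mulrA.
exists A; split=> //; apply: Apos => k kn; by rewrite sE.
Qed.
End Construction.

(** * The parity condition and flag positroids *)

Section BigMin.
Variable R : realType.
Implicit Types (r : seq nat) (P : pred nat) (l : nat -> \bar R).

Lemma bigmine_le r P l k : k \in r -> P k ->
  (\big[mine/+oo%E]_(i <- r | P i) l i <= l k)%E.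
Proof.
elim: r => // j r IH; rewrite inE big_cons => /orP[/eqP<- ->|kr Pk].
  by rewrite ge_min lexx.
by case: ifP => _; rewrite ?ge_min IH ?orbT.
Qed.

Lemma bigmine_ge r P l x : (forall k, k \in r -> P k -> (x <= l k)%E) ->
  (x <= \big[mine/+oo%E]_(i <- r | P i) l i)%E.
Proof.
move=> H; rewrite big_seq_cond; elim/big_ind: _ => [|a b xa xb|k /andP[kr Pk]].
- exact: leey.
- by rewrite le_min xa.
- exact: H.
Qed.

Lemma bigmine_attained r P l : \big[mine/+oo%E]_(i <- r | P i) l i = +oo%E \/
  exists k, [/\ k \in r, P k & l k = \big[mine/+oo%E]_(i <- r | P i) l i].
Proof.
elim: r => [|j r IH]; first by left; rewrite big_nil.
rewrite big_cons; case: ifP => Pj; last first.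
  by case: IH => [->|[k [kr Pk E]]]; [left|right; exists k; rewrite inE kr orbT].
right; case: (leP (l j) (\big[mine/+oo%E]_(i <- r | P i) l i)) => h.
  by exists j; rewrite mem_head.
case: IH => [E|[k [kr Pk E]]]; first by move: h; rewrite E ltNge leey.
by exists k; rewrite inE kr orbT.
Qed.

(** The equality of the two minima in pointwise form, which is what realizations and cells
    provide. *)
Definition parity_balanced n l := forall k, (1 <= k <= n)%N ->
  exists j, [/\ (1 <= j <= n)%N, odd j = ~~ odd k & (l j <= l k)%E].

Lemma parity_balancedP n l : (3 <= n)%N ->
  \big[mine/+oo%E]_(1 <= i < n.+1 | odd i) l i =
  \big[mine/+oo%E]_(1 <= i < n.+1 | ~~ odd i) l i <-> parity_balanced n l.
Proof.
move=> n3; have mi k : (k \in index_iota 1 n.+1) = (1 <= k <= n)%N.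
  by rewrite mem_index_iota ltnS.
split=> [E k kn|H].
  have key (P P' : pred nat) : P k -> (forall j, P' j -> odd j = ~~ odd k) ->
      (exists2 j, (1 <= j <= n)%N & P' j) ->
      \big[mine/+oo%E]_(1 <= i < n.+1 | P i) l i = \big[mine/+oo%E]_(1 <= i < n.+1 | P' i) l i ->
      exists j, [/\ (1 <= j <= n)%N, odd j = ~~ odd k & (l j <= l k)%E].
    move=> Pk P'k [j0 j0n P'j0] EP.
    have := @bigmine_le (index_iota 1 n.+1) P l k; rewrite mi EP => /(_ kn Pk) lek.
    (* An infinite minimum need not be attained, but then [l k] is infinite and any index of the
       other parity will do. *)
    case: (bigmine_attained (index_iota 1 n.+1) P' l) => [Ey|[j [jn P'j Ej]]].
      exists j0; split=> //; first exact: P'k.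
      by move: lek; rewrite Ey leye_eq => /eqP->; rewrite leey.
    by exists j; split; [rewrite -mi|exact: P'k|rewrite Ej].
  have [ok|ok] := orP (orbN (odd k)).
    apply: (key odd (fun i => ~~ odd i)) => // [j /negPf->|]; rewrite ?ok //.
    by exists 2; rewrite ?(leq_trans _ n3).
  apply: (key (fun i => ~~ odd i) odd) => // [j ->|]; rewrite ?ok //.
  by exists 1%N; rewrite ?(leq_trans _ n3).
apply/le_anti/andP; split; apply: bigmine_ge => k; rewrite mi => kn ok.
  have [j [jn oj]] := H k kn; apply: le_trans; apply: bigmine_le; first by rewrite mi.
  by rewrite oj ok.
have [j [jn oj]] := H k kn; apply: le_trans; apply: bigmine_le; first by rewrite mi.
by rewrite oj ok.
Qed.
End BigMin.

Section FlagPositroids.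
Variables (R : realType) (n : nat).
Local Notation K := (puiseux R).
Variables (mu nu : {set 'I_n} -> \bar R).
Hypothesis n3 : (3 <= n)%N.

Lemma vval_sum_le (P : pred 'I_n) (F : 'I_n -> K) :
  (exists i, P i) -> exists2 i, P i & (vval (F i) <= vval (\sum_(i | P i) F i)%R)%E.
Proof.
move=> [i0 Pi0]; have [[i /andP[_ Pi] H]|->] := vval_sum_le_seq (index_enum 'I_n) P F.
  by exists i.
by exists i0; rewrite // vval0 leey.
Qed.

Lemma flag_positroid_balanced : valuated_flag_positroid2 1 (n - 1) mu nu ->
  parity_balanced n (lam mu nu).
Proof.
case=> A [sA r1 r2 p1 p2]; have [M AM] := series_matrix_puiseux sA.
have [c1 H1] := srealizes_point AM r1; have [c2 H2] := srealizes_copoint AM r2.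
have [e1 He1] := spositive_sign AM p1; have [e2 He2] := spositive_sign AM p2.
pose c t : K := ((-1) ^+ e1 * M 0%N t) * ((-1) ^+ e2 * mnr M n.-1 (bump t)).
have c0 t : (t < n)%N -> 0 <= c t.
  move=> tn; apply: mulr_ge0.
    by have := He1 (fun=> t); rewrite mnr1; apply=> // i j; lia.
  rewrite subn1 in He2; apply: He2 => [i j|j]; rewrite /bump; lia.
have lam_elt t : (t < n)%N -> lam mu nu t.+1 = (vval (c t) + (c1 + c2)%:E)%E.
  by move=> tn; rewrite lamS // H1 // H2 // vvalM !vval_sign EFinD addeACA.
have sum0 : \sum_(t < n) (-1) ^+ t * c t = 0.
  have n0 : (0 < n.-1)%N by lia.
  have := incidence M n0; rewrite prednK => [E|]; last by lia.
  transitivity ((-1) ^+ e1 * (-1) ^+ e2 * \sum_(t < n) (-1) ^+ t * (M 0%N t * mnr M n.-1 (bump t))).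
    by rewrite big_distrr; apply: eq_bigr => t _ /=; rewrite /c; ring.
  by rewrite E mulr0.
have key (b : bool) : \sum_(t < n | odd t == b) c t = \sum_(t < n | odd t == ~~ b) c t.
  have E : \sum_(t < n | odd t == true) c t = \sum_(t < n | odd t == ~~ true) c t.
    have S1 : \sum_(t < n | odd t) (-1) ^+ t * c t = - \sum_(t < n | odd t == true) c t.
      rewrite -sumrN; apply: eq_big => [t|t ot]; first by rewrite eqb_id.
      by rewrite -signr_odd ot mulN1r.
    have S2 : \sum_(t < n | ~~ odd t) (-1) ^+ t * c t = \sum_(t < n | odd t == ~~ true) c t.
      apply: eq_big => [t|t /negPf ot]; first by rewrite eqbF_neg.
      by rewrite -signr_odd ot mul1r.
    move: sum0; rewrite (bigID (fun t : 'I_n => odd t)) /= S1 S2 => /eqP.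
    by rewrite addr_eq0 eqr_opp => /eqP.
  by case: b; rewrite ?E.
move=> [//|t] /andP[_ tn]; have tn1 : (t.+1 < n)%N || (0 < t)%N by lia.
(* The term [c t] is bounded by the sum over its parity class, hence by that over the other class,
   and some term there has at most the valuation of its sum. *)
have le_sum : c t <= \sum_(u < n | odd u == odd t) c u.
  rewrite (bigD1 (Ordinal tn)) //= lerDl sumr_ge0 // => u _; exact: c0.
have [u Pu Hu] : exists2 u : 'I_n, odd u == ~~ odd t &
    (vval (c u) <= vval (\sum_(u < n | odd u == ~~ odd t) c u)%R)%E.
  apply: (@vval_sum_le (fun u : 'I_n => odd u == ~~ odd t) (fun u => c u)).
  case: (ltnP t.+1 n) => [tn'|tn']; first by exists (Ordinal tn').
  have t1n : (t.-1 < n)%N by lia.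
  have t0 : (0 < t)%N by lia.
  by exists (Ordinal t1n); rewrite //= -{2}(prednK t0) /= negbK.
exists u.+1; split; first by have := ltn_ord u.
  by rewrite /= (eqP Pu).
rewrite (lam_elt _ tn) (lam_elt _ (ltn_ord u)); apply: leeD2r; apply: (le_trans Hu).
by rewrite -key; exact: vval_anti (c0 _ tn) le_sum.
Qed.

Hypothesis (mu_proper : proper_on n (elt_val mu)) (nu_proper : proper_on n (coelt_val nu)).

Lemma balanced_flag_positroid : parity_balanced n (lam mu nu) ->
  valuated_flag_positroid2 1 (n - 1) mu nu.
Proof.
move=> H; pose l := lam mu nu.
have lN t : (t < n)%N -> l t.+1 != -oo%E.
  move=> tn; rewrite /l lamS //.
  by have := proj2 mu_proper t tn; have := proj2 nu_proper t tn; case: elt_val; case: coelt_val.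
pose w t : K := monoe (l t.+1).
have w0 t : 0 <= w t by exact: monoe_ge0.
pose S b : K := \sum_(t < n | odd t == b) w t.
(* Multiplying each term by the sum over the opposite parity class makes both classes add up to
   [S true * S false]. By hypothesis both sums have the same valuation [m], the minimum of [l], and
   [mono (- m)] undoes this shift. *)
have [m Hm] : exists m : R, forall t, (t < n)%N ->
    vval (w t * S (~~ odd t) * mono (- m)) = l t.+1.
  case: (pselect (exists2 k, (k < n)%N & l k.+1 != +oo%E)) => [[k0 k0n lk0]|Hy]; last first.
    exists 0 => t tn; have ly : l t.+1 = +oo%E.
      by apply/eqP/negPn/negP => h; apply: Hy; exists t.
    by rewrite /w ly !mul0r vval0.
  have [k lk kmin] : exists2 k : 'I_n, l k.+1 != +oo%E & forall t : 'I_n, (l k.+1 <= l t.+1)%E.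
    have [|x /mapP[k _ ->] km] := @seq_minimum _ _ (l k0.+1) [seq l (nat_of_ord k).+1 | k <- enum 'I_n].
      by apply/mapP; exists (Ordinal k0n); rewrite ?mem_enum.
    exists k => [|t]; last by apply: km; apply/mapP; exists t; rewrite ?mem_enum.
    apply: contraNneq lk0 => lk; rewrite -leye_eq -lk; apply: km.
    by apply/mapP; exists (Ordinal k0n); rewrite ?mem_enum.
  have [m mE] : exists m : R, l k.+1 = m%:E.
    by move: lk (lN k (ltn_ord k)); case: (l k.+1) => [x||] // _ _; exists x.
  rewrite mE in kmin.
  have att b : exists2 t : 'I_n, odd t == b & l t.+1 = m%:E.
    have [E|ne] := eqVneq (odd k) b; first by exists k; rewrite ?E.
    have [[|j] [jn oj lj]] := H k.+1 (ltn_ord k); first by [].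
    have {}jn : (j < n)%N by [].
    exists (Ordinal jn); first by move: oj ne; rewrite /=; case: (odd j); case: (odd k); case: b.
    by apply/le_anti/andP; split; [rewrite -mE|exact: kmin].
  have vS b : vval (S b) = m%:E.
    apply/le_anti/andP; split.
      have [t tb lt] := att b; rewrite -lt -(vval_monoe (lN t (ltn_ord t))).
      apply: vval_anti; first exact: w0.
      by rewrite /S (bigD1 t) //= lerDl sumr_ge0.
    have [u ub] := @vval_sum_le (fun u : 'I_n => odd u == b) w ltac:(by have [t tb _] := att b; exists t).
    by apply: le_trans; rewrite vval_monoe ?lN.
  exists m => t tn; rewrite !vvalM vS vval_mono vval_monoe ?lN //.
  case: (l t.+1) (lN t tn) => [x||] //= _.
  by rewrite -!EFinD; congr (_%:E); ring.
pose c t : K := w t * S (~~ odd t) * mono (- m).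
have c0 t : 0 <= c t by rewrite !mulr_ge0 ?sumr_ge0 // ltW ?mono_gt0.
have csum : \sum_(t < n) (-1) ^+ t * c t = 0.
  rewrite (bigID (fun t : 'I_n => odd t)) /=.
  have -> : \sum_(t < n | odd t) (-1) ^+ t * c t = - (S true * (S false * mono (- m))).
    rewrite /S mulr_suml -sumrN; apply: eq_big => [t|t ot]; first by rewrite eqb_id.
    by rewrite /c ot -signr_odd ot mulN1r -mulrA.
  have -> : \sum_(t < n | ~~ odd t) (-1) ^+ t * c t = S false * S true * mono (- m).
    rewrite {1}/S !mulr_suml; apply: eq_big => [t|t ot]; first by rewrite eqbF_neg.
    by rewrite /c ot -signr_odd (negPf ot) mul1r.
  by rewrite mulrA mulrC [S true * _]mulrC mulrC addNr.
pose p t : K := monoe (elt_val mu t).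
pose q t : K := if elt_val mu t is a%:E%E then mono (- a) * c t
   else monoe (coelt_val nu t).
have pq t : (t < n)%N -> p t * q t = c t.
  move=> tn; rewrite /p /q; have := Hm t tn; have := proj2 mu_proper t tn.
  rewrite -/(c t) /l lamS //; case: elt_val => [a||] //= _.
    rewrite mulrA monoM subrr => _; rewrite (_ : mono 0 = 1) ?mul1r //; exact: puiseux_eq.
  rewrite mul0r; have := proj2 nu_proper t tn; case: coelt_val => [b||] //= _ /eqP;
  by rewrite vval_eqy => /eqP.
have [|||||||A [sA r1 r2 [pos1 pos2] _]] := @realization R n mu nu n3 p q.
- by move=> t _; exact: monoe_ge0.
- move=> t _; rewrite /q; case: elt_val => [a||]; rewrite ?monoe_ge0 //.
  by rewrite mulr_ge0 // ltW ?mono_gt0.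
- by move=> t tn; rewrite vval_monoe // (proj2 mu_proper).
- move=> t tn; rewrite /q; have := Hm t tn; rewrite -/(c t) /l lamS //.
  have := proj2 mu_proper t tn; have := proj2 nu_proper t tn.
  case: elt_val => [a||] // bN _ E; last by rewrite vval_monoe.
  rewrite vvalM vval_mono E; case: coelt_val bN => [b||] //= _.
  by rewrite -!EFinD; congr (_%:E); ring.
- exact: (proj1 mu_proper).
- exact: (proj1 nu_proper).
- by rewrite -[RHS]csum; apply: eq_bigr => t _; rewrite pq.
by exists A.
Qed.
End FlagPositroids.

(** * Cells of the subdivision *)

Section RootPolytopes.
Variables (R : realType) (n : nat).
Implicit Types (I J : {set 'I_n}) (x y : 'rV[R]_n).

Definition simplex I (a : 'I_n -> R) :=
  [/\ forall i, 0 <= a i, forall i, i \notin I -> a i = 0 & \sum_i a i = 1].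

(* conv(e_I) + conv(e_([n] \ j), j in J) *)
Definition pol I J : set 'rV[R]_n := [set x | exists a b,
  [/\ simplex I a, simplex J b & x = \row_k (a k + (1 - b k))]]%classic.

(** The point [e_i + e_([n] \ j)], that is, the root [e_i - e_j] translated by the all-ones
    vector. *)
Definition rootv (i j : 'I_n) : 'rV[R]_n := \row_k (1 + (k == i)%:R - (k == j)%:R).

Lemma simplex_le1 I a i : simplex I a -> a i <= 1.
Proof.
by case=> a0 _ <-; rewrite (bigD1 i) //= lerDl sumr_ge0.
Qed.

Lemma simplex_delta I i : i \in I -> simplex I (fun k => (k == i)%:R).
Proof.
move=> iI; split=> [k|k|]; first exact: ler0n.
  by case: eqP => // ->; rewrite iI.
by rewrite (bigD1 i) //= eqxx big1 ?addr0 // => k /negPf->.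
Qed.

(** The coordinates 2 at [i] and 0 at [j] are extreme, and force [a i = 1] and [b j = 1]. *)
Lemma root_pol I J i j : i != j -> pol I J (rootv i j) <-> i \in I /\ j \in J.
Proof.
move=> ij; split=> [[a [b [aI bJ /rowP E]]]|[iI jJ]]; last first.
  exists (fun k => (k == i)%:R), (fun k => (k == j)%:R); split; try exact: simplex_delta.
  by apply/rowP => k; rewrite !mxE; ring.
have ji : (j == i) = false by rewrite eq_sym (negPf ij).
have := E i; have := E j; rewrite !mxE !eqxx ji (negPf ij) /= !mulr1n !mulr0n => Ej Ei.
have := simplex_le1 i aI; have := simplex_le1 j bJ; case: aI bJ => a0 aI _ [b0 bJ _].
have := a0 i; have := a0 j; have := b0 i; have := b0 j => h1 h2 h3 h4 h5 h6.
split; apply: contrapT => /negP.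
  by move/aI => ai; lra.
by move/bJ => bj; lra.
Qed.

Lemma root_inj i j i' j' : i != j -> i' != j' -> rootv i j = rootv i' j' -> i = i' /\ j = j'.
Proof.
move=> ij ij' E; have : pol [set i'] [set j'] (rootv i' j') by apply/root_pol; rewrite ?inE.
by rewrite -E root_pol // !inE => -[/eqP-> /eqP->].
Qed.

Lemma sum_image (T : finType) (V : nmodType) (h : 'I_n -> T) (F : T -> V) : injective h ->
  (forall B, (forall i, B != h i) -> F B = 0) -> \sum_B F B = \sum_i F (h i).
Proof.
move=> hi H; rewrite (bigID (fun B => B \in codom h)) /= [X in _ + X]big1 ?addr0; last first.
  move=> B /negP Bh; apply: H => i; apply/eqP => E; apply: Bh; rewrite E.
  exact: codom_f.
rewrite -big_uniq /=; first by rewrite big_image.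
by rewrite map_inj_uniq ?enum_uniq.
Qed.

Definition convex_set (Q : set 'rV[R]_n) := forall (T : finType) (w : T -> R) (z : T -> 'rV[R]_n),
  (forall t, 0 <= w t) -> \sum_t w t = 1 -> (forall t, w t != 0 -> Q (z t)) ->
  Q (\sum_t w t *: z t).

Lemma conv_convex (T : finType) (A : {set T}) (f : T -> 'rV[R]_n) : convex_set (conv A f).
Proof.
move=> U w z w0 w1 Hz.
have /choice[W HW] : forall t, exists W : T -> R, w t != 0 ->
   [/\ forall i, 0 <= W i, forall i, i \notin A -> W i = 0, \sum_i W i = 1 &
      z t = \sum_i W i *: f i].
  move=> t; have [_|wt] := eqVneq (w t) 0; first by exists (fun=> 0).
  by have [W HW] := Hz t wt; exists W.
exists (fun i => \sum_t w t * W t i); split.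
- move=> i; apply: sumr_ge0 => t _; have [->|wt] := eqVneq (w t) 0; first by rewrite mul0r.
  by have [W0 _ _ _] := HW t wt; rewrite mulr_ge0.
- move=> i iA; apply: big1 => t _; have [->|wt] := eqVneq (w t) 0; first by rewrite mul0r.
  by have [_ WA _ _] := HW t wt; rewrite WA ?mulr0.
- rewrite exchange_big -w1 /=; apply: eq_bigr => t _; rewrite -mulr_sumr.
  have [->|wt] := eqVneq (w t) 0; first by rewrite mul0r.
  by have [_ _ -> _] := HW t wt; rewrite mulr1.
- under [in RHS]eq_bigr do rewrite scaler_suml.
  rewrite exchange_big /=; apply: eq_bigr => t _.
  have [->|wt] := eqVneq (w t) 0.
    by rewrite scale0r big1 // => i _; rewrite mul0r scale0r.
  have [_ _ _ ->] := HW t wt; rewrite scaler_sumr; apply: eq_bigr => i _.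
  by rewrite scalerA.
Qed.

Lemma conv_point (T : finType) (A : {set T}) (f : T -> 'rV[R]_n) t : t \in A -> conv A f (f t).
Proof.
move=> tA; exists (fun u => (u == t)%:R); split.
- by move=> u; exact: ler0n.
- by move=> u; case: eqP => // ->; rewrite tA.
- by rewrite (bigD1 t) //= eqxx big1 ?addr0 // => u /negPf->.
- by rewrite (bigD1 t) //= eqxx scale1r big1 ?addr0 // => u /negPf->; rewrite scale0r.
Qed.

Lemma simplex_convex I (T : finType) (w : T -> R) (a : T -> 'I_n -> R) :
  (forall t, 0 <= w t) -> \sum_t w t = 1 -> (forall t, w t != 0 -> simplex I (a t)) ->
  simplex I (fun i => \sum_t w t * a t i).
Proof.
move=> w0 w1 Ha; split.
- move=> i; apply: sumr_ge0 => t _; have [->|wt] := eqVneq (w t) 0; first by rewrite mul0r.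
  by have [W0 _ _] := Ha t wt; rewrite mulr_ge0.
- move=> i iA; apply: big1 => t _; have [->|wt] := eqVneq (w t) 0; first by rewrite mul0r.
  by have [_ WA _] := Ha t wt; rewrite WA ?mulr0.
- rewrite exchange_big -w1 /=; apply: eq_bigr => t _; rewrite -mulr_sumr.
  have [->|wt] := eqVneq (w t) 0; first by rewrite mul0r.
  by have [_ _ ->] := Ha t wt; rewrite mulr1.
Qed.

Lemma pol_convex I J : convex_set (pol I J).
Proof.
move=> T w z w0 w1 Hz.
have /choice[ab Hab] : forall t, exists ab : ('I_n -> R) * ('I_n -> R), w t != 0 ->
   [/\ simplex I ab.1, simplex J ab.2 & z t = \row_k (ab.1 k + (1 - ab.2 k))].
  move=> t; have [_|wt] := eqVneq (w t) 0; first by exists (fun=> 0, fun=> 0).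
  by have [a [b H]] := Hz t wt; exists (a, b).
exists (fun i => \sum_t w t * (ab t).1 i), (fun i => \sum_t w t * (ab t).2 i); split.
- by apply: simplex_convex => // t /Hab[].
- by apply: simplex_convex => // t /Hab[].
apply/rowP => k; rewrite summxE mxE -[in RHS]w1 -sumrB -big_split; apply: eq_bigr => t _ /=.
rewrite mxE; have [->|wt] := eqVneq (w t) 0; first by ring.
by have [_ _ ->] := Hab t wt; rewrite mxE; ring.
Qed.

Lemma conv_sub (T : finType) (A : {set T}) (f : T -> 'rV[R]_n) (Q : set 'rV[R]_n) :
  convex_set Q -> (forall t, t \in A -> Q (f t)) -> forall x, conv A f x -> Q x.
Proof.
move=> cQ H _ [w [w0 wA w1 ->]]; apply: cQ => // t wt; apply: H.
by apply: contraNT wt => /wA->.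
Qed.

Lemma flag_polytope_pol (B1 B2 : {set {set 'I_n}}) : (0 < n)%N ->
  (forall B, B \in B1 -> #|B| = 1%N) -> (forall B, B \in B2 -> #|B| = n.-1) ->
  flag_polytope2 (R := R) B1 B2 = pol [set i | [set i] \in B1] [set j | ~: [set j] \in B2].
Proof.
move=> n0 H1 H2.
have c1 : injective (fun i : 'I_n => [set i]) by exact: set1_inj.
have c2 : injective (fun j : 'I_n => ~: [set j]).
  by move=> i j /(congr1 (fun A => ~: A)); rewrite !finset.setCK => /set1_inj.
have o1 (w : {set 'I_n} -> R) : (forall B, B \notin B1 -> w B = 0) ->
    forall B, (forall i, B != [set i]) -> w B = 0.
  move=> Hw B HB; apply: Hw; apply/negP => /H1/eqP/cards1P[i E].
  by have := HB i; rewrite E eqxx.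
have o2 (w : {set 'I_n} -> R) : (forall B, B \notin B2 -> w B = 0) ->
    forall B, (forall i, B != ~: [set i]) -> w B = 0.
  move=> Hw B HB; apply: Hw; apply/negP => /H2 cB.
  have : #|~: B| = 1%N by rewrite cardsCs finset.setCK cB card_ord; lia.
  by move=> /eqP/cards1P[i E]; have := HB i; rewrite -E finset.setCK eqxx.
apply/seteqP; split.
  move=> _ [x [y [[w1 [w1p w1B w1s ->]] [w2 [w2p w2B w2s ->]] ->]]].
  exists (fun i => w1 [set i]), (fun j => w2 (~: [set j])); split.
  - split=> [i|i|]; rewrite ?w1p //; first by rewrite inE => /w1B.
    by rewrite -w1s (sum_image c1) //; exact: o1.
  - split=> [i|i|]; rewrite ?w2p //; first by rewrite inE => /w2B.
    by rewrite -w2s (sum_image c2) //; exact: o2.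
  rewrite (sum_image c1) => [|B /(o1 _ w1B)->]; last by rewrite scale0r.
  rewrite (sum_image c2) => [|B /(o2 _ w2B)->]; last by rewrite scale0r.
  have s2 : \sum_j w2 (~: [set j]) = 1 by rewrite -w2s (sum_image c2) //; exact: o2.
  apply/rowP => k; rewrite !mxE !summxE; congr (_ + _).
    rewrite (bigD1 k) //= !mxE inE eqxx mulr1 big1 ?addr0 // => i ik.
    by rewrite !mxE inE eq_sym (negPf ik) mulr0.
  rewrite -s2 (bigD1 k) //= [in RHS](bigD1 k) //= !mxE !inE eqxx mulr0 add0r addrAC subrr add0r.
  by apply: eq_bigr => i ik; rewrite !mxE !inE eq_sym ik mulr1.
move=> _ [a [b [aI bJ ->]]].
have E : \row_k (a k + (1 - b k)) = \sum_i a i *: (\sum_j b j *: (eB R [set i] + eB R (~: [set j]))).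
  case: aI bJ => a0 aI a1 [b0 bJ b1].
  transitivity (\sum_i a i *: eB R [set i] + \sum_j b j *: eB R (~: [set j])).
    apply/rowP => k; rewrite !mxE !summxE; congr (_ + _).
      rewrite (bigD1 k) //= !mxE inE eqxx mulr1 big1 ?addr0 // => i ik.
      by rewrite !mxE inE eq_sym (negPf ik) mulr0.
    rewrite -b1 (bigD1 k) //= [in RHS](bigD1 k) //= !mxE !inE eqxx mulr0 add0r addrAC subrr add0r.
    by apply: eq_bigr => i ik; rewrite !mxE !inE eq_sym ik mulr1.
  transitivity (\sum_i a i *: (eB R [set i] + \sum_j b j *: eB R (~: [set j]))).
    under [in RHS]eq_bigr do rewrite scalerDr.
    by rewrite big_split /= -scaler_suml a1 scale1r.
  apply: eq_bigr => i _; congr (_ *: _).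
  under [in RHS]eq_bigr do rewrite scalerDr.
  by rewrite big_split /= -scaler_suml b1 scale1r.
pose x := \sum_i a i *: eB R [set i]; pose y := \sum_j b j *: eB R (~: [set j]).
case: aI bJ E => a0 aI a1 [b0 bJ b1] ->.
exists x, y; split.
- apply: conv_convex => // i ai; apply: conv_point.
  by apply: contraNT ai => h; apply/eqP/aI; rewrite inE.
- apply: conv_convex => // j bj; apply: conv_point.
  by apply: contraNT bj => h; apply/eqP/bJ; rewrite inE.
under eq_bigr => i _.
  have -> : \sum_j b j *: (eB R [set i] + eB R (~: [set j])) = eB R [set i] + y.
    under eq_bigr do rewrite scalerDr.
    by rewrite big_split /= -scaler_suml b1 scale1r.
  rewrite scalerDr; over.
by rewrite big_split /= -scaler_suml a1 scale1r.
Qed.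
End RootPolytopes.

(** * Bruhat polytopes and their vertices *)

Section BruhatPolytopes.
Variables (R : realType) (n : nat).
Hypothesis n2 : (1 < n)%N.
Implicit Types (I J : {set 'I_n}) (x u v : 'S_n).

Lemma piB_root x i j : x i = n.-1 :> nat -> x j = 0%N :> nat ->
  piB R 1 (n - 1) x = rootv R i j.
Proof.
move=> xi xj; apply/rowP => k; rewrite !mxE.
have -> : (k == i) = (n - 1 <= x k)%N.
  apply/eqP/idP => [->|h]; first by rewrite xi subn1.
  by apply: (@perm_inj _ x); apply: val_inj; rewrite /= xi; have := ltn_ord (x k); lia.
have -> : (k == j) = ~~ (n - (n - 1) <= x k)%N.
  apply/eqP/idP => [->|h]; first by rewrite xj; lia.
  by apply: (@perm_inj _ x); apply: val_inj; rewrite /= xj; lia.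
have : (n - 1 <= x k)%N -> (n - (n - 1) <= x k)%N by lia.
by case: (n - 1 <= x k)%N; case: (n - (n - 1) <= x k)%N => //= H; try ring; have := H isT.
Qed.

Lemma perm_extremes x : exists i j, [/\ i != j, x i = n.-1 :> nat & x j = 0%N :> nat].
Proof.
have h1 : (n.-1 < n)%N by lia.
have h0 : (0 < n)%N by lia.
exists (x^-1 (Ordinal h1))%g, (x^-1 (Ordinal h0))%g; rewrite !permKV; split=> //.
by rewrite (inj_eq perm_inj) -val_eqE /=; lia.
Qed.

(** The combinatorial content of the equality of a Bruhat polytope with [pol I J]. Pairs with
    [i = j] are left out, since the largest and the smallest value never share a position. *)
Definition vertex_pairs I J u v := forall i j : 'I_n, i != j ->
  (i \in I /\ j \in J) <->
  exists x, [/\ bruhat_le u x, bruhat_le x v, x i = n.-1 :> nat & x j = 0%N :> nat].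

(** A convex combination can reach the extreme coordinates 2 and 0 only if every permutation of
    positive weight has them. *)
Lemma bruhat_polytope_vertices I J u v :
  @bruhat_polytope R n 1 (n - 1) u v = pol I J -> vertex_pairs I J u v.
Proof.
move=> E i j ij; rewrite -(@root_pol R n I J i j ij) -E; split=> [|[x [ux xv xi xj]]]; last first.
  rewrite -(piB_root xi xj); apply: conv_point; rewrite inE; exact/asboolP.
move=> [w [w0 wA w1 /rowP rE]].
have [x wx] : exists x, w x != 0.
  apply: contrapT => H; have := oner_neq0 R; rewrite -w1 big1 ?eqxx // => x _.
  by apply/eqP/negPn/negP => wx; apply: H; exists x.
have := rE i; have := rE j; rewrite !summxE !mxE !eqxx (negPf ij) eq_sym (negPf ij).
rewrite /= !mulr1n !mulr0n => Ej Ei.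
have Zj : \sum_y w y * piB R 1 (n - 1) y 0 j = 0.
  transitivity (1 + 0 - 1 : R); last by ring.
  by rewrite Ej; apply: eq_bigr => y _; rewrite [RHS]mxE.
have Zi : \sum_y w y * (2 - piB R 1 (n - 1) y 0 i) = 0.
  under eq_bigr do rewrite mulrBr.
  rewrite sumrB -mulr_suml w1 mul1r.
  rewrite (_ : \sum_(y : 'S_n) w y * piB R 1 (n - 1) y 0 i = 1 + 1 - 0); first by ring.
  by rewrite Ei; apply: eq_bigr => y _; rewrite [RHS]mxE.
have Zj' : w x * piB R 1 (n - 1) x 0 j = 0.
  apply: (psumr_eq0P _ Zj) => // y _; rewrite mulr_ge0 // mxE; exact: ler0n.
have Zi' : w x * (2 - piB R 1 (n - 1) x 0 i) = 0.
  apply: (psumr_eq0P _ Zi) => // y _; rewrite mulr_ge0 // mxE subr_ge0.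
  by rewrite ler_nat; lia.
exists x; have : x \in [set x | `[< bruhat_le u x /\ bruhat_le x v >]].
  by apply: contraNT wx => /wA->.
rewrite inE => /asboolP[ux xv]; split=> //.
  move/eqP: Zi'; rewrite mulf_eq0 (negPf wx) /= mxE.
  by rewrite subr_eq0 eqr_nat; have := ltn_ord (x i); lia.
by move/eqP: Zj'; rewrite mulf_eq0 (negPf wx) /= mxE pnatr_eq0; lia.
Qed.

Lemma vertices_bruhat_polytope I J u v : vertex_pairs I J u v ->
  (forall m, m \in I -> m \in J -> exists m', [/\ m' != m, m' \in I & m' \in J]) ->
  @bruhat_polytope R n 1 (n - 1) u v = pol I J.
Proof.
move=> H IJ; apply/seteqP; split.
  apply: conv_sub; first exact: pol_convex.
  move=> x; rewrite inE => /asboolP[ux xv]; have [i [j [ij xi xj]]] := perm_extremes x.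
  by rewrite (piB_root xi xj) root_pol // H //; exists x.
move=> _ [a [b [[a0 aI a1] [b0 bJ b1] ->]]].
have cQ := @conv_convex R n _ [set x | `[< bruhat_le u x /\ bruhat_le x v >]] (piB R 1 (n - 1)).
have Qr i j : i != j -> i \in I -> j \in J -> @bruhat_polytope R n 1 (n - 1) u v (rootv R i j).
  move=> ij iI jJ; have [x [ux xv xi xj]] := (H i j ij).1 (conj iI jJ).
  by rewrite -(piB_root xi xj); apply: conv_point; rewrite inE; exact/asboolP.
rewrite (_ : \row_k _ = \sum_(ij : 'I_n * 'I_n) (a ij.1 * b ij.2) *: rootv R ij.1 ij.2).
  apply: (cQ) => [ij||ij].
  - by rewrite mulr_ge0.
  - rewrite -(pair_bigA _ (fun i j => a i * b j)) /= -a1; apply: eq_bigr => i _.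
    by rewrite -mulr_sumr b1 mulr1.
  rewrite mulf_eq0 negb_or => /andP[ai bj].
  have iI : ij.1 \in I by apply: contraNT ai => /aI->.
  have jJ : ij.2 \in J by apply: contraNT bj => /bJ->.
  have [ijE|ijne] := eqVneq ij.1 ij.2; last exact: Qr.
  rewrite -ijE in jJ *; have [m [mi mI mJ]] := IJ _ iI jJ.
  (* The centre is the midpoint of two opposite roots, which exist because the common indices are
     not reduced to one. *)
  rewrite (_ : rootv R ij.1 ij.1 = \sum_(c : bool) 2^-1 *:
     (if c then rootv R ij.1 m else rootv R m ij.1)).
    apply: (cQ) => [c||c _].
    - by rewrite invr_ge0.
    - by rewrite big_bool /=; field.
    by case: c; apply: Qr => //; rewrite eq_sym.
  by rewrite big_bool /=; apply/rowP => k; rewrite !mxE; field.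
apply/rowP => k; rewrite mxE summxE.
rewrite -(pair_bigA _ (fun i j => ((a i * b j) *: rootv R i j) 0 k)) /=.
transitivity (\sum_i a i * (1 + (k == i)%:R - b k)); last first.
  apply: eq_bigr => i _.
  transitivity (\sum_j (a i * (1 + (k == i)%:R) * b j - a i * (b j * (k == j)%:R))).
    rewrite sumrB -!mulr_sumr b1 mulr1 mulrBr; congr (_ - _ * _).
    by rewrite (bigD1 k) //= eqxx mulr1 big1 ?addr0 // => j; rewrite eq_sym => /negPf->; rewrite mulr0.
  by apply: eq_bigr => j _; rewrite !mxE; ring.
transitivity (\sum_i (a i * (1 - b k) + a i * (k == i)%:R)); last by apply: eq_bigr => i _; ring.
rewrite big_split /= -mulr_suml a1 mul1r addrC; congr (_ + _).
by rewrite (bigD1 k) //= eqxx mulr1 big1 ?addr0 // => j; rewrite eq_sym => /negPf->; rewrite mulr0.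
Qed.
End BruhatPolytopes.

Lemma argmin_exists (T : finType) d (V : orderType d) (t0 : T) (f : T -> V) :
  exists i, forall k, (f i <= f k)%O.
Proof.
have [|x /mapP[i _ ->] H] := @seq_minimum _ _ (f t0) [seq f t | t <- enum T].
  by apply/mapP; exists t0; rewrite ?mem_enum.
by exists i => k; apply: H; apply/mapP; exists k; rewrite ?mem_enum.
Qed.

(** * Minimizers that define a cell *)

Section Cells.
Variables (R : realType) (n : nat) (mu nu : {set 'I_n} -> \bar R).
Hypothesis n2 : (1 < n)%N.
Hypothesis (mu_proper : proper_on n (elt_val mu)) (nu_proper : proper_on n (coelt_val nu)).
Local Notation l := (lam mu nu).

Let a (i : 'I_n) := elt_val mu i.
Let b (i : 'I_n) := coelt_val nu i.

Lemma elt_val1 (i : 'I_n) : mu [set i] = a i.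
Proof. by congr mu; apply/setP => k; rewrite !inE. Qed.

Lemma coelt_val1 (i : 'I_n) : nu (~: [set i]) = b i.
Proof. by congr nu; apply/setP => k; rewrite !inE. Qed.

Lemma argmin_elt x (i : 'I_n) : ([set i] \in argmin_bases 1 mu x) <->
  forall k, (a i - (x 0 i)%:E <= a k - (x 0 k)%:E)%E.
Proof.
rewrite inE cards1 eqxx /=; split=> [/forallP H k|H].
  by have := H [set k]; rewrite cards1 eqxx /= !elt_val1 /dotB !big_set1.
apply/forallP => B; apply/implyP => /cards1P[k ->].
by rewrite !elt_val1 /dotB !big_set1.
Qed.

Lemma dotB_compl (x : 'rV[R]_n) (j : 'I_n) : dotB x (~: [set j]) = \sum_i x 0 i - x 0 j.
Proof.
rewrite /dotB [X in _ = X - _](bigD1 j) //= addrAC subrr add0r.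
by apply: eq_bigl => i; rewrite !inE.
Qed.

(** On the complement of [j] the linear form is the constant [\sum_i x_i] minus [x_j], whence the
    opposite sign of [x]. *)
Lemma argmin_coelt x (j : 'I_n) : (~: [set j] \in argmin_bases (n - 1) nu x) <->
  forall k, (b j + (x 0 j)%:E <= b k + (x 0 k)%:E)%E.
Proof.
have cc (k : 'I_n) : #|~: [set k]| = (n - 1)%N by rewrite cardsC1 card_ord subn1.
have sh k : (b k - (dotB x (~: [set k]))%:E = (b k + (x 0 k)%:E) - (\sum_i x 0 i)%:E)%E.
  by rewrite dotB_compl; case: (b k) => [r||] //=; congr (_%:E); ring.
rewrite inE cc eqxx /=; split=> [/forallP H k|H].
  have := H (~: [set k]); rewrite cc eqxx /= !coelt_val1 !sh.
  by rewrite leeD2rE.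
apply/forallP => B; apply/implyP => /eqP cB.
have : #|~: B| = 1%N by rewrite cardsCs finset.setCK cB card_ord; lia.
move=> /eqP/cards1P[k Ek]; rewrite -[B]finset.setCK Ek !coelt_val1 !sh.
by rewrite leeD2rE.
Qed.

Definition cellI x := [set i | [set i] \in argmin_bases 1 mu x].
Definition cellJ x := [set j | ~: [set j] \in argmin_bases (n - 1) nu x].

Lemma cellE x : cell2 1 (n - 1) mu nu x = pol (cellI x) (cellJ x).
Proof.
apply: flag_polytope_pol; first by lia.
  by move=> B; rewrite inE => /andP[/eqP].
by move=> B; rewrite inE subn1 => /andP[/eqP].
Qed.

Lemma cellIP x i : i \in cellI x <-> forall k, (a i - (x 0 i)%:E <= a k - (x 0 k)%:E)%E.
Proof. by rewrite inE; exact: argmin_elt. Qed.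

Lemma cellJP x j : j \in cellJ x <-> forall k, (b j + (x 0 j)%:E <= b k + (x 0 k)%:E)%E.
Proof. by rewrite inE; exact: argmin_coelt. Qed.

Lemma cellI_neq0 x : exists i, i \in cellI x.
Proof.
have [i Hi] := argmin_exists (Ordinal n2) (fun k => (a k - (x 0 k)%:E)%E).
by exists i; apply/cellIP.
Qed.

Lemma cellJ_neq0 x : exists j, j \in cellJ x.
Proof.
have [i Hi] := argmin_exists (Ordinal n2) (fun k => (b k + (x 0 k)%:E)%E).
by exists i; apply/cellJP.
Qed.

(** Finiteness is required because an index common to both sides of a cell has a finite [l]; if [l]
    is infinite everywhere the set is empty. *)
Definition argmin_lam := [set i : 'I_n | (l i.+1 != +oo%E) && [forall j : 'I_n, (l i.+1 <= l j.+1)%E]].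

Lemma argmin_lamP i : i \in argmin_lam <-> l i.+1 != +oo%E /\ forall j : 'I_n, (l i.+1 <= l j.+1)%E.
Proof. by rewrite inE; split=> [/andP[h /forallP]|[-> h]]//; apply/forallP. Qed.

Lemma lam_elt (i : 'I_n) : l i.+1 = (a i + b i)%E.
Proof. by rewrite lamS. Qed.

Lemma aN i : a i != -oo%E. Proof. exact: (proj2 mu_proper). Qed.
Lemma bN i : b i != -oo%E. Proof. exact: (proj2 nu_proper). Qed.

Lemma cellI_fin x i : i \in cellI x -> exists r : R, a i = r%:E.
Proof.
move=> /cellIP H; have [t tn at_] := proj1 mu_proper.
have := H (Ordinal tn); move: (aN i) (aN (Ordinal tn)); rewrite /a /=.
by case: (elt_val mu i) => [r||] //; [exists r|case: (elt_val mu t) at_].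
Qed.

Lemma cellJ_fin x i : i \in cellJ x -> exists r : R, b i = r%:E.
Proof.
move=> /cellJP H; have [t tn at_] := proj1 nu_proper.
have := H (Ordinal tn); move: (bN i) (bN (Ordinal tn)); rewrite /b /=.
by case: (coelt_val nu i) => [r||] //; [exists r|case: (coelt_val nu t) at_].
Qed.

(** Adding the two minimality conditions of a common index [m], the weights [x] cancel and leave
    [l m <= l k]; equality forces equality in both conditions. *)
Lemma cell_meet x m : m \in cellI x -> m \in cellJ x ->
  forall k, k \in argmin_lam <-> k \in cellI x /\ k \in cellJ x.
Proof.
have ge i (r s : R) : a i = r%:E -> b i = s%:E -> i \in cellI x -> i \in cellJ x ->
    forall k : 'I_n, (l i.+1 <= l k.+1)%E /\ (l k.+1 = l i.+1 -> k \in cellI x /\ k \in cellJ x).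
  move=> ar bs /cellIP iI /cellJP iJ k; rewrite !lam_elt ar bs.
  have := iI k; have := iJ k; rewrite ar bs.
  case ak: (a k) (aN k) => [r'||] // _; case bk: (b k) (bN k) => [s'||] // _;
    rewrite ?addye ?addey ?leey //=.
  rewrite -!EFinB -!EFinD !lee_fin => h1 h2; split; first by lra.
  move=> [E]; split.
    by apply/cellIP => u; apply: le_trans (iI u); rewrite ak ar -!EFinB lee_fin; lra.
  by apply/cellJP => u; apply: le_trans (iJ u); rewrite bk bs -!EFinD lee_fin; lra.
move=> mI mJ k; have [r ar] := cellI_fin mI; have [s bs] := cellJ_fin mJ.
have fin i (r' s' : R) : a i = r'%:E -> b i = s'%:E -> l i.+1 != +oo%E.
  by move=> ha hb; rewrite lam_elt ha hb.
split=> [/argmin_lamP[kf kmin]|[kI kJ]].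
  have [mk] := ge m r s ar bs mI mJ k; apply.
  by apply/le_anti; rewrite mk kmin.
have [r' ar'] := cellI_fin kI; have [s' bs'] := cellJ_fin kJ.
apply/argmin_lamP; split; first exact: fin ar' bs'.
by move=> j; have [] := ge k r' s' ar' bs' kI kJ j.
Qed.

Lemma cell_argmin_lam m : m \in argmin_lam -> exists x, cellI x = argmin_lam /\ cellJ x = argmin_lam.
Proof.
move=> /argmin_lamP[mf mmin].
have [v vE] : exists v : R, l m.+1 = v%:E.
  by move: mf; rewrite lam_elt; move: (aN m) (bN m); case: (a m) => [r||] //;
     case: (b m) => [s||] //= _ _ _; exists (r + s).
(* The two conditions ask for [v - b i <= x_i <= a i], with equalities exactly when [l_i = v]. Take
   the midpoint, or a point one unit inside when one end is infinite. *)
pose x : 'rV[R]_n := \row_i match a i, b i with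
  | r%:E%E, s%:E%E => r - (r + s - v) / 2
  | r%:E%E, _ => r - 1
  | _, s%:E%E => v + 1 - s
  | _, _ => 0 end.
have key i : if i \in argmin_lam then (a i - (x 0 i)%:E = 0 /\ b i + (x 0 i)%:E = v%:E)%E
   else (0 < a i - (x 0 i)%:E /\ v%:E < b i + (x 0 i)%:E)%E.
  have iM : i \in argmin_lam <-> l i.+1 = v%:E.
    split=> [/argmin_lamP[_ imin]|lv]; first by apply/le_anti; rewrite -vE imin mmin.
    by apply/argmin_lamP; rewrite lv -vE; split.
  have lev : (v%:E <= l i.+1)%E by rewrite -vE mmin.
  move: iM lev; rewrite lam_elt mxE; move: (aN i) (bN i).
  case ai: (a i) => [r||] //; case bi: (b i) => [s||] // _ _ iM lev; case: ifP => M.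
  - have [E] := iM.1 M; rewrite -!EFinB -!EFinD; split; congr (_%:E); lra.
  - move: lev; rewrite -EFinD lee_fin le_eqVlt => /orP[/eqP E|lt].
      by have := iM.2; rewrite -EFinD E M => /(_ erefl).
    by rewrite -!EFinB -!EFinD !lte_fin; split; lra.
  - by have := iM.1 M.
  - by rewrite -EFinB lte_fin addye // ltry; split=> //; lra.
  - by have := iM.1 M.
  - by rewrite -EFinD lte_fin addye // ltry; split=> //; lra.
  - by have := iM.1 M.
  - by rewrite !addye // !ltry.
have mM : m \in argmin_lam by apply/argmin_lamP.
exists x; split; apply/setP => i.
  apply/idP/idP => [/cellIP H|iM].
    have := H m; have := key i; have := key m; rewrite mM => -[-> _].
    by case: (i \in argmin_lam) => // -[h _] /(lt_le_trans h); rewrite ltxx.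
  apply/cellIP => k; have := key i; rewrite iM => -[-> _].
  by have := key k; case: (k \in argmin_lam) => -[]; [move=> ->|move=> /ltW].
apply/idP/idP => [/cellJP H|iM].
  have := H m; have := key i; have := key m; rewrite mM => -[_ ->].
  by case: (i \in argmin_lam) => // -[_ h] /(lt_le_trans h); rewrite ltxx.
apply/cellJP => k; have := key i; rewrite iM => -[_ ->].
by have := key k; case: (k \in argmin_lam) => -[_]; [move=> ->|move=> /ltW].
Qed.
End Cells.

(** * Flag positroid subdivisions *)

Section PositroidSubdivisions.
Variables (R : realType) (n : nat) (mu nu : {set 'I_n} -> \bar R).
Hypothesis n3 : (3 <= n)%N.
Hypothesis (mu_proper : proper_on n (elt_val mu)) (nu_proper : proper_on n (coelt_val nu)).
Hypothesis flag : plucker_rel 1 (n - 1) mu nu.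
Local Notation l := (lam mu nu).
Local Notation M := (argmin_lam mu nu).
Let n2 : (1 < n)%N := ltnW n3.

(** The incidence relation for the empty set and the full set: the minimum of [l] is attained
    twice. *)
Lemma argmin_lam_other m : m \in M -> exists m', [/\ m' != m, m' \in M & m' \in M].
Proof.
move=> mM; have /argmin_lamP[mf mmin] := mM.
have [||all_oo|[t1 [t2 [_ _ t12 ft tmin]]]] := @flag finset.set0 [set: 'I_n].
- by rewrite cards0.
- by rewrite cardsT card_ord; lia.
- case/eqP: mf; rewrite lamS //; have := all_oo m; rewrite !inE => /(_ isT).
  by rewrite finset.setU0 finset.setTD elt_val1 coelt_val1.
have fE t : (mu (t |: finset.set0) + nu ([set: 'I_n] :\ t))%E = l t.+1.
  by rewrite lamS // finset.setU0 finset.setTD elt_val1 coelt_val1.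
have t1M : t1 \in M.
  apply/argmin_lamP; have tm (j : 'I_n) : (l t1.+1 <= l j.+1)%E by have := tmin j; rewrite !fE !inE; apply.
  by split=> //; apply: contraNneq mf => E; rewrite -leye_eq -E tm.
have t2M : t2 \in M.
  by move/argmin_lamP: t1M => [h1 h2]; apply/argmin_lamP; move: ft; rewrite !fE => <-.
have [E|ne] := eqVneq t1 m; last by exists t1.
by exists t2; split=> //; rewrite eq_sym -E.
Qed.

Lemma pol_supports (I J I' J' : {set 'I_n}) : pol I J = pol (R := R) I' J' ->
  forall i j, i != j -> (i \in I /\ j \in J) <-> (i \in I' /\ j \in J').
Proof. by move=> E i j ij; rewrite -!(root_pol R) // E. Qed.

Lemma rbases_support (A : nat -> nat -> R) :
  flag_polytope2 (rbases n A 1) (rbases n A (n - 1)) =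
  pol (R := R) [set i : 'I_n | A 0%N i != 0] [set j : 'I_n | mnr A n.-1 (bump j) != 0].
Proof.
rewrite flag_polytope_pol ?subn1 //; first last.
- by move=> B; rewrite inE => /andP[/eqP].
- by move=> B; rewrite inE => /andP[/eqP].
- by lia.
congr (pol _ _); apply/setP => i; rewrite !inE.
  rewrite cards1 eqxx -[rminor _ _ _]/(mnr A 1 (colfun _)).
  have -> : [set i] = [set k : 'I_n | k == i :> nat] by apply/setP => k; rewrite !inE.
  by rewrite mnr_point.
rewrite cardsC1 card_ord eqxx -[rminor _ _ _]/(mnr A n.-1 (colfun _)).
have -> : ~: [set i] = [set k : 'I_n | k != i :> nat] by apply/setP => k; rewrite !inE.
by rewrite mnr_copoint.
Qed.

Lemma rpositive_sign (A : nat -> nat -> R) d : rpositive_rank n A d ->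
  exists2 c : R, c != 0 & forall g, incr d g -> (forall j, (j < d)%N -> (g j < n)%N) ->
    0 <= c * mnr A d g.
Proof.
move=> [_ [c [c0 H]]]; exists c => // g ig gn; have [B [Bd gB]] := set_of_incr ig gn.
have := H B Bd; rewrite -[rminor _ _ _]/(mnr A d (colfun B)).
by rewrite (@eq_mnr _ A A d _ g) // => i j _ jd; rewrite gB.
Qed.

(** If the condition fails, all minimizers of [l] have the same parity. A nonnegative real flag
    realizing the cell on the minimizers would then satisfy an incidence relation whose nonzero
    terms all have one sign. *)
Lemma positroid_subdivision_balanced : flag_positroid_subdivision2 1 (n - 1) mu nu ->
  parity_balanced n l.
Proof.
move=> H k kn; apply: contrapT => Hk.
have {Hk} Hk (j : 'I_n) : odd j.+1 = ~~ odd k -> (l k < l j.+1)%E.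
  by move=> oj; rewrite ltNge; apply/negP => lj; apply: Hk; exists j.+1; split=> //; exact: ltn_ord.
have [m mmin] := argmin_exists (Ordinal n2) (fun i : 'I_n => l i.+1).
have kE : k = k.-1.+1 by lia.
have kn' : (k.-1 < n)%N by lia.
have par (j : 'I_n) : (l j.+1 <= l k)%E -> odd j.+1 = odd k.
  move=> lj; apply/eqP/negPn/negP => ne.
  have : odd j.+1 = ~~ odd k by move: ne; case: (odd j.+1); case: (odd k).
  by move/Hk; rewrite ltNge lj.
have mk : (l m.+1 <= l k)%E by rewrite kE; exact: (mmin (Ordinal kn')).
have mM : m \in M.
  apply/argmin_lamP; split=> //; apply/eqP => ly.
  have lky : l k = +oo%E by apply/eqP; rewrite -leye_eq -ly.
  pose j := if odd k then 1%N else 0%N.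
  have jn : (j < n)%N by rewrite /j; case: odd; lia.
  have jo : odd j.+1 = ~~ odd k by rewrite /j; case: (odd k).
  by have := Hk (Ordinal jn) jo; rewrite lky ltNge leey.
have parM j : j \in M -> odd j.+1 = odd k.
  by move=> /argmin_lamP[_ jmin]; apply: par; exact: le_trans (jmin m) mk.
have [x [Ix Jx]] := cell_argmin_lam n2 mu_proper nu_proper mM.
have [A [p1 p2]] := H x; rewrite cellE // Ix Jx rbases_support => E.
have PS := pol_supports E.
(* The roots reveal supports only for distinct indices; a second minimizer serves as partner. *)
have supp i : (i \in M) = (A 0%N i != 0) /\ (i \in M) = (mnr A n.-1 (bump i) != 0).
  split; apply/idP/idP => [iM|Ai].
  - have [m' [m'i m'M _]] := argmin_lam_other iM.
    by have := (PS i m' ltac:(by rewrite eq_sym)).1 (conj iM m'M); rewrite !inE => -[].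
  - have [m' [m'm m'M _]] := argmin_lam_other mM.
    have [mA] : A 0%N m != 0 /\ mnr A n.-1 (bump m') != 0.
      by have := (PS m m' ltac:(by rewrite eq_sym)).1 (conj mM m'M); rewrite !inE.
    have [->//|im'] := eqVneq i m' => m'A.
    by have := (PS i m' im').2; rewrite !inE => /(_ (conj Ai m'A))[].
  - have [m' [m'i m'M _]] := argmin_lam_other iM.
    by have := (PS m' i m'i).1 (conj m'M iM); rewrite !inE => -[].
  - have [m' [m'm m'M _]] := argmin_lam_other mM.
    have [m'A] : A 0%N m' != 0 /\ mnr A n.-1 (bump m) != 0.
      by have := (PS m' m m'm).1 (conj m'M mM); rewrite !inE.
    have [->//|im'] := eqVneq i m' => mA.
    by have := (PS m' i ltac:(by rewrite eq_sym)).2; rewrite !inE => /(_ (conj m'A Ai))[].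
have [c1 c10 H1] := rpositive_sign p1; have [c2 c20 H2] := rpositive_sign p2.
have n10 : (0 < n.-1)%N by lia.
have := incidence A n10; rewrite prednK; last by lia.
move=> /(congr1 (fun s => (-1) ^+ (~~ odd k) * (c1 * c2) * s)); rewrite mulr0 big_distrr /=.
have term (t : 'I_n) : (-1) ^+ (~~ odd k) * (c1 * c2) *
     ((-1) ^+ t * (A 0%N t * mnr A n.-1 (bump t))) =
     (c1 * A 0%N t) * (c2 * mnr A n.-1 (bump t)).
  case: (boolP (t \in M)) => tM; last first.
    by move: tM; rewrite (supp t).1 negbK => /eqP->; ring.
  have := parM t tM; rewrite /= => E1; rewrite -E1 negbK.
  rewrite -[(-1) ^+ t]signr_odd; case: (odd t); ring.
have ge0 (t : 'I_n) : 0 <= (c1 * A 0%N t) * (c2 * mnr A n.-1 (bump t)).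
  apply: mulr_ge0.
    by have := H1 (fun=> t); rewrite mnr1; apply=> [i j|j _]; [lia|].
  by rewrite subn1 in H2; apply: H2 => [i j|j]; rewrite /bump; lia.
under eq_bigr do rewrite term.
move=> s0; have /eqP := psumr_eq0P (fun t _ => ge0 t) s0 (i := m) isT.
rewrite !mulf_eq0 (negPf c10) (negPf c20) /=.
by rewrite (negPf (_ : A 0%N m != 0)) -?(supp m).1 // (negPf (_ : mnr A _ _ != 0)) // -(supp m).2.
Qed.

(** Membership for natural numbers, false outside the range, so that neighbours can be tested
    without bounds. *)
Definition inN (S : {set 'I_n}) (t : nat) := [exists i in S, i == t :> nat].

Lemma inNE S (i : 'I_n) : inN S i = (i \in S).
Proof.
apply/existsP/idP => [[j /andP[jS /eqP/val_inj<-]]|iS] //.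
by exists i; rewrite iS eqxx.
Qed.

Lemma flag_positroid_pol (I J : {set 'I_n}) : (exists i, i \in I) -> (exists j, j \in J) ->
  (forall m, m \in I -> m \in J -> exists m' : 'I_n, [/\ odd m' = ~~ odd m, m' \in I & m' \in J]) ->
  flag_positroid_polytope2 1 (n - 1) (pol (R := R) I J).
Proof.
move=> [i0 i0I] [j0 j0J] par.
pose S b : R := \sum_(u : 'I_n | odd u == b) ((u \in I) && (u \in J))%:R.
pose p t : R := (inN I t)%:R.
(* On common indices [q] counts the common indices of opposite parity; both parity classes then
   contribute [S true * S false]. *)
pose q t : R := if inN I t && inN J t then S (~~ odd t) else (inN J t)%:R.
have S0 b : 0 <= S b by apply: sumr_ge0 => u _; exact: ler0n.
have p0 t : (t < n)%N -> 0 <= p t by move=> _; exact: ler0n.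
have q0 t : (t < n)%N -> 0 <= q t by move=> _; rewrite /q; case: ifP.
have pE (i : 'I_n) : (p i != 0) = (i \in I) by rewrite /p inNE pnatr_eq0 eqb0 negbK.
have qE (i : 'I_n) : (q i != 0) = (i \in J).
  rewrite /q !inNE; case: (boolP (i \in I)) => iI /=; last by rewrite pnatr_eq0 eqb0 negbK.
  case: (boolP (i \in J)) => iJ; last by rewrite eqxx.
  have [m' [om mI mJ]] := par i iI iJ.
  rewrite gt_eqF // /S (bigD1 m') ?om ?eqxx //= mI mJ /= ltr_wpDr ?ltr01 //.
  by apply: sumr_ge0 => u _; exact: ler0n.
have orth : \sum_(t < n) (-1) ^+ t * (p t * q t) = 0.
  have pq (t : 'I_n) : p t * q t = ((t \in I) && (t \in J))%:R * S (~~ odd t).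
    rewrite /p /q !inNE; case: (t \in I); case: (t \in J) => /=; ring.
  rewrite (bigID (fun t : 'I_n => odd t)) /=.
  have -> : \sum_(t < n | odd t) (-1) ^+ t * (p t * q t) = - (S true * S false).
    rewrite {1}/S mulr_suml -sumrN; apply: eq_big => [t|t ot]; first by rewrite eqb_id.
    by rewrite pq ot -signr_odd ot mulN1r.
  have -> : \sum_(t < n | ~~ odd t) (-1) ^+ t * (p t * q t) = S false * S true.
    rewrite {1}/S mulr_suml; apply: eq_big => [t|t ot]; first by rewrite eqbF_neg.
    by rewrite pq ot -signr_odd (negPf ot) mul1r.
  by rewrite mulrC addNr.
have [||al [om [aln omn alom [qal pom] _]]] := first_last orth.
- by exists i0; rewrite // pE.
- by exists j0; rewrite // qE.
pose A := fmx n p q al om.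
have Mh t : (t < n)%N -> q al * mnr A n.-1 (bump t) =
  (-1) ^+ (al - (om < al) + al + om.+1) * (q al ^+ (n - 2) * p om) * q t.
  exact: (fmx_hyperplane n2 aln omn alom orth).
have qal0 : 0 < q al by rewrite lt_def qal q0.
have Mq (t : 'I_n) : (mnr A n.-1 (bump t) != 0) = (t \in J).
  have /(congr1 (fun z => z != 0)) := Mh t (ltn_ord t).
  by rewrite !mulf_eq0 signr_eq0 expf_eq0 (negPf qal) (negPf pom) andbF /= qE.
exists A; split.
- split.
    exists [set i0]; split; first by rewrite cards1.
    have -> : [set i0] = [set k : 'I_n | k == i0 :> nat] by apply/setP => k; rewrite !inE.
    by rewrite -[rminor _ _ _]/(mnr A 1 (colfun _)) mnr_point // -[A _ _]/(p i0) pE.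
  exists 1; split=> [|B B1]; first exact: oner_neq0.
  have [t tn ->] := card1_single B1.
  by rewrite mul1r -[rminor _ _ _]/(mnr A 1 (colfun _)) mnr_point // -[A _ _]/(p t) p0.
- split.
    exists [set k : 'I_n | k != j0 :> nat]; split; first by rewrite subn1; exact: (proj1 (colfun_cosingle _)).
    by rewrite subn1 -[rminor _ _ _]/(mnr A n.-1 (colfun _)) mnr_copoint // Mq.
  exists ((-1) ^+ (al - (om < al) + al + om.+1)); split=> [|B]; first by rewrite signr_eq0.
  rewrite subn1 => B1; have [t tn ->] := cardn1_cosingle (ltnW n2) B1.
  rewrite -[rminor _ _ _]/(mnr A n.-1 (colfun _)) mnr_copoint //.
  rewrite -(pmulr_rge0 _ qal0) mulrCA Mh // mulrA mulrA -expr2 sqrr_sign mul1r.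
  by rewrite !mulr_ge0 ?exprn_ge0 ?q0 ?p0.
rewrite rbases_support; congr (pol _ _); apply/setP => t; rewrite inE ?Mq //.
Qed.

Lemma balanced_positroid_subdivision : parity_balanced n l ->
  flag_positroid_subdivision2 1 (n - 1) mu nu.
Proof.
move=> H x; rewrite cellE //; apply: flag_positroid_pol.
- exact: cellI_neq0.
- exact: cellJ_neq0.
move=> m mI mJ; have HM := cell_meet n2 mu_proper nu_proper mI mJ.
have /argmin_lamP[mf mmin] := (HM m).2 (conj mI mJ).
have [[|j] [jn oj lj]] := H m.+1 (ltn_ord m); first by [].
have jn' : (j < n)%N by [].
have [] := (HM (Ordinal jn')).1.
  apply/argmin_lamP; split=> [|i]; last exact: le_trans lj (mmin i).
  by apply: contraNneq mf => E; rewrite -leye_eq -E; exact: lj.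
by exists (Ordinal jn'); split=> //; move: oj; rewrite /= negbK => <-; rewrite negbK.
Qed.
End PositroidSubdivisions.

(** * The tableau criterion for the Bruhat order *)

Section Bruhat.
Variable n : nat.
Implicit Types (u v x y : 'S_n) (i p q : 'I_n) (w : seq 'I_n).
Local Open Scope nat_scope.

Definition cnt x (k T : nat) : nat := \sum_(p : 'I_n) ((p < k) && (T <= x p)).

(** For fixed [k], the inequalities for all [T] say that the sorted values on the first [k]
    positions of [u] are bounded by those of [v]. *)
Definition tableau_le u v := forall k T, cnt u k T <= cnt v k T.

Lemma cnt0 x T : cnt x 0 T = 0.
Proof. by rewrite /cnt big1. Qed.

Lemma cntS x p T : cnt x p.+1 T = cnt x p T + (T <= x p).
Proof.
rewrite /cnt (bigD1 p) //= [in RHS](bigD1 p) //= ltnSn ltnn add0n addnC; congr (_ + _).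
apply: eq_bigr => r; rewrite -val_eqE /= => rp; congr (nat_of_bool (_ && _)).
by apply/idP/idP; move: rp; lia.
Qed.

(** In a product the left factor acts first, so multiplying on the left exchanges positions. The
    identity is additive to avoid truncated subtraction. *)
Lemma cnt_tperm y p q k T : p < q ->
  cnt (tperm p q * y)%g k T + (p < k <= q) * (T <= y p) =
  cnt y k T + (p < k <= q) * (T <= y q).
Proof.
move=> pq; have qp : q != p by rewrite -val_eqE /=; lia.
rewrite /cnt !(bigD1 p (P := predT)) // !(bigD1 q (P := fun i => true && (i != p))) //=.
rewrite !permM tpermL tpermR.
rewrite (eq_bigr (fun r : 'I_n => ((r < k) && (T <= y r) : nat))); first by lia.
by move=> r /andP[rp rq]; rewrite permM tpermD // eq_sym.
Qed.

Lemma cnt_ext u v : (forall k T, cnt u k T = cnt v k T) -> u = v.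
Proof.
move=> H; apply/permP => p; apply: val_inj => /=.
have := H p.+1 (u p); have := H p.+1 (v p); rewrite !cntS !H.
by rewrite !leqnn; lia.
Qed.

Lemma tableau_le_anti u v : tableau_le u v -> tableau_le v u -> u = v.
Proof. by move=> uv vu; apply: cnt_ext => k T; apply/eqP; rewrite eqn_leq uv vu. Qed.

Lemma tableau_le_trans u v x : tableau_le u v -> tableau_le v x -> tableau_le u x.
Proof. by move=> uv vx k T; exact: leq_trans (uv k T) (vx k T). Qed.

Local Notation s i := (tperm i (nxt i)).

Lemma nxtE i : i.+1 < n -> nxt i = i.+1 :> nat.
Proof. by move=> h; rewrite /nxt val_insubd h. Qed.

Lemma cnt_s y i k T : i.+1 < n -> cnt (s i * y)%g k T + (k == i.+1) * (T <= y i) =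
  cnt y k T + (k == i.+1) * (T <= y (nxt i)).
Proof.
move=> h; have E := nxtE h; have := @cnt_tperm y i (nxt i) k T.
by rewrite E ltnSn => /(_ isT); rewrite eqn_leq [(k <= _) && _]andbC.
Qed.

Lemma cntSS y i T : i.+1 < n -> cnt y i.+2 T = cnt y i.+1 T + (T <= y (nxt i)).
Proof. by move=> h; rewrite -(nxtE h) cntS. Qed.

Lemma ascent_le v i : i.+1 < n -> v i < v (nxt i) -> tableau_le v (s i * v)%g.
Proof. by move=> h lt k T; have := cnt_s v k T h; case: (k == i.+1); lia. Qed.

(** Only the counts at [i + 1] change, and there they are controlled by those at [i] and [i + 2];
    the lifting properties that follow hold for the same reason. *)
Lemma tableau_le_s u v i : i.+1 < n -> v i < v (nxt i) -> tableau_le u v ->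
  tableau_le (s i * u)%g (s i * v)%g.
Proof.
move=> h lt uv k T; have := cnt_s v k T h; have := cnt_s u k T h.
case: (eqVneq k i.+1) => [->|_]; last by have := uv k T; lia.
have := uv i T; have := uv i.+2 T; rewrite !cntSS // !cntS; lia.
Qed.

Lemma tableau_le_descent u v i : i.+1 < n -> v (nxt i) < v i -> u i < u (nxt i) ->
  tableau_le u v -> tableau_le u (s i * v)%g.
Proof.
move=> h lt ult uv k T; have := cnt_s v k T h.
case: (eqVneq k i.+1) => [->|_]; last by have := uv k T; lia.
have := uv i T; have := uv i.+2 T; rewrite !cntSS // !cntS; lia.
Qed.

Lemma adjKg i u : (s i * (s i * u))%g = u.
Proof. by rewrite mulgA tperm2 mul1g. Qed.

Lemma adjL i u : (s i * u)%g i = u (nxt i). Proof. by rewrite permM tpermL. Qed.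
Lemma adjR i u : (s i * u)%g (nxt i) = u i. Proof. by rewrite permM tpermR. Qed.

Lemma tableau_le_descents u v i : i.+1 < n -> v (nxt i) < v i -> u (nxt i) < u i ->
  tableau_le u v -> tableau_le (s i * u)%g (s i * v)%g.
Proof.
move=> h lt ult uv; apply: tableau_le_descent => //; first by rewrite adjL adjR.
apply: tableau_le_trans uv; rewrite -{2}(adjKg i u); apply: ascent_le => //.
by rewrite adjL adjR.
Qed.

Lemma word_cons i w : word_prod (i :: w) = (s i * word_prod w)%g.
Proof. by rewrite /word_prod big_cons. Qed.

Lemma is_word_cons i w v : is_word (i :: w) v ->
  i.+1 < n /\ is_word w (s i * v)%g.
Proof. by rewrite /is_word word_cons /= => -[/andP[h aw] <-]; rewrite adjKg. Qed.

Lemma is_wordS i w v : i.+1 < n -> is_word w v -> is_word (i :: w) (s i * v)%g.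
Proof. by move=> h [aw <-]; split; rewrite ?word_cons //= h. Qed.

(* Strong exchange: multiplying by a reflection that removes an inversion
   amounts to deleting one letter. *)
Lemma exchange w v p q : is_word w v -> p < q -> v q < v p ->
  exists w', is_word w' (tperm p q * v)%g /\ size w = (size w').+1.
Proof.
elim: w v p q => [|j w IH] v p q.
  by case=> _; rewrite /word_prod big_nil => <-; rewrite !perm1; lia.
move=> /is_word_cons[jn wv] pq vqp; set v1 := (s j * v)%g in wv.
have vE r : v r = v1 (s j r) by rewrite /v1 permM tpermK.
(* If the first letter keeps [p] and [q] in order, the conjugated reflection deletes a later letter;
   otherwise [p] and [q] are exchanged by the first letter, which is the one deleted. *)
case: (ltnP (s j p) (s j q)) => lt.
  have [w' [ww' sw]] := IH v1 (s j p) (s j q) wv lt ltac:(by rewrite -!vE).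
  exists (j :: w'); rewrite /= sw; split=> //.
  rewrite (_ : (_ * v)%g = (s j * (tperm (s j p) (s j q) * v1))%g); first exact: is_wordS.
  by rewrite -tpermJ /v1 conjgE tpermV !mulgA tperm2 mul1g -!mulgA adjKg.
have E := nxtE jn.
have sjE r : s j r = (if r == j :> nat then j.+1 else if r == j.+1 :> nat then (j : nat) else r) :> nat.
  case: tpermP => [->|->|rj rn].
  - by rewrite eqxx E.
  - by rewrite E eqxx; case: eqP => //; lia.
  have -> : (r == j :> nat) = false by apply/eqP => h; apply: rj; exact: val_inj.
  by have -> : (r == j.+1 :> nat) = false by apply/eqP => h; apply: rn; apply: val_inj; rewrite /= E.
have [pj qj] : p = j /\ q = nxt j.
  by split; apply: val_inj; move: lt; rewrite !sjE /= ?E; do ?case: eqP; lia.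
exists w; split=> //; rewrite pj qj; exact: wv.
Qed.

Lemma tableau_le1 u : tableau_le u 1%g -> u = 1%g.
Proof.
move=> H; have cnt1 k T : k <= T -> cnt 1%g k T = 0.
  by move=> kT; rewrite /cnt big1 // => p _; rewrite perm1; case: ltnP => //= pk; rewrite leqNgt (leq_trans pk kT).
have le p : u p <= p.
  rewrite leqNgt; apply/negP => lt; have := H p.+1 p.+1.
  by rewrite cnt1 // cntS lt addn1.
apply/permP => p; rewrite perm1; apply: val_inj => /=.
have [m pm] := ubnP p; elim: m p pm => // m IH p pm.
case: (ltngtP (u p) p) (le p) => // lt _.
have := IH (u p) ltac:(lia) => /val_inj/perm_inj E.
by move: lt; rewrite E ltnn.
Qed.

Lemma neq_nxt v i : i.+1 < n -> v i != v (nxt i) :> nat.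
Proof. by move=> h; apply/eqP => /val_inj/perm_inj E; have := nxtE h; rewrite -E; lia. Qed.

Lemma no_descent v : (forall i : 'I_n, i.+1 < n -> v i < v (nxt i)) -> v = 1%g.
Proof.
move=> H; pose g k := if insub k is Some p then v p : nat else 0.
have gE p : g p = v p by rewrite /g valK.
have ig : incr n g.
  move=> a b /andP[]; elim: b => // b IH ab bn.
  have hb : b < n by exact: ltnW.
  have step : g b < g b.+1.
    rewrite -[b]/(nat_of_ord (Ordinal hb)) gE -(nxtE (i := Ordinal hb)) // gE.
    exact: H.
  by move: ab; rewrite ltnS leq_eqVlt => /orP[/eqP->|ab] //; apply: ltn_trans (IH ab hb) step.
have idn : incr n id by move=> a b /andP[].
apply/permP => p; rewrite perm1; apply: val_inj => /=; rewrite -gE.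
apply: (incr_same ig idn) => // j jn; exists (g j) => //.
by rewrite -[j]/(nat_of_ord (Ordinal jn)) gE.
Qed.

Lemma descent_dec v : v = 1%g \/ exists2 i : 'I_n, i.+1 < n & v (nxt i) < v i.
Proof.
case: (pselect (exists2 i : 'I_n, i.+1 < n & v (nxt i) < v i)) => [?|H]; [by right|left].
apply: no_descent => i h; rewrite ltn_neqAle; apply/andP; split; first exact: neq_nxt.
by rewrite leqNgt; apply/negP => lt; apply: H; exists i.
Qed.

Lemma is_word_exists v : exists w, is_word w v.
Proof.
(* The sum of all counts decreases when a descent at [i] is removed, strictly because of the count
   at [i + 1] with threshold [v i]. *)
pose L v := \sum_(k < n.+1) \sum_(T < n.+1) cnt v k T.
have [m vm] := ubnP (L v); elim: m v vm => // m IH v vm.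
have [->|[i h lt]] := descent_dec v.
  by exists [::]; rewrite /is_word /word_prod big_nil.
have [|w ww] := IH (s i * v)%g; last first.
  by exists (i :: w); rewrite -(adjKg i v); exact: is_wordS.
apply: (@leq_trans (L v)); last by rewrite -ltnS. rewrite /L.
have le : tableau_le (s i * v)%g v.
  by rewrite -{2}(adjKg i v); apply: ascent_le => //; rewrite adjL adjR.
have hi : i.+1 < n.+1 by lia.
have hv : v i < n.+1 by have := ltn_ord (v i); lia.
rewrite (bigD1 (Ordinal hi)) //= [X in _ < X](bigD1 (Ordinal hi)) //=.
rewrite -addSn leq_add //; last by apply: leq_sum => k _; apply: leq_sum => T _; exact: le.
rewrite (bigD1 (Ordinal hv)) //= [X in _ < X](bigD1 (Ordinal hv)) //=.
rewrite -addSn leq_add //; last by apply: leq_sum => T _; exact: le.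
by have := @cnt_s v i i.+1 (v i) h; rewrite eqxx leqnn leqNgt lt; lia.
Qed.

(** Were the first letter not a descent, [exchange] would give a word for [v] that is shorter by two
    letters. *)
Lemma reduced_cons i w v : reduced_word (i :: w) v ->
  [/\ i.+1 < n, reduced_word w (s i * v)%g & v (nxt i) < v i].
Proof.
move=> [/is_word_cons[h wv] wmin]; split=> //.
  by split=> // w' w'v; have := is_wordS h w'v; rewrite adjKg => /wmin.
rewrite ltnNge; apply/negP => le.
have lt : v i < v (nxt i).
  by rewrite ltn_neqAle le andbT; exact: neq_nxt.
have [||w' [w'v sw]] := @exchange w (s i * v)%g i (nxt i) wv.
- by rewrite nxtE.
- by rewrite adjL adjR.
by have := wmin w'; rewrite adjKg in w'v; move=> /(_ w'v); rewrite /= sw; lia.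
Qed.

Lemma bruhat_tableau u v : bruhat_le u v -> tableau_le u v.
Proof.
case=> w [wv [w' [ww' w'u]]]; elim: w v w' u wv ww' w'u => [|i w IH] v w' u wv.
  move=> /eqP-> [_ <-]; case: wv => -[_ <-] _ k T; exact: leqnn.
have [h wv' lt] := reduced_cons wv.
have asc : (s i * v)%g i < (s i * v)%g (nxt i) by rewrite adjL adjR.
case: w' => [|j w'] /=.
  move=> _ wu; have uv : tableau_le u (s i * v)%g by apply: (IH _ [::]) wu => //; exact: sub0seq.
  by apply: tableau_le_trans uv _; rewrite -{2}(adjKg i v); exact: ascent_le.
case: eqP => [->|_] ww' wu; last first.
  have uv : tableau_le u (s i * v)%g by apply: (IH _ (j :: w')) wu.
  by apply: tableau_le_trans uv _; rewrite -{2}(adjKg i v); exact: ascent_le.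
have [_ wu'] := is_word_cons wu.
rewrite -(adjKg i u) -(adjKg i v); apply: tableau_le_s => //.
exact: IH wv' ww' wu'.
Qed.

Lemma tableau_bruhat u v : tableau_le u v -> bruhat_le u v.
Proof.
have [w0 w0v] := is_word_exists v; have [m wm] := ubnP (size w0).
elim: m w0 u v w0v wm => // m IH w0 u v w0v wm uv.
have [v1|[i h lt]] := descent_dec v.
  have u1 : u = 1%g by apply: tableau_le1; rewrite -v1.
  have e1 : is_word [::] (1%g : 'S_n) by rewrite /is_word /word_prod big_nil.
  by exists [::]; rewrite v1 u1; split; [split|exists [::]].
have [||w1 [w1v sw1]] := @exchange w0 v i (nxt i) w0v; rewrite ?nxtE //.
(* [u'] is whichever of [u] and [s i * u] has an ascent at [i]; the lifting property places it below
   [s i * v]. *)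
have [u' [uv' Hu]] : exists u', tableau_le u' (s i * v)%g /\
    forall w w', subseq w' w -> is_word w' u' -> exists2 w'', subseq w'' (i :: w) & is_word w'' u.
  case: (ltnP (u i) (u (nxt i))) => ui.
    exists u; split; first exact: tableau_le_descent.
    by move=> w w' ww' w'u; exists w' => //; apply: subseq_trans ww' (subseq_cons _ _).
  exists (s i * u)%g; split.
    apply: tableau_le_descents => //; rewrite ltn_neqAle ui andbT eq_sym.
    exact: neq_nxt.
  move=> w w' ww' w'u; exists (i :: w'); first by rewrite /= eqxx.
  by rewrite -(adjKg i u); exact: is_wordS.
have [w [wv [w' [ww' w'u']]]] := IH w1 u' (s i * v)%g w1v ltac:(lia) uv'.
have [w'' sw'' w''u] := Hu w w' ww' w'u'.
exists (i :: w); split; last by exists w''.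
split; first by rewrite -(adjKg i v); apply: is_wordS => //; case: wv.
(* The word is reduced: by exchange, any word for [v] yields one for [s i * v] with one letter
   less. *)
move=> z zv; have [||z1 [z1v sz1]] := @exchange z v i (nxt i) zv; rewrite ?nxtE //.
by rewrite sz1 /= ltnS; exact: (proj2 wv) z1v.
Qed.

Theorem bruhatE u v : bruhat_le u v <-> tableau_le u v.
Proof. by split; [exact: bruhat_tableau|exact: tableau_bruhat]. Qed.
End Bruhat.

(** * Extreme values in Bruhat intervals *)

Section Moves.
Variable n : nat.
Implicit Types (u v x y : 'S_n) (i j p q : 'I_n).
Local Open Scope nat_scope.

Lemma cnt_sub x k k' T : k <= k' -> cnt x k T <= cnt x k' T <= cnt x k T + (k' - k).
Proof.
move=> kk; rewrite -(subnKC kk); elim: (k' - k) => [|d IH]; first by rewrite addn0 subnn addn0 leqnn.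
rewrite addnS; case: (ltnP (k + d) n) => h.
  by have := @cntS _ x (Ordinal h) T; rewrite /=; move: IH; lia.
suff -> : cnt x (k + d).+1 T = cnt x (k + d) T by move: IH; lia.
apply: eq_bigr => p _; have := ltn_ord p; lia.
Qed.

Lemma cnt_n x T : cnt x n T = n - T.
Proof.
rewrite /cnt (eq_bigr (fun p => (T <= x p : nat))); last by move=> p _; rewrite ltn_ord.
rewrite (reindex_inj (@perm_inj _ x^-1%g)) /=.
rewrite (eq_bigr (fun p : 'I_n => (T <= p : nat))); last by move=> p _; rewrite permKV.
elim: (n) => [|m IH]; first by rewrite big_ord0.
by rewrite big_ord_recr /= IH; lia.
Qed.

Lemma cnt_ge x k T : k <= n -> k - T <= cnt x k T.
Proof. by move=> kn; have := cnt_sub x T kn; rewrite cnt_n; lia. Qed.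

Lemma cnt_le x k T : cnt x k T <= k.
Proof. by have := cnt_sub x T (leq0n k); rewrite cnt0; lia. Qed.

Lemma cnt_big x k T : n <= T -> cnt x k T = 0.
Proof.
move=> nT; rewrite /cnt big1 // => p _; have := ltn_ord (x p); lia.
Qed.

Lemma cnt_out x k T : n <= k -> cnt x k T = n - T.
Proof.
move=> nk; rewrite -(cnt_n x); apply: eq_bigr => p _; have := ltn_ord p; lia.
Qed.

Lemma cnt_T0 x k : k <= n -> cnt x k 0 = k.
Proof. by move=> kn; have := cnt_ge x 0 kn; have := cnt_le x k 0; lia. Qed.

Lemma cnt_some x k T p : p < k -> T <= x p -> 0 < cnt x k T.
Proof.
move=> pk Tp; have := cnt_sub x T pk; have := cntS x p T; rewrite Tp; lia.
Qed.

Lemma cnt_none x k T : (forall p, p < k -> x p < T) -> cnt x k T = 0.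
Proof.
move=> H; rewrite /cnt big1 // => p _; case: (ltnP p k) => //= /H; lia.
Qed.

Lemma cnt_eq0 x k T : cnt x k T = 0 -> forall p, p < k -> x p < T.
Proof. by move=> H p pk; rewrite ltnNge; apply/negP => h; have := cnt_some pk h; lia. Qed.

Lemma cnt_tail_all x k T : k <= n -> (forall p, k <= p -> T <= x p) -> cnt x k T = k - T.
Proof.
move=> kn H.
have key k' : k <= k' <= n -> cnt x k' T = cnt x k T + (k' - k).
  elim: k' => [|k' IH] /andP[h1 h2].
    by have -> : k = 0; lia.
  move: h1; rewrite leq_eqVlt => /orP[/eqP->|h1]; first by rewrite subnn addn0.
  have := IH ltac:(lia); have := @cntS _ x (Ordinal h2) T; have /= := H (Ordinal h2) h1.
  by move=> /= -> /= -> ->; lia.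
have := key n ltac:(by rewrite kn leqnn); rewrite cnt_n.
have [kT|Tk] := leqP k T; last by lia.
case: (ltnP T n) => Tn; last by have := cnt_big x k Tn; lia.
case: (ltnP k n) => kn'; lia.
Qed.

(** Of the [n - T] values from [T] on, the positions from [k] on can hold at most [n - k - 1], one
    of them being taken by a smaller value. *)
Lemma cnt_tail_some x k T p : k <= n -> k <= p -> x p < T -> k.+1 - T <= cnt x k T.
Proof.
move=> kn kp xT; have := cnt_sub x T kp; have := cntS x p T.
have -> : (T <= x p) = false by lia.
have := cnt_sub x T (ltn_ord p); rewrite cnt_n; have := ltn_ord p; lia.
Qed.

Lemma cnt_tail x k T : T <= k <= n -> cnt x k T <= k - T -> forall p, k <= p -> T <= x p.
Proof.
move=> /andP[Tk kn] H p kp; rewrite leqNgt; apply/negP => h.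
by have := cnt_tail_some kn kp h; lia.
Qed.

Lemma cnt_tperm_le y p q k T : p <= q ->
  cnt (tperm p q * y)%g k T + ((p < k <= q) && (T <= y p)) =
  cnt y k T + ((p < k <= q) && (T <= y q)).
Proof.
rewrite leq_eqVlt => /orP[/eqP/val_inj->|pq].
  by rewrite tperm1 mul1g.
by have := cnt_tperm y k T pq; case: (p < k <= q); rewrite ?mul1n ?mul0n.
Qed.

(** A count can drop only for [j < k <= j'] and [T <= y j]. There [u] has its large values at all
    positions from [k] on, so its count is the least possible, [k - T], while the 0 at [j'] gives
    [y] at least one more. [top_move] is the dual statement. *)
Lemma zero_move u y j j' S : j <= j' -> y j' = 0 :> nat -> y j <= S ->
  (forall p, j < p -> S <= u p) -> tableau_le u y ->
  tableau_le u (tperm j j' * y)%g /\ tableau_le (tperm j j' * y)%g y.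
Proof.
move=> jj' y0 yS uS uy; split=> k T; have := cnt_tperm_le y k T jj'; have := uy k T;
  rewrite y0; last by lia.
case: (boolP ((j < k <= j') && (T <= y j))) => [/andP[/andP[jk kj'] Ty]|_]; last by lia.
case: T Ty => [|T] Ty; first by lia.
have kn : k <= n by have := ltn_ord j'; lia.
have := @cnt_tail_some y k T.+1 j' kn kj' ltac:(lia).
have := @cnt_tail_all u k T.+1 kn (fun p kp => leq_trans Ty (leq_trans yS (uS p (leq_trans jk kp)))).
by have := ltn_ord j'; have := cnt_n u T.+1; lia.
Qed.

Lemma top_move u y i i' S : i' <= i -> y i' = n.-1 :> nat -> S <= y i ->
  (forall p, p < i -> u p <= S) -> tableau_le u y ->
  tableau_le u (tperm i' i * y)%g /\ tableau_le (tperm i' i * y)%g y.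
Proof.
move=> ii' y0 yS uS uy; split=> k T; have := cnt_tperm_le y k T ii'; have := uy k T;
  rewrite y0; last by have := ltn_ord (y i); lia.
case: (boolP ((i' < k <= i) && (T <= n.-1))) => [/andP[/andP[ik ki] Tn]|_]; last by lia.
case: (leqP T (y i)) => Ty; first by lia.
have -> : cnt u k T = 0 by apply: cnt_none => p pk; have := uS p ltac:(lia); lia.
by lia.
Qed.

(** Here [u] preserves the set of the first [j + 1] positions, so its counts at [j + 1] are the
    least of any permutation and an exchange across this cut cannot fall below them. *)
Lemma split_move u y j j' : j' = j.+1 :> nat -> y j' <= y j ->
  (forall p, j < p -> j < u p) -> tableau_le u y ->
  tableau_le u (tperm j j' * y)%g /\ tableau_le (tperm j j' * y)%g y.
Proof.
move=> jE yj uj uy; have jj' : j <= j' by lia.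
split=> k T; have := cnt_tperm_le y k T jj'; have := uy k T; last by rewrite jE; lia.
have [kE|ne] := eqVneq k j.+1; last by rewrite jE; lia.
have jn : j.+1 <= n by have := ltn_ord j; lia.
have := @cnt_ge (tperm j j' * y)%g k T; have := @cnt_tail_all u j.+1 j.+1 jn uj.
rewrite kE subnn => u0 /(_ jn) ge _ _.
case: (leqP T j.+1) => Tj.
  by rewrite (@cnt_tail_all u j.+1 T jn) // => p jp; apply: leq_trans Tj (uj p jp).
rewrite cnt_none // => p pj; have := cnt_eq0 u0 pj; lia.
Qed.
End Moves.

(** * Intervals below a coset minimum *)

Section CosetMinimum.
Variable n : nat.
Variables a b : 'I_n.
Hypothesis ab : a != b.
Local Open Scope nat_scope.

Let ab' : a <> b :> nat. Proof. by move/val_inj/eqP; rewrite (negPf ab). Qed.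

Definition vmin_val (p : 'I_n) : nat :=
  if p == a then n.-1 else if p == b then 0 else (p - (a < p) - (b < p)).+1.

Lemma vmin_val_lt p : vmin_val p < n.
Proof.
rewrite /vmin_val -!val_eqE /=; have := ltn_ord p; have := ltn_ord a; have := ltn_ord b.
do 2?case: eqP; lia.
Qed.

Lemma vmin_val_inj : injective (fun p => Ordinal (vmin_val_lt p)).
Proof.
move=> p q /(congr1 val) /=; rewrite /vmin_val -!val_eqE /= => E; apply: val_inj => /=.
have := ltn_ord p; have := ltn_ord q; have := ltn_ord a; have := ltn_ord b.
by move: E; do 4?case: eqP; lia.
Qed.

(* The minimum of its coset: n-1 at position a, 0 at position b, the other
   values in increasing order. *)
Definition vmin : 'S_n := perm vmin_val_inj.

Lemma vminE p : vmin p = vmin_val p :> nat. Proof. by rewrite permE. Qed.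
Lemma vmin_a : vmin a = n.-1 :> nat. Proof. by rewrite vminE /vmin_val eqxx. Qed.
Lemma vmin_b : vmin b = 0 :> nat.
Proof. by rewrite vminE /vmin_val eqxx eq_sym (negPf ab). Qed.
Lemma vmin_other p : p != a -> p != b -> vmin p = (p - (a < p) - (b < p)).+1 :> nat.
Proof. by move=> pa pb; rewrite vminE /vmin_val (negPf pa) (negPf pb). Qed.

Lemma cnt_vmin k T : 0 < T < n -> k <= n ->
  cnt vmin k T = (a < k) + (k - (a < k) - (b < k) - T.-1).
Proof.
move=> Tn; elim: k => [_|k IH kn]; first by rewrite cnt0; lia.
rewrite (@cntS _ vmin (Ordinal kn) T) /= IH ?(ltnW kn) // vminE /vmin_val -!val_eqE /=.
by have := ltn_ord a; have := ltn_ord b; do 2?case: eqP; lia.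
Qed.

(** The count of [vmin] is the maximum of three lower bounds: the general one, the one that knows a
    0 not before [k], and the one that knows [n - 1] before [k]. *)
Lemma vmin_le (x : 'S_n) : x a = n.-1 :> nat -> x b = 0 :> nat -> tableau_le vmin x.
Proof.
move=> xa xb k T; case: (leqP k n) => kn; last by rewrite !cnt_out // ltnW.
case: T => [|T]; first by rewrite !cnt_T0.
case: (ltnP T.+1 n) => Tn; last by rewrite !cnt_big.
rewrite cnt_vmin //.
have h1 := cnt_ge x T.+1 kn.
have h2 : k <= b -> k.+1 - T.+1 <= cnt x k T.+1.
  by move=> kb; apply: (@cnt_tail_some _ x k T.+1 b kn kb); rewrite xb.
have h3 : a < k -> 0 < cnt x k T.+1.
  by move=> ak; apply: (@cnt_some _ x k T.+1 a ak); rewrite xa; lia.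
by lia.
Qed.
End CosetMinimum.

Section Intervals.
Variables (R : realType) (n : nat).
Hypothesis n2 : (1 < n)%N.
Implicit Types (u v x y : 'S_n) (i j p q : 'I_n) (I J M : {set 'I_n}).
Local Open Scope nat_scope.

Lemma vmin_minimal (a b : 'I_n) (ab : a != b) : bruhat_minimal R 1 (n - 1) (vmin ab).
Proof.
move=> x E /bruhatE xv; have [i [j [ij xi xj]]] := perm_extremes n2 x.
move: E; rewrite (piB_root R n2 xi xj) (piB_root R n2 (vmin_a ab) (vmin_b ab)).
move=> /(root_inj ij ab)[ia jb].
by apply: tableau_le_anti => //; apply: vmin_le; rewrite -?ia -?jb.
Qed.

Lemma minimal_vmin v : bruhat_minimal R 1 (n - 1) v ->
  exists (a b : 'I_n) (ab : a != b), v = vmin ab.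
Proof.
move=> Hv; have [a [b [ab va vb]]] := perm_extremes n2 v; exists a, b, ab; apply/esym.
apply: Hv; last by apply/bruhatE; exact: vmin_le.
by rewrite (piB_root R n2 va vb) (piB_root R n2 (vmin_a ab) (vmin_b ab)).
Qed.

Section Bounds.
Variables (a b : 'I_n) (ab : a != b).
Let ab' : a <> b :> nat. Proof. by move/val_inj/eqP; rewrite (negPf ab). Qed.

(** For [a < i] and [i != b] this is the value of [vmin] at [i], and [vbot j] is its value at [j]
    for [j < b] and [j != a]: the values displaced when [n - 1] or 0 is moved there. *)
Definition vtop (i : nat) := i - (b <= i).
Definition vbot (j : nat) := j + (j <= a).

Lemma top_lt_a x i : tableau_le x (vmin ab) -> x i = n.-1 :> nat -> a <= i.
Proof.
move=> xv xi; rewrite leqNgt; apply/negP => ia.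
have := xv i.+1 n.-1; have := ltn_ord a; have := ltn_ord b => hb ha.
by rewrite cntS xi leqnn cnt_vmin; lia.
Qed.

Lemma bot_gt_b x j : tableau_le x (vmin ab) -> x j = 0 :> nat -> j <= b.
Proof.
move=> xv xj; rewrite leqNgt; apply/negP => bj; have jn := ltn_ord j.
have := xv j 1; rewrite cnt_vmin; [|lia|lia].
have := cntS x j 1; rewrite xj => E.
have : cnt x j.+1 1 = j.+1 - 1.
  apply: cnt_tail_all => // p jp; rewrite lt0n; apply/eqP => xp.
  have /perm_inj/(congr1 val)/= : x p = x j by apply: val_inj; rewrite /= xp xj.
  by lia.
by rewrite E; lia.
Qed.

(** A larger value of [u] before [i], together with [n - 1] at [i], would give [x] two values above
    [vtop i] on the first [i + 1] positions, where [vmin] has one. *)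
Lemma top_bound u x i : tableau_le u x -> tableau_le x (vmin ab) -> x i = n.-1 :> nat ->
  forall p, p < i -> u p <= vtop i.
Proof.
move=> ux xv xi p pi; have ai := top_lt_a xv xi.
have hi := ltn_ord i; have hp := ltn_ord (u p).
rewrite leqNgt; apply/negP => up; have := ux i (vtop i).+1; have := xv i.+1 (vtop i).+1.
have := @cnt_some _ u i (vtop i).+1 p pi up.
rewrite cntS xi cnt_vmin /vtop; move: up; rewrite /vtop; lia.
Qed.

Lemma bot_bound u x j : tableau_le u x -> tableau_le x (vmin ab) -> x j = 0 :> nat ->
  j < b -> forall p, j < p -> vbot j <= u p.
Proof.
move=> ux xv xj jb p jp; have hj := ltn_ord j; have hb := ltn_ord b.
rewrite leqNgt; apply/negP => up; have := ux j.+1 (vbot j); have := xv j (vbot j).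
have := @cnt_tail_some _ u j.+1 (vbot j) p hj jp up.
rewrite (cntS x j) xj /vbot; case: (leqP j a) => ja; rewrite cnt_vmin; lia.
Qed.

Lemma top_excluded u x i p : tableau_le u x -> tableau_le x (vmin ab) ->
  p < i -> vtop i < u p -> x i <> n.-1 :> nat.
Proof. by move=> ux xv pi up xi; have := top_bound ux xv xi pi; lia. Qed.

Lemma bot_excluded u x j p : tableau_le u x -> tableau_le x (vmin ab) ->
  j < b -> j < p -> u p < vbot j -> x j <> 0 :> nat.
Proof. by move=> ux xv jb jp up xj; have := bot_bound ux xv xj jb jp; lia. Qed.

Lemma vmin_top i : i != a -> i != b -> vtop i <= vmin ab i.
Proof. by move=> ia ib; rewrite vmin_other // /vtop; lia. Qed.

Lemma vmin_bot j : j != a -> j != b -> vmin ab j <= vbot j.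
Proof. by move=> ja jb; rewrite vmin_other //; move: ja; rewrite -val_eqE /= /vbot; lia. Qed.
End Bounds.

Lemma vertex_pairs_no_isolated M u v m : bruhat_le u v -> bruhat_minimal R 1 (n - 1) v ->
  (forall k, k \in M -> exists k', k' != k /\ k' \in M) ->
  m \in M -> (forall k, k \in M -> k != m.+1 :> nat /\ k.+1 != m :> nat) ->
  ~ vertex_pairs M M u v.
Proof.
move=> /bruhatE uv /minimal_vmin[a [b [ab vE]]] Mother mM iso H; subst v.
have ab' : a <> b :> nat by move/val_inj/eqP; rewrite (negPf ab).
have pair i j : i != j -> i \in M -> j \in M ->
    exists x, [/\ tableau_le u x, tableau_le x (vmin ab), x i = n.-1 :> nat & x j = 0 :> nat].
  move=> ij iM jM; have [x [/bruhatE ux /bruhatE xv xi xj]] := (H i j ij).1 (conj iM jM).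
  by exists x.
have inM x i j : i != j -> tableau_le u x -> tableau_le x (vmin ab) ->
    x i = n.-1 :> nat -> x j = 0 :> nat -> i \in M /\ j \in M.
  by move=> ij ux xv xi xj; apply: (H i j ij).2; exists x; split=> //; exact/bruhatE.
have [aM bM] := inM _ a b ab uv (fun k T => leqnn _) (vmin_a ab) (vmin_b ab).
have F1 i : i \in M -> a <= i /\ forall p, p < i -> u p <= vtop b i.
  move=> iM; have [j [ji jM]] := Mother i iM; rewrite eq_sym in ji.
  have [x [ux xv xi xj]] := pair i j ji iM jM.
  by split; [exact: top_lt_a xv xi|move=> p pi; exact: top_bound ux xv xi _ pi].
have F2 j : j \in M -> j <= b /\ (j < b -> forall p, j < p -> vbot a j <= u p).
  move=> jM; have [i [ij iM]] := Mother j jM.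
  have [x [ux xv xi xj]] := pair i j ij iM jM.
  by split; [exact: bot_gt_b xv xj|move=> jb p jp; exact: bot_bound ux xv xj jb _ jp].
have ablt : a < b by have := (F1 b bM).1; lia.
have [am Fm1] := F1 m mM; have [mb Fm2] := F2 m mM.
have vv : tableau_le (vmin ab) (vmin ab) by move=> k T; exact: leqnn.
(* Moving n-1 to m+1, or 0 to m-1, stays in the interval. *)
have no_top : m < b -> (forall p, p <= m -> u p <= m.+1) -> False.
  move=> mb' ub; have mn : m.+1 < n by have := ltn_ord b; lia.
  pose c := Ordinal mn; have cb : c != b.
    by apply/eqP => E; have := (iso b bM).1; rewrite -E eqxx.
  have ca : c != a by rewrite -val_eqE /=; lia.
  have cb' : c < b by move: cb; rewrite -val_eqE /=; lia.
  have vc : vmin ab c = m.+1 :> nat by rewrite vmin_other //=; lia.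
  have [||p|ux xv] := @top_move _ u (vmin ab) c a m.+1 _ (vmin_a ab) _ _ uv.
  - by rewrite /=; lia.
  - by rewrite vc.
  - by rewrite /= ltnS; exact: ub.
  have [] := inM _ c b cb ux xv.
  - by rewrite permM tpermR vmin_a.
  - by rewrite permM tpermD ?vmin_b // eq_sym.
  by move=> cM _; have := (iso c cM).1; rewrite /= eqxx.
have no_bot : a < m -> (forall p, m <= p -> m.-1 <= u p) -> False.
  move=> am' lb; have mn : m.-1 < n by have := ltn_ord m; lia.
  pose c := Ordinal mn; have ca : c != a.
    apply/eqP => E; have := (iso a aM).2; rewrite -E /=; lia.
  have ca' : a < c by move: ca; rewrite -val_eqE /=; lia.
  have cb : c != b by rewrite -val_eqE /=; lia.
  have vc : vmin ab c = m.-1 :> nat by rewrite vmin_other //=; move: ca' => /=; lia.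
  have [||p|ux xv] := @zero_move _ u (vmin ab) c b m.-1 _ (vmin_b ab) _ _ uv.
  - by rewrite /=; lia.
  - by rewrite vc.
  - by rewrite /= => cp; apply: lb; lia.
  have [] := inM _ a c (_ : a != c) ux xv; first by rewrite eq_sym.
  - by rewrite permM tpermD ?vmin_a // eq_sym.
  - by rewrite permM tpermL vmin_b.
  by move=> _ cM; have := (iso c cM).2; rewrite /=; lia.
(* If [m = b], the first [m] positions of [u] hold the values below [m], so all later values are at
   least [m]. *)
have [mE|mb1] := eqVneq m b.
  have am' : a < m by rewrite mE.
  apply: no_bot => // p mp.
  have ub q : q < m -> u q < m by move=> qm; have := Fm1 q qm; rewrite /vtop mE leqnn; lia.
  have mn : m <= n by exact: ltnW.
  have := @cnt_tail _ u m m _ _ p mp; rewrite leqnn mn cnt_none // => /(_ isT isT); lia.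
have mb' : m < b by move: mb1; rewrite -val_eqE /=; lia.
have [mE|ma1] := eqVneq m a.
  apply: no_top => // p pm; have mn : m.+1 <= n by exact: ltn_ord.
  have ub q : m < q -> m.+1 <= u q.
    by move=> mq; have := Fm2 mb' q mq; rewrite /vbot mE leqnn; lia.
  have := @cnt_tail_all _ u m.+1 m.+1 mn ub; rewrite subnn => u0.
  by have := cnt_eq0 u0 (p := p); rewrite ltnS => /(_ pm); lia.
have am' : a < m by move: ma1; rewrite -val_eqE /=; lia.
(* Strictly between [a] and [b], the bounds leave at most [m] before position [m] and at least [m]
   after it; the value at [m] itself decides which of the two moves is possible. *)
case: (leqP (u m) m) => um.
  apply: no_top => // p pm; have [->|pm'] := eqVneq p m; first by lia.
  have := Fm1 p; move: pm'; rewrite -val_eqE /= /vtop => pm' /(_ ltac:(lia)); lia.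
apply: no_bot => // p mp; have [->|pm'] := eqVneq p m; first by lia.
have := Fm2 mb' p; move: pm'; rewrite -val_eqE /= /vbot => pm' /(_ ltac:(lia)); lia.
Qed.
End Intervals.

(** * The lower end of the interval *)

Section BlockRotations.
Variable n : nat.
Implicit Types (A : pred nat) (s w : 'S_n) (p q m : 'I_n).
Local Open Scope nat_scope.

(* The blocks are the intervals [m, m') of [0, n) between consecutive elements
   of A; each of them is rotated. *)
Definition block_rotation A s := forall m,
  if A m then [/\ m <= s m, forall r, m < r <= s m -> ~~ A r & (s m).+1 < n -> A (s m).+1]
  else (s m).+1 = m.

Lemma block_rotation_exists A : A 0 -> exists s, block_rotation A s.
Proof.
move=> A0; pose spec (m e : 'I_n) :=
  if A m then [/\ m <= e, forall r, m < r <= e -> ~~ A r & e.+1 < n -> A e.+1]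
  else e.+1 = m.
have /choice[f Hf] : forall m, exists e, spec m e.
  move=> m; rewrite /spec; case Am: (A m); last first.
    have mn := ltn_ord m; have m0 : 0 < m.
      by rewrite lt0n; apply/eqP => E; rewrite E A0 in Am.
    have h : m.-1 < n by lia.
    by exists (Ordinal h) => /=; lia.
  pose P r := (m < r) && (A r || (n <= r)).
  have exP : exists r, P r by exists n; rewrite /P ltn_ord leqnn orbT.
  case: (ex_minnP exP) => r /andP[mr Ar] rmin.
  have rn : r <= n by apply: rmin; rewrite /P ltn_ord leqnn orbT.
  have h : r.-1 < n by have := ltn_ord m; lia.
  exists (Ordinal h); split=> /=; first by lia.
    move=> k /andP[mk kr]; apply/negP => Ak.
    by have := rmin k; rewrite /P mk Ak => /(_ isT); lia.
  rewrite prednK; last by lia.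
  by move=> rn'; case/orP: Ar => //; lia.
have fi : injective f.
  move=> p q E; have Hp := Hf p; have Hq := Hf q; rewrite /spec -?E in Hp Hq.
  apply: contrapT => pq; have {}pq : p <> q :> nat by move/val_inj.
  case Ap: (A p) Hp; case Aq: (A q) Hq.
  - move=> [h1 h2 h3] [h4 h5 h6]; case: (ltngtP p q) => // lt.
      by have := h5 q; rewrite Aq lt h1 => /(_ isT).
    by have := h2 p; rewrite Ap lt h4 => /(_ isT).
  - move=> h1 [h4 h5 h6]; have := ltn_ord q; rewrite -h1 => /h6.
    by rewrite h1 Aq.
  - move=> [h4 h5 h6] h1; have := ltn_ord p; rewrite -h1 => /h6.
    by rewrite h1 Ap.
  - by move=> h1 h2; lia.
by exists (perm fi) => m; rewrite permE; exact: Hf.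
Qed.

Section Theory.
Variables (A : pred nat) (s : 'S_n).
Hypothesis (A0 : A 0) (rs : block_rotation A s).

Lemma rot_start m : A m -> [/\ m <= s m, forall r, m < r <= s m -> ~~ A r &
   (s m).+1 < n -> A (s m).+1].
Proof. by move=> Am; have := rs m; rewrite Am. Qed.

Lemma rot_inner m : ~~ A m -> (s m).+1 = m.
Proof. by move=> /negPf Am; have := rs m; rewrite Am. Qed.

Lemma rot_ge m : m <= (s m).+1.
Proof.
by case: (boolP (A m)) => [/rot_start[]|/rot_inner->] //; lia.
Qed.

Lemma rot_lt c m : A c -> m < c -> s m < c.
Proof.
move=> Ac mc; case: (boolP (A m)) => [/rot_start[_ h _]|/rot_inner]; last by lia.
by rewrite ltnNge; apply/negP => cs; have := h c; rewrite mc cs Ac => /(_ isT).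
Qed.

Lemma rot_geq c m : A c -> c <= m -> c <= s m.
Proof.
move=> Ac cm; case: (boolP (A m)) => [/rot_start[h _ _]|Am]; first by lia.
have := rot_inner Am; have : c != m by apply: contraNneq Am => <-.
by lia.
Qed.

(** [s] maps the first [k] positions to the first [k - 1] positions and the end of the block that
    contains [k - 1]. *)
Lemma rot_cnt w k T : 0 < k <= n ->
  exists p, [/\ p < k, A p, forall r, p < r < k -> ~~ A r &
     cnt (s * w)%g k T = cnt w k.-1 T + (T <= w (s p))].
Proof.
elim: k => // k IH /andP[_ kn]; have E := cntS (s * w)%g (Ordinal kn) T; rewrite /= permM in E.
case: (posnP k) => [k0|k0].
  subst k; exists (Ordinal kn); split=> //=; first by move=> r; lia.
have [p [pk Ap pr Ep]] := IH ltac:(lia).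
have [h1 h2 h3] := rot_start Ap.
have w_pred (e : 'I_n) : e = k.-1 :> nat -> cnt w k T = cnt w k.-1 T + (T <= w e).
  by move=> ek; have := cntS w e T; rewrite ek prednK.
case: (boolP (A k)) => Ak.
  exists (Ordinal kn); split=> //=; first by move=> r; lia.
  have sp : s p = k.-1 :> nat.
    have := @rot_lt k p Ak pk; move=> sk; apply/eqP; rewrite eqn_leq; apply/andP; split; first by lia.
    rewrite leqNgt; apply/negP => lt; have := pr (s p).+1; rewrite h3; last by lia.
    by move=> /(_ ltac:(lia)).
  by rewrite E Ep (w_pred (s p) sp).
exists p; split=> //; first by lia.
  move=> r /andP[pr' rk]; have [->//|rk'] := eqVneq r k.
  by apply: pr; lia.
have sk : s (Ordinal kn) = k.-1 :> nat
  by apply: succn_inj; rewrite prednK //; exact: (@rot_inner (Ordinal kn) Ak).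
by rewrite E Ep /= (w_pred _ sk) addnAC.
Qed.

Lemma rot_cnt_le w k T : k <= n -> cnt (s * w)%g k T <= cnt w k.-1 T + (0 < k).
Proof.
case: k => [|k] kn; first by rewrite cnt0.
by have [p [_ _ _ ->]] := @rot_cnt w k.+1 T ltac:(lia); rewrite leq_add2l leq_b1.
Qed.

Lemma rot_cnt_start w k T : k <= n -> A k || (k == n) -> cnt (s * w)%g k T = cnt w k T.
Proof.
move=> kn Ak; case: (posnP k) => [->|k0]; first by rewrite !cnt0.
have [p [pk Ap pr ->]] := @rot_cnt w k T ltac:(lia).
have [h1 h2 h3] := rot_start Ap.
have sp : s p = k.-1 :> nat.
  have sk : s p < k.
    by case/orP: Ak => [Ak|/eqP->]; [exact: rot_lt|exact: ltn_ord].
  apply/eqP; rewrite eqn_leq; apply/andP; split; first by lia.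
  rewrite leqNgt; apply/negP => lt; have := pr (s p).+1; rewrite h3; last by lia.
  by move=> /(_ ltac:(lia)).
by rewrite -sp -(cntS w) sp prednK.
Qed.

Lemma rot_block k : ~~ A k -> k < n -> exists p, [/\ p < k, A p & k <= s p].
Proof.
move=> Ak kn; have k0 : 0 < k by rewrite lt0n; apply: contraNneq Ak => ->.
have [p [pk Ap pr _]] := @rot_cnt 1%g k 0 ltac:(lia); exists p; split=> //.
have [h1 h2 h3] := rot_start Ap; rewrite leqNgt; apply/negP => lt.
have : A (s p).+1 by apply: h3; lia.
have [E|ne] := eqVneq (s p).+1 k; first by rewrite E (negPf Ak).
by apply/negP; apply: pr; lia.
Qed.
End Theory.
End BlockRotations.

Section BottomElement.
Variable n : nat.
Variables (I J : pred nat) (a b : 'I_n) (ab : a != b).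
Local Open Scope nat_scope.
Hypothesis In : forall t, I t -> a <= t < n.
Hypothesis Jn : forall t, J t -> t <= b.
Hypothesis (Ia : I a) (Jb : J b).
Hypothesis IJ : forall t, I t -> J t ->
  (I t.+1 /\ J t.+1) \/ (0 < t /\ (I t.-1 /\ J t.-1)).

Let ab' : a <> b :> nat. Proof. by move/val_inj/eqP; rewrite (negPf ab). Qed.

Lemma cnt_shift (x : 'S_n) k T S : k <= n -> (forall p, T <= x p -> S <= p) -> cnt x k T <= k - S.
Proof.
move=> + H; elim: k => [|k IH] kn; first by rewrite cnt0.
have := cntS x (Ordinal kn) T; have := H (Ordinal kn); have := IH (ltnW kn) => /=.
by case: (T <= x (Ordinal kn)); lia.
Qed.

(* The blocks starting at top_start control the admissible positions of n-1, those
   starting at bot_start the positions of 0. *)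
Definition top_start r := (r < a) || I r.
Definition bot_stop := b + (b < a).
(** The threshold [vbot a j] is [j + 1] up to [a] and [j] afterwards, hence the shifted index in the
    third clause. At a common point of [I] and [J] a block of the other kind starts as well; the
    last clause lets a block start there only if the preceding point is common too. *)
Definition bot_start r := [|| r == 0, bot_stop <= r, [&& 0 < r, r <= a & J r.-1],
  [&& a < r, J r & ~~ I r] | [&& 0 < r, I r, J r, I r.-1 & J r.-1]].

Let top_start0 : top_start 0. Proof. by rewrite /top_start; case: posnP => // a0; rewrite -a0 Ia. Qed.
Let bot_start0 : bot_start 0. Proof. by []. Qed.

Lemma bot_stopE : bot_stop = b /\ a < b \/ bot_stop = b.+1 /\ b < a.
Proof. by rewrite /bot_stop; case: (ltnP b a) => h; lia. Qed.

Lemma top_start_in r : I r -> top_start r.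
Proof. by rewrite /top_start => ->; rewrite orbT. Qed.

Lemma top_start_le r : r <= a -> top_start r.
Proof. by rewrite leq_eqVlt /top_start => /orP[/eqP->|->] //; rewrite Ia orbT. Qed.

Lemma bot_start_ge r : bot_stop <= r -> bot_start r.
Proof. by rewrite /bot_start => ->; rewrite orbT. Qed.

(* A common endpoint of both kinds of blocks comes from two neighbours in the
   intersection. *)
Lemma common_block_end e : bot_start e.+1 -> I e.+1 -> a <= e -> e.+1 <= bot_stop -> I e /\ J e.
Proof.
rewrite /bot_start /= => De Ie ae ebe; have [ale _] := andP (In Ie).
case/or4P: De => [h|h|h|/and3P[_ _ /andP[]]] //.
- have [[bE _]|] := bot_stopE; last by lia.
  have eb : e.+1 = b by lia.
  have Je : J e.+1 by rewrite eb.
  by case: (IJ Ie Je) => [[_ /Jn]|[_ []]] //; lia.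
- by case/andP: h; lia.
- by case/and3P: h => _ _ /negP.
Qed.

Section Rotations.
Variables sI sD : 'S_n.
Hypothesis (rI : block_rotation top_start sI) (rD : block_rotation bot_start sD).

Definition bottom := (sI * sD^-1)%g.

Lemma bottomE p : sD (bottom p) = sI p. Proof. by rewrite permM permKV. Qed.

Lemma bottom_preimage r : exists2 m, sI m = sD r & bottom m = r.
Proof.
exists (sI^-1 (sD r))%g; first by rewrite permKV.
by rewrite permM permKV permK.
Qed.

Lemma bottom_le_vmin : tableau_le bottom (vmin ab).
Proof.
move=> k T; have an := ltn_ord a; have bn := ltn_ord b.
case: (leqP n k) => [nk|kn]; first by rewrite !cnt_out.
have kn' := ltnW kn; case: (posnP T) => [->|T0]; first by rewrite !cnt_T0.
case: (leqP n T) => [nT|Tn]; first by rewrite !cnt_big.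
rewrite cnt_vmin ?T0 //; pose w := (sD^-1)%g; pose K := k - (a < k).
have Kn : K <= n by rewrite /K; lia.
(* Up to [a] every position starts a block, so the first rotation preserves the counts; afterwards
   it adds at most one. The inverse of the second raises a value by at most one, and preserves the
   counts at boundaries beyond [b]. *)
have h1 : cnt bottom k T <= (a < k) + cnt w K T.
  rewrite /K; case: (ltnP a k) => ak.
    have := @rot_cnt_le _ _ _ top_start0 rI w k T kn'.
    by rewrite subn1 addnC; have -> : 0 < k by lia.
  by rewrite subn0 (rot_cnt_start top_start0 rI) // top_start_le.
have h2 : cnt w K T <= K - T.-1.
  apply: cnt_shift => // p Tp; have := rot_ge bot_start0 rD (w p); rewrite permKV; lia.
have h3 : b < k -> cnt w K T <= K - T.
  move=> bk; have DK : bot_start K by apply: bot_start_ge; rewrite /K; have := bot_stopE; lia.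
  rewrite -(rot_cnt_start bot_start0 rD w T Kn) ?DK // mulgV.
  by apply: cnt_shift => // p; rewrite perm1.
by move: h1 h2 h3; rewrite /K; case: (b < k) => [h1 h2 /(_ isT)|h1 h2 _]; lia.
Qed.

Lemma bottom_le_vtop i : I i -> a < i -> forall p : 'I_n, p < i -> bottom p <= vtop b i.
Proof.
move=> Ii ai p pi; have e1 := rot_lt top_start0 rI (top_start_in Ii) pi; have e2 := rot_ge bot_start0 rD (bottom p).
rewrite bottomE in e2; rewrite /vtop; case: (leqP b i) => bi; last by lia.
have Di : bot_start i by apply: bot_start_ge; have := bot_stopE; lia.
by case: (leqP i (bottom p)) => h; [have := rot_geq bot_start0 rD Di h; rewrite bottomE; lia|lia].
Qed.

Lemma bottom_ge c p : bot_start c -> c <= sI p -> c <= bottom p.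
Proof.
by move=> Dc cp; rewrite leqNgt; apply/negP => /(rot_lt bot_start0 rD Dc); rewrite bottomE; lia.
Qed.

Lemma bottom_ge_vbot (j : nat) : J j -> j < b -> forall p : 'I_n, j < p -> vbot a j <= bottom p.
Proof.
move=> Jj jb p jp; rewrite /vbot; have e1 := rot_ge top_start0 rI p.
have both : bot_start j.+1 -> top_start j.+1 -> j.+1 <= bottom p.
  by move=> Dj Aj; apply: bottom_ge => //; exact: (rot_geq top_start0 rI Aj).
have Dj : J j -> a < j -> ~~ I j -> j <= bottom p.
  move=> h1 h2 h3; apply: bottom_ge; last by rewrite -ltnS (leq_trans jp e1).
  by rewrite /bot_start h2 h1 h3 !orbT.
case: (ltngtP j a) => ja.
- rewrite addn1; apply: both; last exact: top_start_le.
  by rewrite /bot_start /= ja Jj !orbT.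
- rewrite addn0; case: (boolP (I j)) => Ij; last exact: Dj.
  case: (IJ Ij Jj) => [[h1 h2]|[h0 [h1 h2]]].
    by apply: ltnW; apply: both; rewrite ?top_start_in // /bot_start /= h1 h2 Ij Jj !orbT.
  by apply: bottom_ge; [rewrite /bot_start h0 Ij Jj h1 h2 !orbT|rewrite -ltnS (leq_trans jp e1)].
- rewrite addn1 in both *; have Ij : I j by rewrite ja.
  case: (IJ Ij Jj) => [[h1 h2]|[h0 [/In]]]; last by clear both Dj; lia.
  by apply: both; rewrite ?top_start_in // /bot_start /= h1 h2 Ij Jj !orbT.
Qed.

Lemma bot_stop_lt e : e < bot_stop -> a <= e -> e.+1 < n.
Proof. by have := ltn_ord a; have := ltn_ord b; have := bot_stopE; lia. Qed.

Lemma top_start_gt r : a <= r -> top_start r.+1 -> I r.+1.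
Proof. by move=> h /orP[|//]; lia. Qed.

(** By [common_block_end] such an end lies in [I], so it would start a block of [sI] itself, inside
    a block that begins earlier. *)
Lemma no_common_end (p r : 'I_n) : top_start p -> bot_start r -> sI p = sD r ->
  p < sI p -> a <= sI p < bot_stop -> False.
Proof.
move=> Ap Dr E pd /andP[ad db]; have dn := bot_stop_lt db ad.
have [_ h1 h2] := rot_start rI Ap; have [_ _ h3] := rot_start rD Dr.
rewrite -E in h3; have [Id _] := common_block_end (h3 dn) (top_start_gt ad (h2 dn)) ad db.
by have := h1 (sI p); rewrite pd leqnn top_start_in // => /(_ isT).
Qed.

Lemma bottom_gt_vtop k : ~~ I k -> a < k < n -> exists2 p : 'I_n, p < k & vtop b k < bottom p.
Proof.
move=> Ik /andP[ak kn]; have Ak : ~~ top_start k by rewrite /top_start negb_or Ik -leqNgt ltnW.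
have [p [pk Ap ke]] := rot_block top_start0 rI Ak kn; exists p => //.
rewrite /vtop; have E := bottomE p; case: (boolP (bot_start (bottom p))) => Du; last first.
  by have := rot_inner rD Du; rewrite E => <-; rewrite ltnS (leq_trans (leq_subr _ _) ke).
have [_ h1 _] := rot_start rD Du; rewrite E in h1.
case: (ltnP (sI p) bot_stop) => eb.
  by case: (no_common_end Ap Du (esym E) (leq_trans pk ke)); rewrite eb (leq_trans (ltnW ak) ke).
have le : sI p <= bottom p.
  by rewrite leqNgt; apply/negP => lt; have := h1 (sI p); rewrite lt leqnn (bot_start_ge eb) => /(_ isT).
by clear h1 E; have := bot_stopE; lia.
Qed.

(** The value sought is typically the start [r] of a block of [sD] that reaches the threshold. It is
    taken at the [m] with [sI m = sD r], and [m <= k] is excluded by the blocks of [sI], for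
    [k >= a] through [common_block_end]. *)
Lemma bottom_lt_vbot k : ~~ J k -> k < b -> exists2 p : 'I_n, k < p & bottom p < vbot a k.
Proof.
move=> Jk kb; have bn := ltn_ord b; have beE := bot_stopE; rewrite /vbot.
have D_end (r : 'I_n) : bot_start r -> r < sD r -> sD r < bot_stop.
  move=> Dr rd; rewrite ltnNge; apply/negP => /bot_start_ge Dd.
  by have [_ h _] := rot_start rD Dr; have := h (sD r); rewrite rd leqnn Dd => /(_ isT).
case: (ltngtP k a) => ka.
- have Dk : ~~ bot_start k.+1.
    apply/negP => /or4P[|h|/andP[_]|/orP[|]]; rewrite ?(negPf Jk) ?andbF //=; try lia.
  have [r [rk Dr kd]] := rot_block bot_start0 rD Dk ltac:(lia).
  have [m Em um] := bottom_preimage r; exists m; last by rewrite um; lia.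
  rewrite ltnNge -ltnS; apply/negP => /(rot_lt top_start0 rI (top_start_le ka)); rewrite Em; lia.
- have Dk : ~~ bot_start k.
    apply/negP => /or4P[|h|/and3P[]|/orP[|]]; rewrite ?(negPf Jk) ?andbF //=; try lia.
  have [r [rk Dr kd]] := rot_block bot_start0 rD Dk ltac:(lia).
  have [m Em um] := bottom_preimage r; exists m; last by rewrite um; lia.
  rewrite ltnNge; apply/negP => mk; have db := D_end r Dr ltac:(lia).
  have Am : top_start m by apply: contraT => /(rot_inner rI); rewrite Em; lia.
  case: (ltnP m (sI m)) => md.
    by case: (no_common_end Am Dr Em md); rewrite Em db (leq_trans (ltnW ka) kd).
  have [_ _ h2] := rot_start rI Am; have [_ _ h3] := rot_start rD Dr.
  rewrite Em in h2 md; have ad : a <= sD r := leq_trans (ltnW ka) kd.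
  have dn := bot_stop_lt db ad.
  have [_ Jd] := common_block_end (h3 dn) (top_start_gt ad (h2 dn)) ad db.
  have Ek : k = sD r by apply/eqP; rewrite eqn_leq kd (leq_trans md mk).
  by rewrite Ek Jd in Jk.
- case: (boolP (bot_start a.+1)) => Da.
    have [r Er] : exists r : 'I_n, sD r = a by exists (sD^-1 a)%g; rewrite permKV.
    have [m Em um] := bottom_preimage r; exists m.
      rewrite ltnNge ka; apply/negP => ma; rewrite Er in Em.
      have Am := top_start_le ma; have [h1 h2 h3] := rot_start rI Am.
      rewrite Em in h1 h2 h3.
      have Ia1 : I a.+1 by apply: top_start_gt => //; apply: h3; lia.
      have a_lt : a.+1 <= bot_stop by clear h1 h2 h3 Da; lia.
      by have [_ Ja] := common_block_end Da Ia1 (leqnn _) a_lt; rewrite ka Ja in Jk.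
    rewrite um addn1 ka ltnS leqNgt; apply/negP => ar; have := rot_geq bot_start0 rD Da (m := r).
    by rewrite Er; lia.
  have [r [rk Dr kd]] := rot_block bot_start0 rD Da ltac:(lia).
  have [m Em um] := bottom_preimage r; exists m; last by rewrite um; lia.
  rewrite ltnNge ka; apply/negP => ma; have db := D_end r Dr ltac:(lia).
  by case: (no_common_end (top_start_le ma) Dr Em); rewrite Em ?(leq_ltn_trans ma kd) // (ltnW kd) db.
Qed.
End Rotations.

Lemma bottom_exists : exists u : 'S_n, [/\ tableau_le u (vmin ab),
  forall i, I i -> a < i -> forall p : 'I_n, p < i -> u p <= vtop b i,
  forall j, J j -> j < b -> forall p : 'I_n, j < p -> vbot a j <= u p,
  forall k, ~~ I k -> a < k < n -> exists2 p : 'I_n, p < k & vtop b k < u p &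
  forall k, ~~ J k -> k < b -> exists2 p : 'I_n, k < p & u p < vbot a k].
Proof.
have [sI rI] := block_rotation_exists n top_start0; have [sD rD] := block_rotation_exists n bot_start0.
exists (sI * sD^-1)%g; split.
- exact: bottom_le_vmin.
- exact: bottom_le_vtop.
- exact: bottom_ge_vbot.
- exact: bottom_gt_vtop.
- exact: bottom_lt_vbot.
Qed.
End BottomElement.

(** * Positions attained in the interval *)

Section IntervalVertices.
Variables (n : nat) (I J : pred nat) (a b : 'I_n) (ab : a != b) (u : 'S_n).
Local Open Scope nat_scope.
Hypothesis In : forall t, I t -> a <= t < n.
Hypothesis Jn : forall t, J t -> t <= b.
Hypothesis (Ia : I a) (Jb : J b).
Hypothesis IJ : forall t, I t -> J t ->
  (I t.+1 /\ J t.+1) \/ (0 < t /\ (I t.-1 /\ J t.-1)).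
Hypothesis u_le : tableau_le u (vmin ab).
Hypothesis u_top : forall i, I i -> a < i -> forall p : 'I_n, p < i -> u p <= vtop b i.
Hypothesis u_bot : forall j, J j -> j < b -> forall p : 'I_n, j < p -> vbot a j <= u p.
Implicit Types (i j p q : 'I_n) (y : 'S_n).

Definition in_interval y := tableau_le u y /\ tableau_le y (vmin ab).
Local Notation v := (vmin ab).
Let ab' : a <> b :> nat. Proof. by move/val_inj/eqP; rewrite (negPf ab). Qed.

Let n2 : 1 < n. Proof. by have := ltn_ord a; have := ltn_ord b; lia. Qed.

Let interval_vmin : in_interval v. Proof. by split=> // k T; exact: leqnn. Qed.

Lemma tperm_mulL y p q : (tperm p q * y)%g p = y q. Proof. by rewrite permM tpermL. Qed.
Lemma tperm_mulR y p q : (tperm p q * y)%g q = y p. Proof. by rewrite permM tpermR. Qed.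
Lemma tperm_mulD y p q i : i <> p :> nat -> i <> q :> nat -> (tperm p q * y)%g i = y i.
Proof.
by move=> ip iq; rewrite permM tpermD // eq_sym; apply/eqP => E; [apply: ip|apply: iq]; rewrite E.
Qed.

Lemma interval_zero_move y j j' : in_interval y -> y j' = 0 :> nat -> j <= j' -> J j ->
  (j < j' -> y j <= vbot a j) -> in_interval (tperm j j' * y)%g.
Proof.
move=> [uy yv] y0 jj' Jj; case: (ltnP j j') => [lt /(_ isT) yj|ge _]; last first.
  have -> : j = j' by apply: val_inj => /=; lia.
  by rewrite tperm1 mul1g.
have jb := bot_gt_b n2 yv y0.
have [h1 h2] := zero_move jj' y0 yj (@u_bot _ Jj (leq_trans lt jb)) uy.
by split=> //; exact: tableau_le_trans h2 yv.
Qed.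

Lemma interval_top_move y i i' : in_interval y -> y i' = n.-1 :> nat -> i' <= i -> I i ->
  (i' < i -> vtop b i <= y i) -> in_interval (tperm i' i * y)%g.
Proof.
move=> [uy yv] y0 ii' Ii; case: (ltnP i' i) => [lt /(_ isT) yi|ge _]; last first.
  have -> : i = i' by apply: val_inj => /=; lia.
  by rewrite tperm1 mul1g.
have ai := top_lt_a n2 yv y0.
have [h1 h2] := top_move ii' y0 yi (@u_top _ Ii (leq_ltn_trans ai lt)) uy.
by split=> //; exact: tableau_le_trans h2 yv.
Qed.

Lemma interval_split_move y j' : in_interval y -> j' = a.+1 :> nat -> y j' <= y a -> J a -> a < b ->
  in_interval (tperm a j' * y)%g.
Proof.
move=> [uy yv] jE yj Ja lt.
have ub p : a < p -> a < u p by have := @u_bot _ Ja lt p; rewrite /vbot leqnn addn1.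
have [h1 h2] := split_move jE yj ub uy.
by split=> //; exact: tableau_le_trans h2 yv.
Qed.

Let v_top i : a < i -> i <> b :> nat -> vtop b i <= v i.
Proof.
by move=> ai ib; apply: (vmin_top n2); rewrite -val_eqE /=; [rewrite gtn_eqF|exact/eqP].
Qed.

Let v_bot j : j <> a :> nat -> j < b -> v j <= vbot a j.
Proof.
by move=> ja jb; apply: (vmin_bot n2); rewrite -val_eqE /=; [exact/eqP|rewrite ltn_eqF].
Qed.

Let v_mid i : a < i < b -> v i = i :> nat.
Proof.
by move=> /andP[ai ib]; rewrite vmin_other -?val_eqE /=; lia.
Qed.

Lemma next_common : J a -> I a.+1 /\ J a.+1.
Proof.
by move=> /(IJ Ia)[//|[a0 [/In/andP[+ _] _]]]; rewrite -ltnS prednK // ltnn.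
Qed.

Lemma prev_common : I b -> I b.-1 /\ J b.-1.
Proof. by move=> Ib; case: (IJ Ib Jb) => [[_ /Jn]|[_ []]] //; rewrite ltnn. Qed.

#[local] Hint Resolve vmin_a vmin_b : core.

(** Starting from [vmin], 0 moves left from [b] to [j] and then [n - 1] right from [a] to [i]. If
    [i = b] or [j = a] the two values obstruct each other, and the common neighbour [b - 1] or
    [a + 1] is used as an intermediate place. *)
Lemma interval_pair i j : I i -> J j -> i <> j :> nat ->
  exists y, [/\ in_interval y, y i = n.-1 :> nat & y j = 0 :> nat].
Proof.
move=> Ii Jj ij; have an := ltn_ord a; have bn := ltn_ord b.
have [ai _] := andP (In Ii); have jb := Jn Jj.
have [ib|ib] := eqVneq (i : nat) b.
  have Ib : I b by rewrite -ib.
  have [Ic Jc] := prev_common Ib.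
  have cn : b.-1 < n by lia.
  have [c cE] : exists c : 'I_n, c = b.-1 :> nat by exists (Ordinal cn).
  rewrite -cE in Ic Jc.
  have [ac _] := andP (In Ic).
  have alb : a < b by lia.
  have {}ib : i = b by exact: val_inj.
  subst i; have [ca|ca] := eqVneq (c : nat) a.
    have bE : b = a.+1 :> nat by lia.
    have Ja : J a by rewrite -ca.
    have g1 : in_interval (tperm a b * v)%g by apply: interval_split_move => //; rewrite vmin_b.
    have [ja|ja] := eqVneq (j : nat) a.
      have {}ja : j = a by exact: val_inj.
      by subst j; exists (tperm a b * v)%g; split=> //; rewrite ?tperm_mulL ?tperm_mulR.
    exists (tperm j a * (tperm a b * v))%g; split.
    - apply: interval_zero_move => //; rewrite ?tperm_mulL //; first by lia.
      by move=> lt; rewrite tperm_mulD; [apply: v_bot; lia|lia|lia].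
    - by rewrite tperm_mulD; [rewrite tperm_mulR|lia|lia].
    - by rewrite tperm_mulL tperm_mulL.
  have lac : a < c by lia.
  have g1 : in_interval (tperm c b * v)%g.
    apply: interval_zero_move => //; first by lia.
    by move=> lt; apply: v_bot => //; lia.
  have y1b : (tperm c b * v)%g b = c :> nat by rewrite tperm_mulR v_mid //; lia.
  have g2 : in_interval (tperm a b * (tperm c b * v))%g.
    apply: interval_top_move => //; first by rewrite tperm_mulD; [|lia|lia].
    by move=> _; rewrite y1b /vtop leqnn; lia.
  set y2 := (tperm a b * (tperm c b * v))%g in g2.
  have y2b : y2 b = n.-1 :> nat by rewrite tperm_mulR tperm_mulD; [|lia|lia].
  have y2a : y2 a = c :> nat by rewrite tperm_mulL y1b.
  have y2c : y2 c = 0 :> nat by rewrite tperm_mulD; [rewrite tperm_mulL|lia|lia].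
  have cb : c < b by rewrite cE; lia.
  have y2o q : q <> a :> nat -> q < c -> y2 q = v q.
    by move=> qa qc; have qb := ltn_trans qc cb; rewrite !tperm_mulD //; apply/eqP; rewrite ltn_eqF.
  have [ja|ja] := eqVneq (j : nat) a; last first.
    exists (tperm j c * y2)%g; split; rewrite ?tperm_mulL //.
    - apply: interval_zero_move => //; first by lia.
      by move=> lt; rewrite y2o; [apply: v_bot (ltn_trans lt cb); exact/eqP|exact/eqP|].
    - by rewrite tperm_mulD //; lia.
  (* The value [c] now at [a] may exceed [vbot a a], so 0 stops at [a + 1] and crosses the last cut
     by a split move. *)
  have {}ja : j = a by exact: val_inj.
  subst j; have [_ Jd] := next_common Jj.
  have dn : a.+1 < n by lia.
  have [d dE] : exists d : 'I_n, d = a.+1 :> nat by exists (Ordinal dn).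
  rewrite -dE in Jd.
  have g3 : in_interval (tperm d c * y2)%g.
    apply: interval_zero_move => //; first by rewrite dE.
    have da : d <> a :> nat by rewrite dE; apply/eqP; rewrite gtn_eqF.
    by move=> lt; rewrite y2o; [apply: v_bot (ltn_trans lt cb)| |].
  exists (tperm a d * (tperm d c * y2))%g; split.
  - by apply: interval_split_move => //; rewrite tperm_mulL y2c.
  - by rewrite tperm_mulD; [rewrite tperm_mulD; [|lia|lia]|lia|lia].
  - by rewrite tperm_mulL tperm_mulL.
have [ja|ja] := eqVneq (j : nat) a; last first.
  have g1 : in_interval (tperm j b * v)%g.
    by apply: interval_zero_move => // lt; apply: v_bot => //; lia.
  exists (tperm a i * (tperm j b * v))%g; split; rewrite ?tperm_mulR.
  - apply: interval_top_move => //; first by rewrite tperm_mulD; [|lia|lia].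
    by move=> lt; rewrite tperm_mulD; [apply: v_top; lia|lia|lia].
  - by rewrite tperm_mulD; [|lia|lia].
  - by rewrite tperm_mulD; [rewrite tperm_mulL|lia|lia].
have {}ja : j = a by exact: val_inj.
subst j; have [Id Jd] := next_common Jj.
have db := Jn Jd; have dn : a.+1 < n by lia.
have [d dE] : exists d : 'I_n, d = a.+1 :> nat by exists (Ordinal dn).
rewrite -dE in Id Jd db.
have alb : a < b by lia.
have [bd|bd] := eqVneq (b : nat) a.+1.
  exists (tperm b i * (tperm a b * v))%g; split; rewrite ?tperm_mulR //.
  - apply: interval_top_move => //; rewrite ?tperm_mulR //.
    + by apply: interval_split_move => //; rewrite vmin_b.
    + by lia.
    + by move=> lt; rewrite tperm_mulD; [apply: v_top; lia|lia|lia].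
  - by rewrite tperm_mulD; [rewrite tperm_mulL|lia|lia].
have g1 : in_interval (tperm a d * v)%g.
  apply: interval_top_move => //; first by rewrite dE.
  by move=> lt; apply: v_top => //; lia.
have g2 : in_interval (tperm a b * (tperm a d * v))%g.
  apply: interval_zero_move => //; first by rewrite tperm_mulD; [|lia|lia].
  by move=> _; rewrite tperm_mulL v_mid /vbot ?leqnn; lia.
exists (tperm d i * (tperm a b * (tperm a d * v)))%g; split; rewrite ?tperm_mulR.
- apply: interval_top_move => //; first by rewrite tperm_mulD; [rewrite tperm_mulR|lia|lia].
    by lia.
  move=> lt; rewrite tperm_mulD; [|lia|lia].
  by rewrite tperm_mulD; [apply: v_top; lia|lia|lia].
- by rewrite tperm_mulD; [rewrite tperm_mulR|lia|lia].
- rewrite tperm_mulD; [|lia|lia]; rewrite tperm_mulL.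
  by rewrite tperm_mulD; [|lia|lia].
Qed.
End IntervalVertices.

Lemma vertex_pairs_exist (R : realType) n (I J : {set 'I_n}) : (1 < n)%N ->
  (exists i, i \in I) -> (exists j, j \in J) ->
  (forall m, m \in I -> m \in J ->
     exists m', [/\ m' \in I, m' \in J & (m' == m.+1 :> nat) || (m'.+1 == m :> nat)]) ->
  exists u v, [/\ bruhat_le u v, bruhat_minimal R 1 (n - 1) v & vertex_pairs I J u v].
Proof.
move=> n2 [i0 i0I] [j0 j0J] IJ.
case: (arg_minnP (fun i : 'I_n => i : nat) i0I) => a aI amin.
case: (arg_maxnP (fun i : 'I_n => i : nat) j0J) => b bJ bmax.
(* Otherwise this point would be common to both sets, with no point of [J] after it and none of [I]
   before it. *)
have ab : a != b.
  apply/eqP => E; subst b; have [m [mI mJ /orP[/eqP h|/eqP h]]] := IJ a aI bJ.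
    by have := bmax m mJ; rewrite /= h; lia.
  by have := amin m mI; rewrite -h; lia.
have inNP S t : inN S t -> exists2 i : 'I_n, i \in S & i = t :> nat.
  by case/existsP => i /andP[iS /eqP]; exists i.
have In t : inN I t -> (a <= t < n)%N.
  by case/inNP => i iI <-; rewrite ltn_ord amin.
have Jn t : inN J t -> (t <= b)%N by case/inNP => j jJ <-; exact: bmax.
have IJn t : inN I t -> inN J t ->
    (inN I t.+1 /\ inN J t.+1) \/ ((0 < t)%N /\ (inN I t.-1 /\ inN J t.-1)).
  case/inNP => m mI <-; rewrite inNE => mJ.
  have [m' [m'I m'J /orP[/eqP h|/eqP h]]] := IJ m mI mJ.
    by left; rewrite -h !inNE.
  by right; rewrite -h /= !inNE.
have Ia : inN I a by rewrite inNE.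
have Jb : inN J b by rewrite inNE.
have [u [uv top bot topN botN]] := bottom_exists ab In Jn Ia Jb IJn.
exists u, (vmin ab); split; [exact/bruhatE|exact: vmin_minimal|].
move=> i j ij; have ij' : i <> j :> nat by move/val_inj/eqP; rewrite (negPf ij).
split=> [[iI jJ]|[x [/bruhatE ux /bruhatE xv xi xj]]].
  have [||x [[ux xv] xi xj]] := interval_pair In Jn Ia Jb IJn uv top bot _ _ ij'; rewrite ?inNE //.
  by exists x; split=> //; exact/bruhatE.
split.
  have ai := top_lt_a n2 xv xi; rewrite -inNE; apply: contraT => iI.
  have [E|ia] := eqVneq i a; first by rewrite E Ia in iI.
  have ai' : (a < i < n)%N by rewrite ltn_ord andbT; move: ia; rewrite -val_eqE /=; lia.
  have [p pi up] := topN i iI ai'.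
  by case: (top_excluded n2 ux xv pi up xi).
have jb := bot_gt_b n2 xv xj; rewrite -inNE; apply: contraT => jJ.
have [E|jb'] := eqVneq j b; first by rewrite E Jb in jJ.
have jb2 : (j < b)%N by move: jb'; rewrite -val_eqE /=; lia.
have [p jp up] := botN j jJ jb2.
by case: (bot_excluded n2 ux xv jb2 jp up xj).
Qed.

(** * Bruhat subdivisions and the isolated minimum *)

Section BruhatSubdivisions.
Variables (R : realType) (n : nat) (mu nu : {set 'I_n} -> \bar R).
Local Notation l := (lam mu nu).
Local Notation M := (argmin_lam mu nu).

Definition no_isolated_min := forall m : 'I_n, m \in M ->
  exists m' : 'I_n, m' \in M /\ (m' == m.+1 :> nat) || (m'.+1 == m :> nat).

(** A minimal value equals the minimum of its neighbours exactly when a neighbour is minimal too;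
    the infinite values outside the range never help, and if [l] is infinite everywhere both sides
    hold. *)
Lemma no_isolated_minP : (forall i, (1 <= i <= n)%N ->
    (forall j, (1 <= j <= n)%N -> (l i <= l j)%E) -> l i = mine (l i.-1) (l i.+1)) <->
  no_isolated_min.
Proof.
split=> [H m /argmin_lamP[mf mmin]|H i /andP[i0 iN] imin].
  have mn : (1 <= m.+1 <= n)%N by exact: ltn_ord.
  have : l m.+1 = mine (l m) (l m.+2).
    apply: H mn _ => j /andP[j0 jn]; have jn' : (j.-1 < n)%N by lia.
    by have := mmin (Ordinal jn'); rewrite /= prednK.
  have inM k (kn : (k < n)%N) : l m.+1 = l k.+1 -> Ordinal kn \in M.
    by move=> E; apply/argmin_lamP; rewrite /= -E.
  rewrite minEle; case: ifP => _ E.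
    have m0 : (0 < m)%N by rewrite lt0n; apply: contraNneq mf => m0; rewrite E m0 lam_out.
    have kn : (m.-1 < n)%N by have := ltn_ord m; lia.
    exists (Ordinal kn); split; first by apply: inM; rewrite prednK.
    by rewrite /= prednK // eqxx orbT.
  have kn : (m.+1 < n)%N.
    by rewrite ltnNge; apply: contraNN mf => h; rewrite E lam_out //; lia.
  by exists (Ordinal kn); split; [exact: inM|rewrite /= eqxx].
have le_min' k : (l i <= l k)%E.
  by case: (boolP (0 < k <= n)%N) => [/imin//|/(lam_out mu nu) ->]; exact: leey.
apply/eqP; rewrite eq_le le_min !le_min' /= ge_min.
have [iy|iy] := eqVneq (l i) +oo%E; first by rewrite iy !leey.
have im : (i.-1 < n)%N by lia.
have [|m' [/argmin_lamP[_ m'min] m'i]] := H (Ordinal im).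
  apply/argmin_lamP; rewrite /= prednK //; split=> // j; exact: le_min'.
have {}m'min : (l m'.+1 <= l i)%E by have := m'min (Ordinal im); rewrite /= prednK.
by case/orP: m'i => /= /eqP E; [have <- : m'.+1 = i.+1 by lia|have <- : m'.+1 = i.-1 by lia];
  rewrite m'min ?orbT.
Qed.

Hypothesis n3 : (3 <= n)%N.
Hypothesis (mu_proper : proper_on n (elt_val mu)) (nu_proper : proper_on n (coelt_val nu)).
Hypothesis flag : plucker_rel 1 (n - 1) mu nu.
Let n2 : (1 < n)%N := ltnW n3.

Lemma bruhat_subdivision_minimum : bruhat_subdivision2 1 (n - 1) mu nu -> no_isolated_min.
Proof.
move=> H m mM; apply: contrapT => iso.
have [x [Ix Jx]] := cell_argmin_lam n2 mu_proper nu_proper mM.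
have [u [v [uv minv E]]] := H x.
rewrite (cellE _ _ n2) Ix Jx in E.
have Mother k : k \in M -> exists k', k' != k /\ k' \in M.
  by move=> /(argmin_lam_other n3 flag)[k' [h1 h2 _]]; exists k'.
apply: (vertex_pairs_no_isolated n2 uv minv Mother mM _
  (bruhat_polytope_vertices n2 (esym E))) => k kM.
by apply/andP; rewrite -negb_or; apply/negP => h; apply: iso; exists k.
Qed.

Lemma minimum_bruhat_subdivision : no_isolated_min -> bruhat_subdivision2 1 (n - 1) mu nu.
Proof.
move=> H x; have cM m : m \in cellI mu x -> m \in cellJ nu x ->
    exists m', [/\ m' \in cellI mu x, m' \in cellJ nu x &
                   (m' == m.+1 :> nat) || (m'.+1 == m :> nat)].
  move=> mI mJ; have meet := cell_meet n2 mu_proper nu_proper mI mJ.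
  have [m' [/meet[m'I m'J] h]] := H m ((meet m).2 (conj mI mJ)).
  by exists m'.
have [u [v [uv minv vp]]] := vertex_pairs_exist R n2 (cellI_neq0 mu n2 x) (cellJ_neq0 nu n2 x) cM.
exists u, v; split=> //; rewrite (cellE _ _ n2); apply: esym; apply: (vertices_bruhat_polytope R n2 vp).
move=> m mI mJ; have [m' [m'I m'J h]] := cM m mI mJ; exists m'; split=> //.
by apply: contraTneq h => ->; lia.
Qed.
End BruhatSubdivisions.

Lemma valuated_point_proper (R : realType) n (mu : {set 'I_n} -> \bar R) :
  valuated_matroid 1 mu ->
  proper_on n (elt_val mu).
Proof.
have E (i : 'I_n) : mu [set i] = elt_val mu i.
  by rewrite /elt_val; congr mu; apply/setP => k; rewrite !inE.
case=> muN [B [/eqP/cards1P[i ->]]]; rewrite E => mui _; split; first by exists i.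
by move=> t tn; have := muN [set Ordinal tn]; rewrite cards1 E; apply.
Qed.

Lemma valuated_copoint_proper (R : realType) n (nu : {set 'I_n} -> \bar R) : (0 < n)%N ->
  valuated_matroid (n - 1) nu ->
  proper_on n (coelt_val nu).
Proof.
move=> n0; have E (i : 'I_n) : nu (~: [set i]) = coelt_val nu i.
  by rewrite /coelt_val; congr nu; apply/setP => k; rewrite !inE.
have cC (B : {set 'I_n}) : #|~: B| = (n - #|B|)%N by rewrite cardsCs finset.setCK card_ord.
case=> nuN [B [Bn nuB _]]; split.
  have /eqP/cards1P[i Bi] : #|~: B| = 1%N by rewrite cC Bn; lia.
  by move: nuB; rewrite -(finset.setCK B) Bi E; exists i.
by move=> t tn; have := nuN (~: [set Ordinal tn]); rewrite cC cards1 E; apply.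
Qed.

Local Close Scope ring_scope.
Theorem theorem1p2 (R : realType) (n : nat) (mu nu : {set 'I_n} -> \bar R) :
  (3 <= n)%N ->
  valuated_flag_matroid2 1 (n - 1) mu nu ->
  let l := lam mu nu in
  [/\
   (* 1 *)
   totally_nonnegative2 1 (n - 1) mu nu <->
     (forall i, (1 <= i <= n)%N -> (mine (l i.-1) (l i.+1) <= l i)%E),
   (* 2 *)
   bruhat_subdivision2 1 (n - 1) mu nu <->
     (forall i, (1 <= i <= n)%N ->
        (forall j, (1 <= j <= n)%N -> (l i <= l j)%E) ->
        l i = mine (l i.-1) (l i.+1)) &
   (* 3 *)
   (valuated_flag_positroid2 1 (n - 1) mu nu <->
      flag_positroid_subdivision2 1 (n - 1) mu nu) /\
   (valuated_flag_positroid2 1 (n - 1) mu nu <->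
      \big[mine/+oo%E]_(1 <= i < n.+1 | odd i) l i =
      \big[mine/+oo%E]_(1 <= i < n.+1 | ~~ odd i) l i)].
Proof.
move=> n3 [_ vmu vnu flag] l.
have mup := valuated_point_proper vmu.
have nup := valuated_copoint_proper (ltnW (ltnW n3)) vnu.
split.
- by split; [exact: totally_nonnegative_lam|exact: lam_totally_nonnegative].
- by split=> [/bruhat_subdivision_minimum H|H];
    [apply/no_isolated_minP; exact: H|
     apply: minimum_bruhat_subdivision => //; exact/no_isolated_minP].
have balP := parity_balancedP l n3.
have posP : valuated_flag_positroid2 1 (n - 1) mu nu <-> parity_balanced n l.
  by split; [exact: flag_positroid_balanced|exact: balanced_flag_positroid].
split; last by split=> [/posP/balP|/balP/posP].
split=> [/posP|/positroid_subdivision_balanced H].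
  exact: balanced_positroid_subdivision.
by apply/posP; exact: H.
Qed.
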